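(* Let $\{x_k\}_{k\ge0}$ be a sequence of nonnegative numbers infinitely many of which are positive, with generating function $f(z)=\sum_{k\ge0}x_kz^k$ of convergence radius $\sigma$. Suppose that $f$ is meromorphic in an open set containing $\{z\in\mathbb C:|z|\le\sigma\}$, that $z=\sigma$ is a pole of $f$ of finite order $\breve m\ge1$, and that $f$ has exactly $P\ge1$ dominant poles $\sigma_0,\dots,\sigma_{P-1}$, where $\sigma_0=\sigma$ and $0=\arg\sigma_0<\arg\sigma_1<\cdots<\arg\sigma_{P-1}<2\pi$. Let $a_{1,k}=(\sigma+\varepsilon_0)^{-k}$ for a sufficiently small $\varepsilon_0>0$, and $a_{m,k}=k^{m-2}/\sigma^k$ for $m\ge2$. Then: (a) $x_k=\binom{k+\breve m-1}{\breve m-1}\sigma^{-k}\xi_k+O(a_{\breve m,k})=\frac{k^{\breve m-1}}{(\breve m-1)!}\sigma^{-k}\xi_k+O(a_{\breve m,k})$ as $k\to\infty$, where $\xi_k=\sum_{j=0}^{P-1}(\sigma/\sigma_j)^k\lim_{z\to\sigma_j}(1-z/\sigma_j)^{\breve m}f(z)$; (b) $\limsup_{k\to\infty}\xi_k>0$; (c) $\xi_k\ge0$ for all $k\ge0$; (d) if in addition $\{x_k\}$ is eventually nonincreasing and $(\arg\sigma_j)/\pi$ is rational for every $j=0,\dots,P-1$, then $\xi_k>0$ for all $k\ge0$.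
   Context: A dominant pole of $f$ is a pole of $f$ lying on the circle $\{|z|=\sigma\}$ whose order equals $\breve m$, the order of the pole at $z=\sigma$. The convergence radius is $\sigma=\sup\{|z|:\sum_k x_kz^k<\infty\}$. *)

(* Defs.v *)
From Stdlib Require Import Reals.
From Coquelicot Require Import Coquelicot.
Open Scope R_scope.


Fixpoint Csum_lt (f : nat -> C) (n : nat) : C :=
  match n with O => RtoC 0 | S n => Cplus (Csum_lt f n) (f n) end.

Definition expi (t : R) : C := (cos t, sin t).

Definition holomorphic_on_ball (g : C -> C) (z0 : C) (r : R) : Prop :=
  forall z : C, Cmod (Cminus z z0) < r ->
    @ex_derive C_AbsRing C_NormedModule g z.

(* f is meromorphic on the open set U: every point z0 of U has a disc
   in which f(z) = g(z)/(z-z0)^m for z <> z0, with g holomorphic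
   (values of f at the isolated singularities are irrelevant). *)
Definition meromorphic_on (U : C -> Prop) (f : C -> C) : Prop :=
  (forall z0, U z0 -> exists r, 0 < r /\ forall z, Cmod (Cminus z z0) < r -> U z) /\
  (forall z0, U z0 -> exists (r : R) (m : nat) (g : C -> C),
     0 < r /\ holomorphic_on_ball g z0 r /\
     forall z, Cmod (Cminus z z0) < r -> z <> z0 ->
       f z = Cdiv (g z) (Cpow (Cminus z z0) m)).

Definition is_pole_of_order (f : C -> C) (z0 : C) (m : nat) : Prop :=
  (1 <= m)%nat /\
  exists (r : R) (g : C -> C),
    0 < r /\ holomorphic_on_ball g z0 r /\ g z0 <> RtoC 0 /\
    forall z, Cmod (Cminus z z0) < r -> z <> z0 ->
      f z = Cdiv (g z) (Cpow (Cminus z z0) m).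

Definition conv_radius (x : nat -> R) : Rbar :=
  Lub_Rbar (fun r => 0 <= r /\ ex_series (fun k => x k * r ^ k)).

Definition a_seq (sigma eps0 : R) (m k : nat) : R :=
  match m with
  | 1%nat => / (sigma + eps0) ^ k
  | _ => INR k ^ (m - 2) / sigma ^ k
  end.

Definition bigO_seq (u : nat -> R) (a : nat -> R) : Prop :=
  exists (K : nat) (M : R), forall k, (K <= k)%nat -> Rabs (u k) <= M * a k.

(* Main.v *)
(** The poles of [f] on [|z| = sigma] are cleared by a polynomial
    [Q = prod (1 - z / p)]: by compactness [Q f] extends holomorphically across
    the circle, so by Cauchy's theorem its coefficients are [O(rho^-k)] for some
    [rho > sigma].  Dividing by one factor of [Q] at a time gives
    [x_k = sum_(q, a) beta q a * binomial (k + a) a * q^-k + O(rho^-k)].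
    Comparing with the radial limits of [(1 - t)^D f (t q)] as [t -> 1-] identifies
    the coefficients: since [x_k >= 0], [|f (t q)| <= f (t sigma)], so no order
    exceeds [m]; those of order [m] are the [c_j].  This is (a).

    Dividing (a) by the leading binomial, [xi_k] is asymptotic to a nonnegative
    sequence.  A finite sum of powers of unit complex numbers is recurrent, hence
    [xi_k >= 0] for every [k], and the limsup is positive unless [xi] is identically
    zero, which would lower the order of the pole at [sigma].  With rational angles
    [xi] is periodic, and a zero of [xi] would, by monotonicity of [x], propagate to all
    later indices.

    Only complex differentiability is assumed, so Cauchy's theorem is proved from
    Goursat's bisection, applied to [w |-> F (e^w)]: rectangles in [w] are
    annuli in [z], and the mean of [F] over [|z| = r] does not depend on [r]. *)

Require Import Defs.
From Stdlib Require Import ZArith Reals Factorial Lra Lia Psatz Compare_dec Classical ClassicalEpsilon List.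
From Coquelicot Require Import Coquelicot.
Open Scope R_scope.

(** * Complex differentiability *)

(** The orders of the poles on the circle are not bounded in advance, and the values of [f] at its
    singularities are arbitrary. So [f] is compared with the expansion only along radii inside the
    disc, where it equals its series. Partial fractions are replaced by a class of sequences,
    [expo], closed under solving [v k - v (k - 1) / p = u k]; membership says nothing about the
    coefficients, which are found afterwards from radial limits. A local representation
    [g / (z - q)^d] may have [g q = 0], so [d] need not be the order of a pole. To recognise a
    dominant pole from a nonzero radial limit, surplus factors are cancelled by [removable_zero],
    which rests on Taylor expansion and thus on Cauchy's formula. In the logarithmic coordinate the
    two sides that close up the annulus cancel by periodicity, so rectangles are the only contours.
    The gap [rho - sigma] between the circle and the radius of the error term is the bound on [eps0]
    in (a). *)

Definition ccont (f : C -> C) (z : C) : Prop :=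
  forall eps, 0 < eps -> exists del, 0 < del /\
    forall w, Cmod (w - z) < del -> Cmod (f w - f z) < eps.

Definition cderiv (f : C -> C) (z d : C) : Prop :=
  forall eps, 0 < eps -> exists del, 0 < del /\
    forall w, Cmod (w - z) < del ->
      Cmod (f w - f z - d * (w - z)) <= eps * Cmod (w - z).

Definition cdiff (f : C -> C) (z : C) : Prop := exists d, cderiv f z d.

Lemma Cmod_minus_sym (a b : C) : Cmod (a - b) = Cmod (b - a).
Proof. rewrite <- Cmod_opp. f_equal. ring. Qed.

Lemma Cmod_triangle_minus (a b : C) : Cmod (a - b) <= Cmod a + Cmod b.
Proof. unfold Cminus. rewrite <- (Cmod_opp b). apply Cmod_triangle. Qed.

Lemma Cmod_triangle_inv (a b : C) : Cmod a - Cmod b <= Cmod (a - b).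
Proof.
  assert (H := Cmod_triangle (a - b) b).
  replace (a - b + b)%C with a in H by ring. lra.
Qed.

Lemma Cmod_RtoC_nonneg (r : R) : 0 <= r -> Cmod (RtoC r) = r.
Proof. intros H. rewrite Cmod_R. apply Rabs_pos_eq, H. Qed.

Lemma Cmod_minus_eq_0 (a b : C) : Cmod (a - b) = 0 -> a = b.
Proof. intros H. apply Ceq_minus, Cmod_eq_0, H. Qed.

Lemma Cmod_minus_small_eq (a b : C) :
  (forall eps, 0 < eps -> Cmod (a - b) <= eps) -> a = b.
Proof.
  intros H. apply Cmod_minus_eq_0.
  destruct (Rle_lt_or_eq_dec 0 (Cmod (a - b)) (Cmod_ge_0 _)) as [Hp|He]; [|easy].
  specialize (H (Cmod (a - b) / 2)). lra.
Qed.

Lemma Cmod_self_minus (a : C) : Cmod (a - a) = 0.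
Proof. replace (a - a)%C with (RtoC 0) by ring. apply Cmod_0. Qed.

Lemma Cmod_le_add (a : C) : Cmod a <= Rabs (fst a) + Rabs (snd a).
Proof.
  destruct a as [x y]; simpl.
  replace (x, y) with (RtoC x + Ci * RtoC y)%C
    by (unfold RtoC, Ci, Cplus, Cmult; simpl; f_equal; ring).
  eapply Rle_trans; [apply Cmod_triangle|].
  rewrite Cmod_mult, Cmod_Ci, !Cmod_R. lra.
Qed.

Lemma fst_le_Cmod (a : C) : Rabs (fst a) <= Cmod a.
Proof. eapply Rle_trans; [apply Rmax_l | apply Rmax_Cmod]. Qed.

Lemma snd_le_Cmod (a : C) : Rabs (snd a) <= Cmod a.
Proof. eapply Rle_trans; [apply Rmax_r | apply Rmax_Cmod]. Qed.

Lemma Cmod_pos_neq_0 (a : C) : 0 < Cmod a -> a <> 0.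
Proof. intros H. now apply Cmod_gt_0. Qed.

Lemma ccont_const (k z : C) : ccont (fun _ => k) z.
Proof.
  intros eps He. exists 1. split; [lra|]. intros w _. now rewrite Cmod_self_minus.
Qed.

Lemma ccont_id (z : C) : ccont (fun w => w) z.
Proof. intros eps He. now exists eps. Qed.

Lemma ccont_ext_loc (f g : C -> C) (z : C) (r : R) : 0 < r ->
  (forall w, Cmod (w - z) < r -> f w = g w) -> ccont f z -> ccont g z.
Proof.
  intros Hr E H eps He. destruct (H eps He) as [del [Hd H']].
  exists (Rmin del r). split; [now apply Rmin_pos|]. intros w Hw.
  assert (A1 := Rmin_l del r). assert (A2 := Rmin_r del r).
  rewrite <- !E; [apply H'; lra | rewrite Cmod_self_minus; lra | lra].
Qed.

Lemma ccont_plus (f g : C -> C) (z : C) :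
  ccont f z -> ccont g z -> ccont (fun w => f w + g w)%C z.
Proof.
  intros Hf Hg eps He.
  destruct (Hf (eps / 2)) as [d1 [Hd1 H1]]; [lra|].
  destruct (Hg (eps / 2)) as [d2 [Hd2 H2]]; [lra|].
  exists (Rmin d1 d2). split; [now apply Rmin_pos|]. intros w Hw.
  assert (A1 := Rmin_l d1 d2). assert (A2 := Rmin_r d1 d2).
  replace (f w + g w - (f z + g z))%C with ((f w - f z) + (g w - g z))%C by ring.
  eapply Rle_lt_trans; [apply Cmod_triangle|].
  assert (H1' := H1 w). assert (H2' := H2 w). lra.
Qed.

Lemma ccont_bounded (f : C -> C) (z : C) : ccont f z ->
  exists del, 0 < del /\ forall w, Cmod (w - z) < del -> Cmod (f w) <= Cmod (f z) + 1.
Proof.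
  intros H. destruct (H 1) as [d [Hd H']]; [lra|]. exists d. split; [easy|].
  intros w Hw. specialize (H' w Hw). assert (A := Cmod_triangle_inv (f w) (f z)). lra.
Qed.

Lemma ccont_mult (f g : C -> C) (z : C) :
  ccont f z -> ccont g z -> ccont (fun w => f w * g w)%C z.
Proof.
  intros Hf Hg eps He.
  destruct (ccont_bounded g z Hg) as [d0 [Hd0 H0]].
  assert (P1 := Cmod_ge_0 (f z)). assert (P2 := Cmod_ge_0 (g z)).
  set (K := Cmod (f z) + Cmod (g z) + 1) in *.
  assert (HK : 0 < K) by (unfold K; lra).
  destruct (Hf (eps / (2 * K))) as [d1 [Hd1 H1]]; [apply Rdiv_lt_0_compat; lra|].
  destruct (Hg (eps / (2 * K))) as [d2 [Hd2 H2]]; [apply Rdiv_lt_0_compat; lra|].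
  exists (Rmin d0 (Rmin d1 d2)). split; [repeat apply Rmin_pos; easy|]. intros w Hw.
  assert (A1 := Rmin_l d0 (Rmin d1 d2)). assert (A2 := Rmin_r d0 (Rmin d1 d2)).
  assert (A3 := Rmin_l d1 d2). assert (A4 := Rmin_r d1 d2).
  replace (f w * g w - f z * g z)%C
    with ((f w - f z) * g w + f z * (g w - g z))%C by ring.
  eapply Rle_lt_trans; [apply Cmod_triangle|]. rewrite !Cmod_mult.
  assert (B0 := H0 w ltac:(lra)). assert (B1 := H1 w ltac:(lra)).
  assert (B2 := H2 w ltac:(lra)).
  set (e := eps / (2 * K)) in *.
  assert (Ee : e * K = eps / 2) by (unfold e; field; lra).
  assert (Q1 := Cmod_ge_0 (f w - f z)). assert (Q2 := Cmod_ge_0 (g w - g z)).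
  assert (Q3 := Cmod_ge_0 (g w)).
  assert (0 < e) by (unfold e; apply Rdiv_lt_0_compat; lra).
  apply Rle_lt_trans with (e * Cmod (g w) + Cmod (f z) * e).
  - apply Rplus_le_compat; [apply Rmult_le_compat_r | apply Rmult_le_compat_l]; lra.
  - apply Rle_lt_trans with (e * (Cmod (g z) + 1) + Cmod (f z) * e).
    + apply Rplus_le_compat_r, Rmult_le_compat_l; lra.
    + replace (e * (Cmod (g z) + 1) + Cmod (f z) * e) with (e * K) by (unfold K; ring). lra.
Qed.

Lemma ccont_inv (f : C -> C) (z : C) :
  ccont f z -> f z <> 0 -> ccont (fun w => / f w)%C z.
Proof.
  intros Hf Hz eps He.
  assert (Hp : 0 < Cmod (f z)) by now apply Cmod_gt_0.
  set (m := Cmod (f z)) in *.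
  destruct (Hf (Rmin (m / 2) (eps * (m * m / 2)))) as [d [Hd H]].
  { apply Rmin_pos; [lra|]. apply Rmult_lt_0_compat; [easy|]. nra. }
  exists d. split; [easy|]. intros w Hw. specialize (H w Hw).
  assert (A1 := Rmin_l (m / 2) (eps * (m * m / 2))).
  assert (A2 := Rmin_r (m / 2) (eps * (m * m / 2))).
  assert (B : m / 2 < Cmod (f w)).
  { assert (T := Cmod_triangle_inv (f z) (f w)). rewrite Cmod_minus_sym in T.
    fold m in T. lra. }
  assert (Hw0 : f w <> 0) by (apply Cmod_pos_neq_0; lra).
  replace (/ f w - / f z)%C with (- (f w - f z) * / (f w * f z))%C
    by (field; now split).
  rewrite Cmod_mult, Cmod_opp, Cmod_inv, Cmod_mult by now apply Cmult_neq_0.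
  fold m.
  assert (0 < Cmod (f w) * m) by nra.
  apply Rmult_lt_reg_r with (Cmod (f w) * m); [easy|].
  rewrite Rmult_assoc, Rinv_l by lra.
  rewrite Rmult_1_r. eapply Rlt_le_trans; [exact H|].
  eapply Rle_trans; [exact A2|]. apply Rmult_le_compat_l; nra.
Qed.

Lemma ccont_comp (f g : C -> C) (z : C) :
  ccont g z -> ccont f (g z) -> ccont (fun w => f (g w)) z.
Proof.
  intros Hg Hf eps He. destruct (Hf eps He) as [d [Hd H]].
  destruct (Hg d Hd) as [d' [Hd' H']]. exists d'. split; [easy|].
  intros w Hw. now apply H, H'.
Qed.

(* Caratheodory's form of differentiability, which reduces the rules of
   differentiation to rules for continuous functions. *)
Lemma cderiv_slope (f : C -> C) (z d : C) : cderiv f z d ->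
  exists phi, (forall w, f w - f z = phi w * (w - z))%C /\ phi z = d /\ ccont phi z.
Proof.
  intros H.
  exists (fun w => if Ceq_dec w z then d else (f w - f z) / (w - z))%C.
  split; [|split].
  - intros w. destruct (Ceq_dec w z) as [->|Hn]; [ring|].
    field. now apply Cminus_eq_contra.
  - now destruct (Ceq_dec z z).
  - intros eps He. destruct (H (eps / 2)) as [del [Hd H']]; [lra|].
    exists del. split; [easy|]. intros w Hw.
    destruct (Ceq_dec z z) as [_|]; [|easy].
    destruct (Ceq_dec w z) as [->|Hn]; [now rewrite Cmod_self_minus|].
    assert (Hn' : (w - z)%C <> 0) by now apply Cminus_eq_contra.
    assert (Hp : 0 < Cmod (w - z)) by now apply Cmod_gt_0.
    replace ((f w - f z) / (w - z) - d)%C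
      with ((f w - f z - d * (w - z)) / (w - z))%C by (field; easy).
    rewrite Cmod_div by easy. apply Rle_lt_trans with (eps / 2); [|lra].
    apply Rle_div_l; [lra|]. now apply H'.
Qed.

Lemma slope_cderiv (f phi : C -> C) (z : C) :
  (forall w, f w - f z = phi w * (w - z))%C -> ccont phi z -> cderiv f z (phi z).
Proof.
  intros E H eps He. destruct (H eps He) as [del [Hd H']].
  exists del. split; [easy|]. intros w Hw. rewrite E.
  replace (phi w * (w - z) - phi z * (w - z))%C
    with ((phi w - phi z) * (w - z))%C by ring.
  rewrite Cmod_mult. apply Rmult_le_compat_r; [apply Cmod_ge_0|].
  now apply Rlt_le, H'.
Qed.

Lemma cderiv_ccont (f : C -> C) (z d : C) : cderiv f z d -> ccont f z.
Proof.
  intros H. destruct (cderiv_slope f z d H) as [phi [E [_ Hc]]].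
  apply ccont_ext_loc with (f := fun w => (f z + phi w * (w + - z))%C) (r := 1); [lra| |].
  - intros w _. change (w + - z)%C with (w - z)%C. rewrite <- E. ring.
  - apply ccont_plus; [apply ccont_const|]. apply ccont_mult; [easy|].
    apply ccont_plus; [apply ccont_id | apply ccont_const].
Qed.

Lemma cdiff_ccont (f : C -> C) (z : C) : cdiff f z -> ccont f z.
Proof. intros [d H]. now apply cderiv_ccont with d. Qed.

Lemma cderiv_ext_loc (f g : C -> C) (z d : C) (r : R) : 0 < r ->
  (forall w, Cmod (w - z) < r -> f w = g w) -> cderiv f z d -> cderiv g z d.
Proof.
  intros Hr E H eps He. destruct (H eps He) as [del [Hd H']].
  exists (Rmin del r). split; [now apply Rmin_pos|]. intros w Hw.
  assert (A1 := Rmin_l del r). assert (A2 := Rmin_r del r).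
  rewrite <- !E; [apply H'; lra | rewrite Cmod_self_minus; lra | lra].
Qed.

Lemma cdiff_ext_loc (f g : C -> C) (z : C) (r : R) : 0 < r ->
  (forall w, Cmod (w - z) < r -> f w = g w) -> cdiff f z -> cdiff g z.
Proof. intros Hr E [d H]. exists d. now apply cderiv_ext_loc with f r. Qed.

Lemma cdiff_const (k z : C) : cdiff (fun _ => k) z.
Proof.
  exists 0. apply (slope_cderiv _ (fun _ => 0)); [intros; ring | apply ccont_const].
Qed.

Lemma cdiff_id (z : C) : cdiff (fun w => w) z.
Proof.
  exists 1. apply (slope_cderiv _ (fun _ => 1)); [intros; ring | apply ccont_const].
Qed.

Lemma cdiff_plus (f g : C -> C) (z : C) :
  cdiff f z -> cdiff g z -> cdiff (fun w => f w + g w)%C z.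
Proof.
  intros [a Ha] [b Hb].
  destruct (cderiv_slope _ _ _ Ha) as [p [Ep [_ Hp]]].
  destruct (cderiv_slope _ _ _ Hb) as [q [Eq [_ Hq]]].
  eexists. apply (slope_cderiv _ (fun w => p w + q w)%C).
  - intros w. rewrite Cmult_plus_distr_r, <- Ep, <- Eq. ring.
  - now apply ccont_plus.
Qed.

Lemma cdiff_mult (f g : C -> C) (z : C) :
  cdiff f z -> cdiff g z -> cdiff (fun w => f w * g w)%C z.
Proof.
  intros Hf Hg. assert (Hc := cdiff_ccont _ _ Hg). revert Hf Hg. intros [a Ha] [b Hb].
  destruct (cderiv_slope _ _ _ Ha) as [p [Ep [_ Hp]]].
  destruct (cderiv_slope _ _ _ Hb) as [q [Eq [_ Hq]]].
  eexists. apply (slope_cderiv _ (fun w => p w * g w + f z * q w)%C).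
  - intros w.
    replace ((p w * g w + f z * q w) * (w - z))%C
      with (p w * (w - z) * g w + f z * (q w * (w - z)))%C by ring.
    rewrite <- Ep, <- Eq. ring.
  - apply ccont_plus; apply ccont_mult; try easy. apply ccont_const.
Qed.

Lemma cdiff_inv (f : C -> C) (z : C) :
  cdiff f z -> f z <> 0 -> cdiff (fun w => / f w)%C z.
Proof.
  intros Hf Hz. assert (Hc := cdiff_ccont _ _ Hf).
  destruct (Hc (Cmod (f z))) as [r [Hr Hb]]; [now apply Cmod_gt_0|].
  destruct Hf as [a Ha]. destruct (cderiv_slope _ _ _ Ha) as [p [Ep [_ Hp]]].
  assert (E : forall w, Cmod (w - z) < r -> f w <> 0).
  { intros w Hw H0. specialize (Hb w Hw). rewrite H0, Cmod_minus_sym in Hb.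
    replace (f z - 0)%C with (f z) in Hb by ring. lra. }
  (* The slope identity for [/ f] holds only where [f] is nonzero. [h] satisfies it for every [w]
     and agrees with [/ f] near [z]. *)
  set (h := fun w => (/ f z + (- p w * / f w * / f z) * (w - z))%C).
  apply cdiff_ext_loc with (f := h) (r := r); [easy| |].
  - intros w Hw. specialize (E w Hw). unfold h.
    replace (- p w * / f w * / f z * (w - z))%C
      with (- (p w * (w - z)) * (/ f w * / f z))%C by ring.
    rewrite <- Ep. field. now split.
  - eexists. apply (slope_cderiv _ (fun w => - p w * / f w * / f z)%C).
    + intros w. unfold h. ring.
    + apply ccont_mult; [|apply ccont_const]. apply ccont_mult; [|now apply ccont_inv].
      apply ccont_ext_loc with (f := fun w => ((-(1)) * p w)%C) (r := 1); [lra| |].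
      * intros; ring.
      * apply ccont_mult; [apply ccont_const | easy].
Qed.

Lemma cdiff_comp (f g : C -> C) (z : C) :
  cdiff g z -> cdiff f (g z) -> cdiff (fun w => f (g w)) z.
Proof.
  intros Hg Hf. assert (Hc := cdiff_ccont _ _ Hg). revert Hf Hg. intros [a Ha] [b Hb].
  destruct (cderiv_slope _ _ _ Ha) as [p [Ep [_ Hp]]].
  destruct (cderiv_slope _ _ _ Hb) as [q [Eq [_ Hq]]].
  eexists. apply (slope_cderiv _ (fun w => p (g w) * q w)%C).
  - intros w. rewrite Ep, Eq. ring.
  - apply ccont_mult; [now apply ccont_comp | easy].
Qed.

Lemma cdiff_pow (f : C -> C) (z : C) (n : nat) :
  cdiff f z -> cdiff (fun w => Cpow (f w) n) z.
Proof.
  intros H. induction n as [|n IH].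
  - exact (cdiff_const (RtoC 1) z).
  - now apply (cdiff_mult f (fun w => Cpow (f w) n)).
Qed.

Lemma cdiff_minus_const (z q : C) : cdiff (fun w => w - q)%C z.
Proof. apply (cdiff_plus (fun w => w) (fun _ => (- q)%C)); [apply cdiff_id | apply cdiff_const]. Qed.

Lemma ball_C_of_Cmod (z w : C) (eps : posreal) :
  Cmod (w - z) < eps -> @ball C_UniformSpace z eps w.
Proof.
  intros H. split; eapply Rle_lt_trans; try exact H;
    [apply (fst_le_Cmod (w - z)%C) | apply (snd_le_Cmod (w - z)%C)].
Qed.

(** Balls of the product structure on C are squares, so returning to the modulus costs a constant
    factor. *)
Lemma Cmod_of_ball_C (z w : C) (eps : posreal) :
  @ball C_UniformSpace z eps w -> Cmod (w - z) < 2 * eps.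
Proof.
  intros [H1 H2]. eapply Rle_lt_trans; [apply Cmod_le_add|].
  change (Rabs (fst w - fst z) < eps) in H1. change (Rabs (snd w - snd z) < eps) in H2.
  change (Rabs (fst w - fst z) + Rabs (snd w - snd z) < 2 * eps). lra.
Qed.

Lemma ex_derive_cdiff (g : C -> C) (z : C) :
  @ex_derive C_AbsRing C_NormedModule g z -> cdiff g z.
Proof.
  intros [d [_ H]]. exists d. intros eps He.
  specialize (H z (fun P HP => HP) (mkposreal eps He)). destruct H as [del H].
  exists del. split; [apply cond_pos|]. intros w Hw.
  specialize (H w).
  replace (d * (w - z))%C with ((w - z) * d)%C by ring.
  apply H. apply Hw.
Qed.

Lemma cdiff_ex_derive (g : C -> C) (z : C) :
  cdiff g z -> @ex_derive C_AbsRing C_NormedModule g z.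
Proof.
  intros [d H]. exists d. split; [apply is_linear_scal_l|].
  intros z' Hz'.
  rewrite <- (@is_filter_lim_locally_unique C_AbsRing (AbsRing_NormedModule C_AbsRing) z z' Hz').
  intros eps. destruct (H eps (cond_pos eps)) as [del [Hd H']].
  exists (mkposreal del Hd). intros w Hw.
  specialize (H' w Hw).
  replace (d * (w - z))%C with ((w - z) * d)%C in H' by ring. apply H'.
Qed.

(** * The complex exponential and polar coordinates *)

Definition cexp (w : C) : C := Cmult (RtoC (exp (fst w))) (expi (snd w)).

Lemma expi_plus (a b : R) : expi (a + b) = (expi a * expi b)%C.
Proof.
  unfold expi, Cmult; simpl. rewrite cos_plus, sin_plus. f_equal; ring.
Qed.

Lemma cexp_plus (a b : C) : cexp (a + b) = (cexp a * cexp b)%C.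
Proof.
  unfold cexp. simpl. rewrite exp_plus, expi_plus, RtoC_mult. ring.
Qed.

Lemma Cmod_expi (t : R) : Cmod (expi t) = 1.
Proof.
  assert (H := sin2_cos2 t). unfold Rsqr in H. unfold Cmod, expi; simpl.
  replace (_ + _) with 1 by lra. apply sqrt_1.
Qed.

Lemma Cmod_cexp (w : C) : Cmod (cexp w) = exp (fst w).
Proof.
  unfold cexp. rewrite Cmod_mult, Cmod_expi, Cmod_RtoC_nonneg; [ring|].
  apply Rlt_le, exp_pos.
Qed.

Lemma expi_neq_0 (t : R) : expi t <> 0.
Proof. apply Cmod_pos_neq_0. rewrite Cmod_expi. lra. Qed.

Lemma Cmod_pair (x y : R) : Cmod (x, y) ^ 2 = x ^ 2 + y ^ 2.
Proof. rewrite Cmod2_alt. reflexivity. Qed.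

Lemma is_derive_small (f : R -> R) (d eps : R) : is_derive f 0 d -> 0 < eps ->
  exists del, 0 < del /\ forall t, Rabs t < del -> Rabs (f t - f 0 - d * t) <= eps * Rabs t.
Proof.
  intros H He. destruct H as [_ H].
  destruct (H 0 (fun P HP => HP) (mkposreal eps He)) as [del Hd].
  exists del. split; [apply cond_pos|]. intros t Ht.
  specialize (Hd t). assert (B : ball 0 del t).
  { change (Rabs (t - 0) < del). now rewrite Rminus_0_r. }
  specialize (Hd B).
  change (Rabs (f t - f 0 - (t - 0) * d) <= eps * Rabs (t - 0)) in Hd.
  rewrite Rminus_0_r in Hd. now rewrite (Rmult_comm d).
Qed.

Lemma cderiv_cexp_0 : cderiv cexp 0 1.
Proof.
  intros eps He.
  (* Both components of the remainder together are at most seven terms of size [e * m], with [m] the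
     modulus of the increment. The cap [1 / 2] absorbs [e * (e * m)] into [e * m]. *)
  set (e := Rmin (eps / 12) (1 / 2)).
  assert (Hep : 0 < e) by (apply Rmin_pos; lra).
  assert (E1 := Rmin_l (eps / 12) (1 / 2)). assert (E2 := Rmin_r (eps / 12) (1 / 2)).
  fold e in E1, E2. clearbody e.
  destruct (is_derive_small exp 1 e) as [d1 [Hd1 H1]]; [auto_derive; [easy|rewrite exp_0; ring]|easy|].
  destruct (is_derive_small cos 0 e) as [d2 [Hd2 H2]]; [auto_derive; [easy|rewrite sin_0; ring]|easy|].
  destruct (is_derive_small sin 1 e) as [d3 [Hd3 H3]]; [auto_derive; [easy|rewrite cos_0; ring]|easy|].
  exists (Rmin e (Rmin d1 (Rmin d2 d3))). split; [repeat apply Rmin_pos; easy|].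
  intros [u t] Hw.
  replace ((u, t) - 0)%C with (u, t) in * by (unfold Cminus, Cplus, Copp, RtoC; simpl; f_equal; ring).
  assert (A1 := Rmin_l e (Rmin d1 (Rmin d2 d3))). assert (A2 := Rmin_r e (Rmin d1 (Rmin d2 d3))).
  assert (A3 := Rmin_l d1 (Rmin d2 d3)). assert (A4 := Rmin_r d1 (Rmin d2 d3)).
  assert (A5 := Rmin_l d2 d3). assert (A6 := Rmin_r d2 d3).
  assert (Bu := fst_le_Cmod (u, t)). assert (Bt := snd_le_Cmod (u, t)). simpl in Bu, Bt.
  set (m := Cmod (u, t)) in *.
  specialize (H1 u ltac:(lra)). specialize (H2 t ltac:(lra)). specialize (H3 t ltac:(lra)).
  rewrite exp_0 in H1. rewrite cos_0 in H2. rewrite sin_0 in H3.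
  eapply Rle_trans; [apply Cmod_le_add|].
  unfold cexp, expi; simpl. rewrite exp_0, cos_0, sin_0.
  set (eu := exp u) in *. set (ct := cos t) in *. set (st := sin t) in *.
  assert (Hm : 0 <= m) by apply Cmod_ge_0.
  assert (K1 : Rabs (eu - 1 - 1 * u) <= e * m) by (eapply Rle_trans; [exact H1|apply Rmult_le_compat_l; lra]).
  assert (K2 : Rabs (ct - 1 - 0 * t) <= e * m) by (eapply Rle_trans; [exact H2|apply Rmult_le_compat_l; lra]).
  assert (K3 : Rabs (st - 0 - 1 * t) <= e * m) by (eapply Rle_trans; [exact H3|apply Rmult_le_compat_l; lra]).
  set (a := eu - 1 - 1 * u) in *. set (b := ct - 1 - 0 * t) in *. set (c := st - 0 - 1 * t) in *.
  assert (Lc : Rabs ct <= 1) by (apply Rabs_le; apply COS_bound).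
  assert (Ls : Rabs st <= 1) by (apply Rabs_le; apply SIN_bound).
  assert (Lu : Rabs u <= e) by lra.
  match goal with |- Rabs ?X + Rabs ?Y <= _ =>
    replace X with (a * ct + b + u * b) by (unfold a, b; ring);
    replace Y with (a * st + c + u * (c + t)) by (unfold a, c; ring) end.
  assert (M : forall p q P Q, Rabs p <= P -> Rabs q <= Q -> Rabs (p * q) <= P * Q).
  { intros. rewrite Rabs_mult. apply Rmult_le_compat; auto using Rabs_pos. }
  assert (T1 := M a ct _ _ K1 Lc). assert (T2 := M u b _ _ Lu K2).
  assert (T3 := M a st _ _ K1 Ls).
  assert (T4 : Rabs (c + t) <= e * m + m) by (eapply Rle_trans; [apply Rabs_triang|lra]).
  assert (T5 := M u (c + t) _ _ Lu T4).
  assert (S1 := Rabs_triang (a * ct + b) (u * b)). assert (S2 := Rabs_triang (a * ct) b).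
  assert (S3 := Rabs_triang (a * st + c) (u * (c + t))). assert (S4 := Rabs_triang (a * st) c).
  assert (e * m <= eps / 12 * m) by (apply Rmult_le_compat_r; lra).
  assert (e * (e * m) <= e * m) by (rewrite <- (Rmult_1_l (e * m)) at 2; apply Rmult_le_compat_r; nra).
  replace (Cmod ((u, t) - 0)) with m
    by (unfold m; f_equal; unfold Cminus, Cplus, Copp, RtoC; simpl; f_equal; ring).
  assert (0 <= e * m) by (apply Rmult_le_pos; lra). lra.
Qed.

Lemma cdiff_cexp (z : C) : cdiff cexp z.
Proof.
  apply cdiff_ext_loc with (f := fun w => (cexp z * cexp (w - z))%C) (r := 1); [lra| |].
  - intros w _. rewrite <- cexp_plus. f_equal. ring.
  - apply cdiff_mult; [apply cdiff_const|].
    apply (cdiff_comp cexp (fun w => (w - z)%C)); [apply cdiff_minus_const|].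
    exists 1. replace (z - z)%C with (RtoC 0) by ring. apply cderiv_cexp_0.
Qed.

Lemma unit_circle_angle (x y : R) : x ^ 2 + y ^ 2 = 1 ->
  exists t, 0 <= t <= 2 * PI /\ (x, y) = expi t.
Proof.
  intros H. assert (Hx : -1 <= x <= 1) by nra.
  assert (B := acos_bound x). assert (P := PI_RGT_0).
  assert (S : sin (acos x) = sqrt (y ^ 2)).
  { rewrite sin_acos by easy. f_equal. unfold Rsqr. lra. }
  destruct (Rle_dec 0 y) as [Hy|Hy].
  - exists (acos x). split; [lra|]. unfold expi. rewrite cos_acos, S by easy.
    f_equal. symmetry. now apply sqrt_pow2.
  - exists (2 * PI - acos x). split; [lra|]. unfold expi.
    replace (2 * PI - acos x) with (- acos x + 2 * INR 1 * PI) by (simpl; ring).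
    rewrite cos_period, sin_period, cos_neg, sin_neg, cos_acos, S by easy.
    f_equal. replace (y ^ 2) with ((- y) ^ 2) by ring. rewrite sqrt_pow2; lra.
Qed.

Lemma polar_form (w : C) : exists t, 0 <= t <= 2 * PI /\ w = (RtoC (Cmod w) * expi t)%C.
Proof.
  destruct (Ceq_dec w 0) as [->|Hw].
  - exists 0. split; [assert (P := PI_RGT_0); lra|]. rewrite Cmod_0. ring.
  - assert (Hp : 0 < Cmod w) by now apply Cmod_gt_0.
    assert (Hn : RtoC (Cmod w) <> 0) by (intros E; apply RtoC_inj in E; lra).
    assert (Hq := Cmod_div w (RtoC (Cmod w)) Hn).
    rewrite (Cmod_RtoC_nonneg (Cmod w)) in Hq by lra.
    replace (Cmod w / Cmod w) with 1 in Hq by (field; lra).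
    destruct (w / RtoC (Cmod w))%C as [x y] eqn:E.
    destruct (unit_circle_angle x y) as [t [Ht Ex]].
    { rewrite <- Cmod_pair, Hq. ring. }
    exists t. split; [easy|]. rewrite <- Ex, <- E. field. easy.
Qed.

Lemma polar_form_cexp (w : C) : w <> 0 -> exists v, cexp v = w.
Proof.
  intros Hw. destruct (polar_form w) as [t [_ E]].
  exists (ln (Cmod w), t). unfold cexp; simpl. rewrite exp_ln; [easy|]. now apply Cmod_gt_0.
Qed.

(** * Goursat's theorem for rectangles *)

Definition rcont (f : R -> C) (t : R) : Prop :=
  forall eps, 0 < eps -> exists del, 0 < del /\
    forall s, Rabs (s - t) < del -> Cmod (f s - f t) < eps.

Lemma rcont_continuous (f : R -> C) (t : R) :
  rcont f t -> @continuous R_UniformSpace C_UniformSpace f t.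
Proof.
  intros H. apply filterlim_locally. intros eps.
  destruct (H eps (cond_pos eps)) as [d [Hd H']]. exists (mkposreal d Hd).
  intros s Hs. apply ball_C_of_Cmod, H', Hs.
Qed.

Lemma rcont_comp (G : C -> C) (g : R -> C) (t : R) :
  ccont G (g t) -> rcont g t -> rcont (fun s => G (g s)) t.
Proof.
  intros HG Hg eps He. destruct (HG eps He) as [d [Hd H]].
  destruct (Hg d Hd) as [d' [Hd' H']]. exists d'. split; [easy|]. intros s Hs.
  now apply H, H'.
Qed.

Lemma rcont_horizontal (t u : R) : rcont (fun x => (x, t)) u.
Proof.
  intros eps He. exists eps. split; [easy|]. intros s Hs.
  replace ((s, t) - (u, t))%C with (RtoC (s - u))
    by (unfold RtoC, Cminus, Cplus, Copp; simpl; f_equal; ring).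
  now rewrite Cmod_R.
Qed.

Lemma rcont_vertical (u t : R) : rcont (fun x => (u, x)) t.
Proof.
  intros eps He. exists eps. split; [easy|]. intros s Hs.
  replace ((u, s) - (u, t))%C with (Ci * RtoC (s - t))%C
    by (unfold RtoC, Ci, Cmult, Cminus, Cplus, Copp; simpl; f_equal; ring).
  now rewrite Cmod_mult, Cmod_Ci, Cmod_R, Rmult_1_l.
Qed.

Definition CI (f : R -> C) (a b : R) : C := @RInt C_R_CompleteNormedModule f a b.
Definition EI (f : R -> C) (a b : R) : Prop := @ex_RInt C_R_NormedModule f a b.

Lemma CI_correct (f : R -> C) (a b : R) : EI f a b -> @is_RInt C_R_NormedModule f a b (CI f a b).
Proof. intros H. apply (@RInt_correct C_R_CompleteNormedModule). exact H. Qed.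

Lemma CI_unique (f : R -> C) (a b : R) (l : C) : @is_RInt C_R_NormedModule f a b l -> CI f a b = l.
Proof. intros H. apply (@is_RInt_unique C_R_CompleteNormedModule). exact H. Qed.

Lemma EI_rcont (f : R -> C) (a b : R) :
  (forall t, Rmin a b <= t <= Rmax a b -> rcont f t) -> EI f a b.
Proof.
  intros H. apply (@ex_RInt_continuous C_R_CompleteNormedModule).
  intros t Ht. apply rcont_continuous, H, Ht.
Qed.

Lemma EI_plus (f g : R -> C) (a b : R) :
  EI f a b -> EI g a b -> EI (fun t => f t + g t)%C a b.
Proof. apply (@ex_RInt_plus C_R_NormedModule). Qed.

Lemma EI_minus (f g : R -> C) (a b : R) :
  EI f a b -> EI g a b -> EI (fun t => f t - g t)%C a b.
Proof. apply (@ex_RInt_minus C_R_NormedModule). Qed.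

Lemma EI_const (k : C) (a b : R) : EI (fun _ => k) a b.
Proof. apply (@ex_RInt_const C_R_NormedModule). Qed.

Lemma CI_plus (f g : R -> C) (a b : R) :
  EI f a b -> EI g a b -> CI (fun t => f t + g t)%C a b = (CI f a b + CI g a b)%C.
Proof. intros Hf Hg. apply (@RInt_plus C_R_CompleteNormedModule f g a b Hf Hg). Qed.

Lemma CI_minus (f g : R -> C) (a b : R) :
  EI f a b -> EI g a b -> CI (fun t => f t - g t)%C a b = (CI f a b - CI g a b)%C.
Proof. intros Hf Hg. apply (@RInt_minus C_R_CompleteNormedModule f g a b Hf Hg). Qed.

Lemma CI_const (k : C) (a b : R) : CI (fun _ => k) a b = (RtoC (b - a) * k)%C.
Proof.
  unfold CI. rewrite (@RInt_const C_R_CompleteNormedModule).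
  destruct k as [x y]. apply injective_projections; unfold RtoC, Cmult; simpl.
  - change ((b - a) * x = (b - a) * x - 0 * y). ring.
  - change ((b - a) * y = (b - a) * y + 0 * x). ring.
Qed.

Lemma CI_ext (f g : R -> C) (a b : R) :
  (forall t, Rmin a b < t < Rmax a b -> f t = g t) -> CI f a b = CI g a b.
Proof. apply (@RInt_ext C_R_CompleteNormedModule). Qed.

Lemma CI_Chasles (f : R -> C) (a b c : R) :
  EI f a b -> EI f b c -> CI f a c = (CI f a b + CI f b c)%C.
Proof.
  intros Hf Hg. symmetry. apply (@RInt_Chasles C_R_CompleteNormedModule f a b c Hf Hg).
Qed.

Lemma CI_bound (f : R -> C) (a b M : R) : a <= b ->
  EI f a b -> (forall t, a <= t <= b -> Cmod (f t) <= M) -> Cmod (CI f a b) <= (b - a) * M.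
Proof.
  intros Hab Hf H. rewrite Cmod_norm.
  apply (@norm_RInt_le_const C_R_NormedModule f a b _ M Hab); [|now apply CI_correct].
  intros t Ht. specialize (H t Ht). now rewrite Cmod_norm in H.
Qed.

(** The integral lives in a real module, so C-linearity is obtained from the real and imaginary
    parts. *)
Lemma is_RInt_Cmult (k : C) (f : R -> C) (a b : R) (l : C) :
  @is_RInt C_R_NormedModule f a b l ->
  @is_RInt C_R_NormedModule (fun t => k * f t)%C a b (k * l)%C.
Proof.
  intros H.
  assert (H1 := @is_RInt_fct_extend_fst R_NormedModule R_NormedModule f a b l H).
  assert (H2 := @is_RInt_fct_extend_snd R_NormedModule R_NormedModule f a b l H).
  apply (@is_RInt_fct_extend_pair R_NormedModule R_NormedModule).
  - apply (@is_RInt_minus R_NormedModule (fun t => fst k * fst (f t)) (fun t => snd k * snd (f t)));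
    now apply (@is_RInt_scal R_NormedModule).
  - apply (@is_RInt_plus R_NormedModule (fun t => fst k * snd (f t)) (fun t => snd k * fst (f t)));
    now apply (@is_RInt_scal R_NormedModule).
Qed.

Lemma EI_Cmult (k : C) (f : R -> C) (a b : R) : EI f a b -> EI (fun t => k * f t)%C a b.
Proof. intros [l H]. exists (k * l)%C. now apply is_RInt_Cmult. Qed.

Lemma CI_Cmult (k : C) (f : R -> C) (a b : R) :
  EI f a b -> CI (fun t => k * f t)%C a b = (k * CI f a b)%C.
Proof. intros H. apply CI_unique, is_RInt_Cmult, CI_correct, H. Qed.

(* The integral of [G w dw] along the boundary of [[u1,u2] x [t1,t2]]. *)
Definition rect_int (G : C -> C) (u1 u2 t1 t2 : R) : C :=
  (Ci * CI (fun t => G (u2, t) - G (u1, t)) t1 t2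
   - CI (fun u => G (u, t2) - G (u, t1)) u1 u2)%C.

Definition in_rect (u1 u2 t1 t2 : R) (w : C) : Prop :=
  u1 <= fst w <= u2 /\ t1 <= snd w <= t2.

Lemma rect_int_split_u (G : C -> C) (u1 u u2 t1 t2 : R) :
  u1 <= u <= u2 -> t1 <= t2 ->
  (forall w, in_rect u1 u2 t1 t2 w -> ccont G w) ->
  rect_int G u1 u2 t1 t2 = (rect_int G u1 u t1 t2 + rect_int G u u2 t1 t2)%C.
Proof.
  intros Hu Ht H.
  assert (V : forall x, u1 <= x <= u2 -> EI (fun t => G (x, t)) t1 t2).
  { intros x Hx. apply EI_rcont. rewrite Rmin_left, Rmax_right by lra. intros t Hs.
    apply rcont_comp; [apply H; split; simpl; lra | apply rcont_vertical]. }
  assert (W : forall x a b, t1 <= x <= t2 -> u1 <= a <= b -> b <= u2 ->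
              EI (fun u => G (u, x)) a b).
  { intros x a b Hx Ha Hb. apply EI_rcont. rewrite Rmin_left, Rmax_right by lra. intros t Hs.
    apply (rcont_comp G (fun u => (u, x))); [apply H; split; simpl; lra | apply rcont_horizontal]. }
  unfold rect_int.
  rewrite (CI_Chasles (fun x => G (x, t2) - G (x, t1))%C u1 u u2)
    by (apply EI_minus; apply W; lra).
  rewrite !(CI_minus (fun t => G (_, t))) by (apply V; lra). ring.
Qed.

Lemma rect_int_split_t (G : C -> C) (u1 u2 t1 t t2 : R) :
  u1 <= u2 -> t1 <= t <= t2 ->
  (forall w, in_rect u1 u2 t1 t2 w -> ccont G w) ->
  rect_int G u1 u2 t1 t2 = (rect_int G u1 u2 t1 t + rect_int G u1 u2 t t2)%C.
Proof.
  intros Hu Ht H.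
  assert (V : forall x a b, u1 <= x <= u2 -> t1 <= a <= b -> b <= t2 ->
              EI (fun t => G (x, t)) a b).
  { intros x a b Hx Ha Hb. apply EI_rcont. rewrite Rmin_left, Rmax_right by lra. intros y Hs.
    apply rcont_comp; [apply H; split; simpl; lra | apply rcont_vertical]. }
  assert (W : forall x, t1 <= x <= t2 -> EI (fun u => G (u, x)) u1 u2).
  { intros x Hx. apply EI_rcont. rewrite Rmin_left, Rmax_right by lra. intros y Hs.
    apply (rcont_comp G (fun u => (u, x))); [apply H; split; simpl; lra | apply rcont_horizontal]. }
  unfold rect_int.
  rewrite (CI_Chasles (fun x => G (u2, x) - G (u1, x))%C t1 t t2)
    by (apply EI_minus; apply V; lra).
  rewrite !(CI_minus (fun t => G (t, _))) by (apply W; lra). ring.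
Qed.

Lemma rect_int_bound (G : C -> C) (u1 u2 t1 t2 M : R) :
  u1 <= u2 -> t1 <= t2 ->
  (forall w, in_rect u1 u2 t1 t2 w -> ccont G w) ->
  (forall w, in_rect u1 u2 t1 t2 w -> Cmod (G w) <= M) ->
  Cmod (rect_int G u1 u2 t1 t2) <= 2 * M * ((u2 - u1) + (t2 - t1)).
Proof.
  intros Hu Ht H HM. unfold rect_int.
  eapply Rle_trans; [apply Cmod_triangle_minus|]. rewrite Cmod_mult, Cmod_Ci, Rmult_1_l.
  replace (2 * M * (u2 - u1 + (t2 - t1)))
    with ((t2 - t1) * (2 * M) + (u2 - u1) * (2 * M)) by ring.
  apply Rplus_le_compat; apply CI_bound; try easy.
  - apply EI_minus; apply EI_rcont; rewrite Rmin_left, Rmax_right by lra; intros t Hs;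
    (apply rcont_comp; [apply H; split; simpl; lra | apply rcont_vertical]).
  - intros t Hs. eapply Rle_trans; [apply Cmod_triangle_minus|].
    assert (A1 := HM (u2, t) ltac:(split; simpl; lra)).
    assert (A2 := HM (u1, t) ltac:(split; simpl; lra)). lra.
  - apply EI_minus; apply EI_rcont; rewrite Rmin_left, Rmax_right by lra; intros t Hs.
    + apply (rcont_comp G (fun u => (u, t2))); [apply H; split; simpl; lra | apply rcont_horizontal].
    + apply (rcont_comp G (fun u => (u, t1))); [apply H; split; simpl; lra | apply rcont_horizontal].
  - intros t Hs. eapply Rle_trans; [apply Cmod_triangle_minus|].
    assert (A1 := HM (t, t2) ltac:(split; simpl; lra)).
    assert (A2 := HM (t, t1) ltac:(split; simpl; lra)). lra.
Qed.

(** On opposite sides an affine function differs by a constant, [q * (u2 - u1)] for one pair and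
    [q * Ci * (t2 - t1)] for the other; after integration the two contributions cancel. *)
Lemma rect_int_minus_affine (G : C -> C) (p q : C) (u1 u2 t1 t2 : R) :
  u1 <= u2 -> t1 <= t2 ->
  (forall w, in_rect u1 u2 t1 t2 w -> ccont G w) ->
  rect_int (fun w => G w - (p + q * w))%C u1 u2 t1 t2 = rect_int G u1 u2 t1 t2.
Proof.
  intros Hu Ht H. unfold rect_int.
  rewrite (CI_ext _ (fun t => (G (u2, t) - G (u1, t)) - q * RtoC (u2 - u1))%C).
  2:{ intros t _.
      replace (u2, t) with (RtoC (u2 - u1) + (u1, t))%C
        by (unfold RtoC, Cplus; simpl; f_equal; ring).
      ring. }
  rewrite (CI_ext (fun u => G (u, t2) - (p + q * (u, t2)) - _)%C
             (fun u => (G (u, t2) - G (u, t1)) - q * Ci * RtoC (t2 - t1))%C).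
  2:{ intros t _.
      replace (t, t2) with (Ci * RtoC (t2 - t1) + (t, t1))%C
        by (unfold RtoC, Ci, Cmult, Cplus; simpl; f_equal; ring).
      ring. }
  assert (E1 : EI (fun t => G (u2, t) - G (u1, t))%C t1 t2).
  { apply EI_minus; apply EI_rcont; rewrite Rmin_left, Rmax_right by lra; intros t Hs;
    (apply rcont_comp; [apply H; split; simpl; lra | apply rcont_vertical]). }
  assert (E2 : EI (fun u => G (u, t2) - G (u, t1))%C u1 u2).
  { apply EI_minus; apply EI_rcont; rewrite Rmin_left, Rmax_right by lra; intros t Hs.
    - apply (rcont_comp G (fun u => (u, t2))); [apply H; split; simpl; lra | apply rcont_horizontal].
    - apply (rcont_comp G (fun u => (u, t1))); [apply H; split; simpl; lra | apply rcont_horizontal]. }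
  rewrite (CI_minus _ _ t1 t2 E1 (EI_const _ _ _)).
  rewrite (CI_minus _ _ u1 u2 E2 (EI_const _ _ _)).
  rewrite !CI_const. ring.
Qed.

(** The point is the supremum of the left endpoints, since nestedness makes every right endpoint an
    upper bound of them. *)
Lemma nested_halving (a : nat -> R) (L : R) :
  (forall n, a n <= a (S n) <= a n + L / 2 ^ S n) ->
  exists x, forall n, a n <= x <= a n + L / 2 ^ n.
Proof.
  intros H.
  assert (Pw : forall n, 0 < 2 ^ n) by (intros n; apply pow_lt; lra).
  assert (E : forall n, L / 2 ^ n = L / 2 ^ S n + L / 2 ^ S n).
  { intros n. simpl. field. specialize (Pw n). lra. }
  assert (I : forall n k, a n <= a (n + k)%nat /\ a (n + k)%nat + L / 2 ^ (n + k) <= a n + L / 2 ^ n).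
  { intros n k. induction k as [|k IH].
    - rewrite Nat.add_0_r. lra.
    - rewrite Nat.add_succ_r. specialize (H (n + k)%nat). specialize (E (n + k)%nat). lra. }
  assert (HL : forall n, 0 <= L / 2 ^ n).
  { intros n. specialize (H n). specialize (E n). lra. }
  assert (Ub : forall n k, a k <= a n + L / 2 ^ n).
  { intros n k. destruct (Nat.le_ge_cases n k) as [Hl|Hl].
    - specialize (I n (k - n)%nat). replace (n + (k - n))%nat with k in I by lia.
      specialize (HL k). lra.
    - specialize (I k (n - k)%nat). replace (k + (n - k))%nat with n in I by lia.
      specialize (HL n). lra. }
  destruct (completeness (fun y => exists n, y = a n)) as [x [Hx1 Hx2]].
  - exists (a O + L / 2 ^ 0). intros y [n ->]. apply Ub.
  - now exists (a O), O.
  - exists x. intros n. split.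
    + apply Hx1. now exists n.
    + apply Hx2. intros y [k ->]. apply Ub.
Qed.

(** Bisection as an induction principle: if [Q] failed, quarters on which it fails could be chosen
    forever, and they would shrink to a point near which the last hypothesis gives [Q]. *)
Lemma rectangle_bisection (Q : R -> R -> R -> R -> Prop) (u t L H : R) :
  0 <= L -> 0 <= H ->
  (forall a b l h, 0 <= l -> 0 <= h ->
     Q a b l h -> Q (a + l) b l h -> Q a (b + h) l h -> Q (a + l) (b + h) l h ->
     Q a b (2 * l) (2 * h)) ->
  (forall x y, u <= x <= u + L -> t <= y <= t + H -> exists del, 0 < del /\
     forall a b l h, 0 <= l < del -> 0 <= h < del -> a <= x <= a + l -> b <= y <= b + h ->
       Q a b l h) ->
  Q u t L H.
Proof.
  intros HL HH Hq Hloc. apply NNPP. intros Hbad.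
  set (Bad := fun (n : nat) (p : R * R) => ~ Q (fst p) (snd p) (L / 2 ^ n) (H / 2 ^ n)).
  (* Badness of [p] is a premise inside [Next], so every pair has a successor and [epsilon] defines
     the sequence before badness along it is proved. *)
  set (Next := fun (n : nat) (p p' : R * R) => Bad n p ->
     Bad (S n) p' /\ fst p <= fst p' <= fst p + L / 2 ^ S n /\
     snd p <= snd p' <= snd p + H / 2 ^ S n).
  assert (Pw : forall n, 0 < 2 ^ n) by (intros n; apply pow_lt; lra).
  assert (Ln : forall n, 0 <= L / 2 ^ n) by (intros n; apply Rdiv_le_0_compat; auto).
  assert (Hn : forall n, 0 <= H / 2 ^ n) by (intros n; apply Rdiv_le_0_compat; auto).
  assert (Step : forall n p, exists p', Next n p p').
  { intros n p. apply NNPP. intros Hno.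
    assert (Hb : Bad n p).
    { apply NNPP. intros Hg. apply Hno. now exists p. }
    apply Hb.
    replace (L / 2 ^ n) with (2 * (L / 2 ^ S n)) by (simpl; field; specialize (Pw n); lra).
    replace (H / 2 ^ n) with (2 * (H / 2 ^ S n)) by (simpl; field; specialize (Pw n); lra).
    assert (A1 := Ln (S n)). assert (A2 := Hn (S n)).
    apply Hq; try easy; apply NNPP; intros Hg; apply Hno.
    - exists p. intros _. repeat split; try lra. exact Hg.
    - exists (fst p + L / 2 ^ S n, snd p). intros _. cbn [fst snd]. repeat split; try lra. exact Hg.
    - exists (fst p, snd p + H / 2 ^ S n). intros _. cbn [fst snd]. repeat split; try lra. exact Hg.
    - exists (fst p + L / 2 ^ S n, snd p + H / 2 ^ S n). intros _. cbn [fst snd].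
      repeat split; try lra. exact Hg. }
  set (nxt := fun n p => epsilon (inhabits p) (Next n p)).
  assert (Hnxt : forall n p, Next n p (nxt n p)).
  { intros n p. apply epsilon_spec, Step. }
  set (pt := fix pt (n : nat) : R * R := match n with O => (u, t) | S n => nxt n (pt n) end).
  assert (HB : forall n, Bad n (pt n)).
  { induction n as [|n IH].
    - unfold Bad; cbn [pt fst snd]. replace (L / 2 ^ 0) with L by (simpl; field).
      replace (H / 2 ^ 0) with H by (simpl; field). exact Hbad.
    - now apply Hnxt. }
  destruct (nested_halving (fun n => fst (pt n)) L) as [x Hx].
  { intros n. apply (Hnxt n (pt n) (HB n)). }
  destruct (nested_halving (fun n => snd (pt n)) H) as [y Hy].
  { intros n. apply (Hnxt n (pt n) (HB n)). }
  destruct (Hloc x y) as [del [Hd Hq']].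
  { specialize (Hx O). simpl in Hx. lra. }
  { specialize (Hy O). simpl in Hy. lra. }
  (* One index [N] makes both sides shorter than [del]; the [+ 1] covers [L = H = 0]. *)
  destruct (pow_lt_1_zero (/ 2)) with (y := del / (L + H + 1)) as [N HN].
  { rewrite Rabs_pos_eq; lra. }
  { apply Rdiv_lt_0_compat; lra. }
  specialize (HN N (Nat.le_refl N)). rewrite Rabs_pos_eq in HN by (apply pow_le; lra).
  rewrite pow_inv in HN. apply Rlt_div_r in HN; [|lra].
  assert (Hi : 0 < / 2 ^ N) by (apply Rinv_0_lt_compat, Pw).
  apply (HB N). apply Hq'; try apply Hx; try apply Hy; (split; [easy|]); unfold Rdiv; nra.
Qed.

Lemma goursat (G : C -> C) (u1 u2 t1 t2 : R) :
  u1 <= u2 -> t1 <= t2 ->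
  (forall w, in_rect u1 u2 t1 t2 w -> cdiff G w) ->
  rect_int G u1 u2 t1 t2 = 0.
Proof.
  intros Hu Ht HG.
  assert (Hc : forall w, in_rect u1 u2 t1 t2 w -> ccont G w)
    by (intros; now apply cdiff_ccont, HG).
  set (Z := (u2 - u1) + (t2 - t1)).
  assert (Main : forall eps, 0 < eps -> Cmod (rect_int G u1 u2 t1 t2) <= eps * Z ^ 2).
  { intros eps He.
    (* A bound quadratic in the size is what four quarters reproduce exactly when added. Containment
       in the given rectangle is a premise because the principle ranges over all rectangles. *)
    set (Q := fun a b l h => u1 <= a -> a + l <= u2 -> t1 <= b -> b + h <= t2 ->
       Cmod (rect_int G a (a + l) b (b + h)) <= eps * (l + h) ^ 2).
    assert (HQ : Q u1 t1 (u2 - u1) (t2 - t1)).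
    2:{ unfold Q in HQ. replace (u1 + (u2 - u1)) with u2 in HQ by ring.
        replace (t1 + (t2 - t1)) with t2 in HQ by ring. apply HQ; lra. }
    apply rectangle_bisection; try lra.
    - intros a b l h Hl Hh Q1 Q2 Q3 Q4 B1 B2 B3 B4.
      specialize (Q1 ltac:(lra) ltac:(lra) ltac:(lra) ltac:(lra)).
      specialize (Q2 ltac:(lra) ltac:(lra) ltac:(lra) ltac:(lra)).
      specialize (Q3 ltac:(lra) ltac:(lra) ltac:(lra) ltac:(lra)).
      specialize (Q4 ltac:(lra) ltac:(lra) ltac:(lra) ltac:(lra)).
      replace (a + l + l) with (a + 2 * l) in * by ring.
      replace (b + h + h) with (b + 2 * h) in * by ring.
      assert (Sub : forall w, in_rect a (a + 2 * l) b (b + 2 * h) w -> ccont G w).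
      { intros w [W1 W2]. apply Hc. split; lra. }
      rewrite (rect_int_split_u G a (a + l)) by (try lra; apply Sub).
      rewrite (rect_int_split_t G a (a + l) b (b + h))
        by (try lra; intros w [W1 W2]; apply Sub; split; lra).
      rewrite (rect_int_split_t G (a + l) (a + 2 * l) b (b + h))
        by (try lra; intros w [W1 W2]; apply Sub; split; lra).
      eapply Rle_trans; [apply Cmod_triangle|].
      eapply Rle_trans; [apply Rplus_le_compat; apply Cmod_triangle|].
      replace (eps * (2 * l + 2 * h) ^ 2) with (4 * (eps * (l + h) ^ 2)) by ring. lra.
    - (* Near a point of differentiability, only the remainder of the affine
         approximation contributes to the boundary integral. *)
      intros x y Hx Hy.
      assert (Hin : in_rect u1 u2 t1 t2 (x, y)) by (split; simpl; lra).
      destruct (HG _ Hin) as [d Hder].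
      destruct (Hder (eps / 2)) as [del [Hd Hder']]; [lra|].
      exists (del / 2). split; [lra|]. intros a b l h Hl Hh Ha Hb B1 B2 B3 B4.
      assert (Sub : forall w, in_rect a (a + l) b (b + h) w -> ccont G w).
      { intros w [W1 W2]. apply Hc. split; lra. }
      rewrite <- (rect_int_minus_affine G (G (x, y) - d * (x, y)) d) by (try lra; apply Sub).
      eapply Rle_trans.
      + apply rect_int_bound with (M := eps / 2 * (l + h)); try lra.
        * intros w Hw.
          apply (ccont_plus G (fun w => - (G (x, y) - d * (x, y) + d * w))%C); [now apply Sub|].
          apply ccont_ext_loc with (f := fun w => (- (G (x, y) - d * (x, y)) + (- d) * w)%C) (r := 1);
            [lra | intros; ring |].
          apply ccont_plus; [apply ccont_const|]. apply ccont_mult; [apply ccont_const | apply ccont_id].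
        * intros w [W1 W2].
          replace (G w - (G (x, y) - d * (x, y) + d * w))%C
            with (G w - G (x, y) - d * (w - (x, y)))%C by ring.
          assert (Hw : Cmod (w - (x, y)) <= l + h).
          { eapply Rle_trans; [apply Cmod_le_add|]. simpl.
            apply Rplus_le_compat; apply Rabs_le; lra. }
          eapply Rle_trans; [apply Hder'; lra|]. apply Rmult_le_compat_l; lra.
      + replace (a + l - a + (b + h - b)) with (l + h) by ring. apply Req_le. field. }
  apply Cmod_minus_small_eq. intros eps He.
  replace (rect_int G u1 u2 t1 t2 - 0)%C with (rect_int G u1 u2 t1 t2) by ring.
  assert (Zp : 0 <= Z ^ 2) by apply pow2_ge_0.
  eapply Rle_trans; [apply (Main (eps / (Z ^ 2 + 1))); apply Rdiv_lt_0_compat; lra|].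
  replace eps with (eps / (Z ^ 2 + 1) * (Z ^ 2 + 1)) at 2 by (field; lra).
  apply Rmult_le_compat_l; [apply Rdiv_le_0_compat; lra | lra].
Qed.

(** Differentiability may fail at one interior point, as happens for a slope function at its base
    point. A square of half-side [r] is cut out around [w0]; the rest is covered by [goursat], and
    the square contributes at most [8 * M * r], with [M] a bound for [G] near [w0]. *)
Lemma goursat_punctured (G : C -> C) (u1 u2 t1 t2 : R) (w0 : C) :
  u1 < fst w0 < u2 -> t1 < snd w0 < t2 ->
  (forall w, in_rect u1 u2 t1 t2 w -> ccont G w) ->
  (forall w, in_rect u1 u2 t1 t2 w -> w <> w0 -> cdiff G w) ->
  rect_int G u1 u2 t1 t2 = 0.
Proof.
  intros Hu Ht Hc HG. apply Cmod_minus_small_eq. intros eps He.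
  replace (rect_int G u1 u2 t1 t2 - 0)%C with (rect_int G u1 u2 t1 t2) by ring.
  destruct w0 as [u t]. simpl in Hu, Ht.
  assert (Hin : in_rect u1 u2 t1 t2 (u, t)) by (split; simpl; lra).
  destruct (ccont_bounded G _ (Hc _ Hin)) as [del [Hd HM]].
  assert (MP := Cmod_ge_0 (G (u, t))).
  set (M := Cmod (G (u, t)) + 1) in *.
  set (r := Rmin (Rmin (del / 3) (eps / (8 * M)))
             (Rmin (Rmin (u - u1) (u2 - u)) (Rmin (t - t1) (t2 - t)))).
  assert (Hr : 0 < r).
  { unfold r. repeat apply Rmin_pos; try lra. apply Rdiv_lt_0_compat; unfold M; lra. }
  assert (R1 : r <= del / 3 /\ r <= eps / (8 * M) /\ r <= u - u1 /\ r <= u2 - u /\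
               r <= t - t1 /\ r <= t2 - t).
  { unfold r. repeat split.
    - eapply Rle_trans; [apply Rmin_l | apply Rmin_l].
    - eapply Rle_trans; [apply Rmin_l | apply Rmin_r].
    - eapply Rle_trans; [apply Rmin_r|]. eapply Rle_trans; [apply Rmin_l|apply Rmin_l].
    - eapply Rle_trans; [apply Rmin_r|]. eapply Rle_trans; [apply Rmin_l|apply Rmin_r].
    - eapply Rle_trans; [apply Rmin_r|]. eapply Rle_trans; [apply Rmin_r|apply Rmin_l].
    - eapply Rle_trans; [apply Rmin_r|]. eapply Rle_trans; [apply Rmin_r|apply Rmin_r]. }
  clearbody r. destruct R1 as [R1 [R2 [R3 [R4 [R5 R6]]]]].
  rewrite (rect_int_split_u G u1 (u - r)) by (try lra; easy).
  rewrite (rect_int_split_u G (u - r) (u + r) u2)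
    by (try lra; intros w [W1 W2]; apply Hc; split; lra).
  rewrite (rect_int_split_t G (u - r) (u + r) t1 (t - r))
    by (try lra; intros w [W1 W2]; apply Hc; split; lra).
  rewrite (rect_int_split_t G (u - r) (u + r) (t - r) (t + r))
    by (try lra; intros w [W1 W2]; apply Hc; split; lra).
  rewrite (goursat G u1 (u - r)), (goursat G (u + r) u2),
    (goursat G (u - r) (u + r) t1), (goursat G (u - r) (u + r) (t + r)); try lra.
  2-5: intros w [W1 W2]; apply HG; [split; lra|]; intros ->; simpl in W1, W2; lra.
  replace (_ + _)%C with (rect_int G (u - r) (u + r) (t - r) (t + r)) by ring.
  eapply Rle_trans.
  - apply rect_int_bound with (M := M); try lra.
    + intros w [W1 W2]. apply Hc. split; lra.
    + intros w [W1 W2]. apply HM.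
      eapply Rle_lt_trans; [apply Cmod_le_add|]. simpl.
      apply Rle_lt_trans with (r + r); [|lra].
      apply Rplus_le_compat; apply Rabs_le; lra.
  - replace (2 * M * (u + r - (u - r) + (t + r - (t - r)))) with (r * (8 * M)) by ring.
    apply Rle_div_r in R2; [lra | unfold M; lra].
Qed.

(** * Circle means and Taylor expansion *)

Definition circ (rho t : R) : C := (RtoC rho * expi t)%C.

(* Not normalised: [2 PI] times the mean over the circle. *)
Definition cmean (F : C -> C) (rho : R) : C := CI (fun t => F (circ rho t)) 0 (2 * PI).

Lemma Cmod_circ (rho t : R) : 0 <= rho -> Cmod (circ rho t) = rho.
Proof. intros H. unfold circ. rewrite Cmod_mult, Cmod_expi, Cmod_RtoC_nonneg by easy. ring. Qed.

Lemma cexp_circ (u t : R) : cexp (u, t) = circ (exp u) t.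
Proof. reflexivity. Qed.

Lemma circ_ln (rho t : R) : 0 < rho -> circ rho t = cexp (ln rho, t).
Proof. intros H. unfold circ, cexp; simpl. now rewrite exp_ln. Qed.

Lemma expi_period (t : R) : expi (t + 2 * PI) = expi t.
Proof.
  unfold expi. replace (t + 2 * PI) with (t + 2 * INR 1 * PI) by (simpl; ring).
  now rewrite cos_period, sin_period.
Qed.

Lemma rcont_circ (F : C -> C) (rho t : R) : 0 < rho ->
  (forall w, Cmod w = rho -> ccont F w) -> rcont (fun t => F (circ rho t)) t.
Proof.
  intros H HF. apply rcont_comp; [apply HF, Cmod_circ; lra|].
  intros eps He.
  destruct (rcont_comp cexp (fun t => (ln rho, t)) t) with (eps := eps) as [d [Hd H']]; try easy.
  - apply cdiff_ccont, cdiff_cexp.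
  - apply rcont_vertical.
  - exists d. split; [easy|]. intros s Hs. rewrite !circ_ln by easy. now apply H'.
Qed.

Lemma EI_circ (F : C -> C) (rho a b : R) : 0 < rho ->
  (forall w, Cmod w = rho -> ccont F w) -> EI (fun t => F (circ rho t)) a b.
Proof. intros H HF. apply EI_rcont. intros t _. now apply rcont_circ. Qed.

Lemma CI_period (g : R -> C) (a : R) : (forall t, rcont g t) ->
  (forall t, g (t + 2 * PI) = g t) -> CI g a (a + 2 * PI) = CI g 0 (2 * PI).
Proof.
  intros Hc Hp.
  assert (E : forall a b, EI g a b) by (intros; apply EI_rcont; intros; apply Hc).
  assert (Sh : CI g (2 * PI) (a + 2 * PI) = CI g 0 a).
  { symmetry. apply CI_unique.
    assert (H := @is_RInt_comp_lin C_R_NormedModule g 1 (2 * PI) 0 a (CI g (2 * PI) (a + 2 * PI))).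
    apply (@is_RInt_ext C_R_NormedModule) with (2 := H ltac:(
      replace (1 * 0 + 2 * PI) with (2 * PI) by ring;
      replace (1 * a + 2 * PI) with (a + 2 * PI) by ring; apply CI_correct, E)).
    intros t _. rewrite (@scal_one R_AbsRing C_R_NormedModule). rewrite Rmult_1_l. apply Hp. }
  rewrite (CI_Chasles g a 0) by apply E. rewrite (CI_Chasles g 0 (2 * PI) (a + 2 * PI)) by apply E.
  rewrite Sh.
  assert (Z : (CI g a 0 + CI g 0 a)%C = 0).
  { rewrite <- CI_Chasles by apply E. apply (@RInt_point C_R_CompleteNormedModule). }
  replace (CI g a 0 + (CI g 0 (2 * PI) + CI g 0 a))%C
    with ((CI g a 0 + CI g 0 a) + CI g 0 (2 * PI))%C by ring.
  rewrite Z. ring.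
Qed.

Lemma expi_eq_1_small (x : R) : - PI <= x <= PI -> expi x = 1 -> x = 0.
Proof.
  intros Hx H. assert (Hc : cos x = 1) by (unfold expi, RtoC in H; congruence).
  assert (P := PI_RGT_0).
  replace x with (2 * (x / 2)) in Hc by field. rewrite cos_2a_sin in Hc.
  assert (Hs : sin (x / 2) = 0) by nra.
  destruct (Rtotal_order x 0) as [Hn|[Hz|Hp]]; [|easy|].
  - assert (A := sin_gt_0 (- (x / 2)) ltac:(lra) ltac:(lra)). rewrite sin_neg in A. lra.
  - assert (A := sin_gt_0 (x / 2) ltac:(lra) ltac:(lra)). lra.
Qed.

(** In a rectangle of height [2 * PI] centred at the level of [v], this makes [v] the only preimage
    of [cexp v], boundary included. *)
Lemma cexp_inj_strip (w v : C) : Rabs (snd w - snd v) <= PI -> cexp w = cexp v -> w = v.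
Proof.
  intros Hs E. assert (E1 : fst w = fst v).
  { apply exp_inv. rewrite <- !Cmod_cexp. now rewrite E. }
  apply injective_projections; [easy|].
  apply Rminus_diag_uniq, expi_eq_1_small; [apply Rabs_le_between, Hs|].
  unfold cexp in E. rewrite E1 in E.
  assert (Hn : RtoC (exp (fst v)) <> 0).
  { intros Z. apply RtoC_inj in Z. assert (A := exp_pos (fst v)). lra. }
  replace (snd w) with (snd w - snd v + snd v) in E by ring.
  rewrite expi_plus in E. assert (Hx := expi_neq_0 (snd v)).
  replace (expi (snd w - snd v))
    with (RtoC (exp (fst v)) * (expi (snd w - snd v) * expi (snd v)) / (RtoC (exp (fst v)) * expi (snd v)))%C
    by (field; now split).
  rewrite E. field. now split.
Qed.

(** In the coordinate [w] the annulus is a rectangle: its vertical sides give the two circle means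
    and its horizontal sides cancel by periodicity. Centring it at the argument of [z0] keeps the
    exceptional point off the cut, with a single interior preimage. *)
Lemma cmean_radius_punctured (F : C -> C) (r1 r2 : R) (z0 : C) :
  0 < r1 -> r1 < Cmod z0 < r2 ->
  (forall w, r1 <= Cmod w <= r2 -> ccont F w) ->
  (forall w, r1 <= Cmod w <= r2 -> w <> z0 -> cdiff F w) ->
  cmean F r1 = cmean F r2.
Proof.
  intros H1 Hz Hc Hd.
  destruct (polar_form_cexp z0) as [v Hv]; [apply Cmod_pos_neq_0; lra|].
  assert (Hr : exp (fst v) = Cmod z0) by (rewrite <- Hv; symmetry; apply Cmod_cexp).
  set (b := snd v). assert (P := PI_RGT_0).
  assert (Rg : forall w, in_rect (ln r1) (ln r2) (b - PI) (b - PI + 2 * PI) w -> r1 <= Cmod (cexp w) <= r2).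
  { intros w [[A B] _]. rewrite Cmod_cexp. rewrite <- (exp_ln r1), <- (exp_ln r2) by lra.
    split.
    - destruct A as [A| ->]; [now apply Rlt_le, exp_increasing | lra].
    - destruct B as [B| ->]; [now apply Rlt_le, exp_increasing | lra]. }
  assert (G0 : rect_int (fun w => F (cexp w)) (ln r1) (ln r2) (b - PI) (b - PI + 2 * PI) = 0).
  { apply goursat_punctured with v.
    - rewrite <- (ln_exp (fst v)), Hr. split; apply ln_increasing; lra.
    - fold b. lra.
    - intros w Hw. apply ccont_comp; [apply cdiff_ccont, cdiff_cexp | now apply Hc, Rg].
    - intros w Hw Hn. apply cdiff_comp; [apply cdiff_cexp|]. apply Hd; [now apply Rg|].
      rewrite <- Hv. intros E. apply Hn, cexp_inj_strip; [|easy].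
      destruct Hw as [_ Hw]. fold b. apply Rabs_le. lra. }
  assert (C1 : forall w, Cmod w = r1 -> ccont F w) by (intros w Hw; apply Hc; lra).
  assert (C2 : forall w, Cmod w = r2 -> ccont F w) by (intros w Hw; apply Hc; lra).
  assert (Z : CI (fun t => F (circ r2 t) - F (circ r1 t))%C (b - PI) (b - PI + 2 * PI) = 0).
  { unfold rect_int in G0.
    rewrite (CI_ext (fun u => F (cexp (u, (b - PI + 2 * PI)%R)) - F (cexp (u, (b - PI)%R)))%C (fun _ => RtoC 0)) in G0.
    2:{ intros t _. rewrite !cexp_circ. unfold circ. rewrite expi_period. ring. }
    rewrite CI_const in G0.
    rewrite (CI_ext _ (fun t => F (cexp (ln r2, t)) - F (cexp (ln r1, t)))%C).
    2:{ intros t _. now rewrite !circ_ln by lra. }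
    set (X := CI _ _ _) in *.
    replace X with (- Ci * (Ci * X - RtoC (ln r2 - ln r1) * 0))%C.
    - rewrite G0. ring.
    - transitivity (- (Ci * Ci) * X)%C; [ring|].
      replace (Ci * Ci)%C with (- RtoC 1)%C by (unfold Ci, Cmult, Copp, RtoC; simpl; f_equal; ring).
      ring. }
  rewrite CI_minus in Z by (apply EI_circ; try lra; easy).
  rewrite !CI_period in Z.
  - symmetry. apply Ceq_minus. exact Z.
  - intros t. apply rcont_circ; [lra|easy].
  - intros t. unfold circ. now rewrite expi_period.
  - intros t. apply rcont_circ; [lra|easy].
  - intros t. unfold circ. now rewrite expi_period.
Qed.

Lemma cmean_radius (F : C -> C) (r1 r2 : R) :
  0 < r1 < r2 -> (forall w, r1 <= Cmod w <= r2 -> cdiff F w) -> cmean F r1 = cmean F r2.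
Proof.
  intros H Hd. apply cmean_radius_punctured with (RtoC ((r1 + r2) / 2)).
  - lra.
  - rewrite Cmod_RtoC_nonneg; lra.
  - intros w Hw. now apply cdiff_ccont, Hd.
  - intros w Hw _. now apply Hd.
Qed.

Lemma cmean_bound (F : C -> C) (rho M : R) : 0 < rho ->
  (forall w, Cmod w = rho -> ccont F w) -> (forall w, Cmod w = rho -> Cmod (F w) <= M) ->
  Cmod (cmean F rho) <= 2 * PI * M.
Proof.
  intros H Hc HM. unfold cmean. assert (P := PI_RGT_0).
  replace (2 * PI * M) with ((2 * PI - 0) * M) by ring.
  apply CI_bound; [lra | now apply EI_circ |]. intros t _. apply HM, Cmod_circ. lra.
Qed.

(** Since the mean does not depend on the radius, it may be estimated where [F] is small: near 0 for
    positive powers, far out for negative powers and for the Cauchy kernel. *)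
Lemma cmean_eq_0 (F : C -> C) (rho : R) :
  (forall eps, 0 < eps -> exists r, 0 < r /\ cmean F r = cmean F rho /\
     (forall w, Cmod w = r -> ccont F w) /\ (forall w, Cmod w = r -> Cmod (F w) <= eps)) ->
  cmean F rho = 0.
Proof.
  intros H. apply Cmod_minus_small_eq. intros eps He. assert (P := PI_RGT_0).
  destruct (H (eps / (2 * PI))) as [r [Hr [E [Hc HM]]]]; [apply Rdiv_lt_0_compat; lra|].
  replace (cmean F rho - 0)%C with (cmean F r) by (rewrite E; ring).
  replace eps with (2 * PI * (eps / (2 * PI))) by (field; lra).
  now apply cmean_bound.
Qed.

Lemma cdiff_inv_pow (w : C) (j : nat) : w <> 0 -> cdiff (fun w => / Cpow w j)%C w.
Proof.
  intros H. apply (cdiff_inv (fun w => Cpow w j)).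
  - apply (cdiff_pow (fun w => w)), cdiff_id.
  - now apply Cpow_nz.
Qed.

Lemma cmean_pow (j : nat) (rho : R) : 0 < rho -> cmean (fun w => Cpow w (S j)) rho = 0.
Proof.
  intros H. apply cmean_eq_0. intros eps He.
  set (r := Rmin (rho / 2) (Rmin 1 eps)).
  assert (Hr : 0 < r) by (unfold r; repeat apply Rmin_pos; lra).
  assert (R1 : r <= rho / 2 /\ r <= 1 /\ r <= eps).
  { assert (A1 := Rmin_l (rho / 2) (Rmin 1 eps)). assert (A2 := Rmin_r (rho / 2) (Rmin 1 eps)).
    assert (A3 := Rmin_l 1 eps). assert (A4 := Rmin_r 1 eps). fold r in A1, A2. lra. }
  clearbody r. assert (D : forall w, cdiff (fun w => Cpow w (S j)) w).
  { intros w. apply (cdiff_pow (fun w => w)), cdiff_id. }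
  exists r. repeat split.
  - easy.
  - apply cmean_radius; [lra | intros; apply D].
  - intros; apply cdiff_ccont, D.
  - intros w Hw. rewrite Cmod_pow, Hw. simpl.
    assert (B : r ^ j <= 1) by (rewrite <- (pow1 j); apply pow_incr; lra).
    assert (B' : 0 <= r ^ j) by (apply pow_le; lra). nra.
Qed.

Lemma cmean_inv_pow (j : nat) (rho : R) : 0 < rho -> cmean (fun w => / Cpow w (S j))%C rho = 0.
Proof.
  intros H. apply cmean_eq_0. intros eps He.
  set (r := rho + 1 + / eps).
  assert (Hi : 0 < / eps) by now apply Rinv_0_lt_compat.
  assert (Hr : 1 <= r) by (unfold r; lra).
  assert (D : forall w, 0 < Cmod w -> cdiff (fun w => / Cpow w (S j))%C w).
  { intros w Hw. now apply cdiff_inv_pow, Cmod_pos_neq_0. }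
  exists r. repeat split.
  - lra.
  - symmetry. apply cmean_radius; [unfold r; lra | intros w Hw; apply D; lra].
  - intros w Hw; apply cdiff_ccont, D. lra.
  - intros w Hw. rewrite Cmod_inv by (apply Cpow_nz, Cmod_pos_neq_0; lra).
    rewrite Cmod_pow, Hw. rewrite <- (Rinv_inv eps). apply Rinv_le_contravar; [easy|].
    simpl. assert (B : 1 <= r ^ j) by now apply pow_R1_Rle.
    apply Rle_trans with r; [unfold r; lra | nra].
Qed.

(** With respect to the angle, the Cauchy kernel is [w / (w - z) = 1 + z / (w - z)]. This is its
    second part, which tends to 0 at infinity. *)
Lemma cmean_cauchy_kernel (z : C) (rho : R) : Cmod z < rho ->
  cmean (fun w => z * / (w - z))%C rho = 0.
Proof.
  intros H. assert (Zp := Cmod_ge_0 z). apply cmean_eq_0. intros eps He.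
  set (r := rho + 1 + Cmod z / eps).
  assert (Hi : 0 <= Cmod z / eps) by now apply Rdiv_le_0_compat.
  assert (N : forall w, rho <= Cmod w -> (w - z)%C <> 0).
  { intros w Hw E. assert (T := Cmod_triangle_inv w z). rewrite E, Cmod_0 in T. lra. }
  assert (D : forall w, rho <= Cmod w -> cdiff (fun w => z * / (w - z))%C w).
  { intros w Hw. apply cdiff_mult; [apply cdiff_const|].
    apply (cdiff_inv (fun w => w - z)%C); [apply cdiff_minus_const | now apply N]. }
  exists r. repeat split.
  - unfold r; lra.
  - symmetry. apply cmean_radius; [unfold r; lra | intros w Hw; apply D; lra].
  - intros w Hw; apply cdiff_ccont, D. unfold r in Hw; lra.
  - intros w Hw. assert (Hw' : rho <= Cmod w) by (unfold r in Hw; lra).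
    rewrite Cmod_mult, Cmod_inv by now apply N.
    assert (T := Cmod_triangle_inv w z).
    assert (B : Cmod z / eps < Cmod (w - z)) by (unfold r in Hw; lra).
    apply Rmult_le_reg_r with (Cmod (w - z)); [lra|].
    rewrite Rmult_assoc, Rinv_l by lra. rewrite Rmult_1_r.
    apply Rlt_div_l in B; lra.
Qed.

Lemma circle_bounded (F : C -> C) (rho : R) : 0 < rho ->
  (forall w, Cmod w = rho -> ccont F w) ->
  exists M, 0 <= M /\ forall w, Cmod w = rho -> Cmod (F w) <= M.
Proof.
  intros Hr Hc. assert (P := PI_RGT_0).
  destruct (continuity_ab_maj (fun t => Cmod (F (circ rho t))) 0 (2 * PI)) as [Mx [H _]]; [lra| |].
  - intros t _. intros eps He. destruct (rcont_circ F rho t Hr Hc eps He) as [d [Hd H]].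
    exists d. split; [easy|]. intros s [_ Hs].
    eapply Rle_lt_trans; [|apply (H s Hs)].
    apply Rabs_le. simpl.
    assert (T1 := Cmod_triangle_inv (F (circ rho s)) (F (circ rho t))).
    assert (T2 := Cmod_triangle_inv (F (circ rho t)) (F (circ rho s))).
    rewrite (Cmod_minus_sym (F (circ rho t))) in T2. lra.
  - exists (Cmod (F (circ rho Mx))). split; [apply Cmod_ge_0|].
    intros w Hw. destruct (polar_form w) as [t [Ht E]]. rewrite E, Hw. now apply H.
Qed.

Lemma CI_Csum (k : nat -> C) (h : nat -> R -> C) (a b : R) (N : nat) :
  (forall n, EI (h n) a b) ->
  EI (fun t => Csum_lt (fun n => k n * h n t)%C N) a b /\
  CI (fun t => Csum_lt (fun n => k n * h n t)%C N) a b = Csum_lt (fun n => k n * CI (h n) a b)%C N.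
Proof.
  intros H. induction N as [|N [I1 I2]]; simpl.
  - split; [apply EI_const|]. rewrite CI_const. ring.
  - split.
    + apply EI_plus; [easy|]. now apply EI_Cmult.
    + rewrite CI_plus; [|easy|now apply EI_Cmult]. rewrite I2. f_equal. now apply CI_Cmult.
Qed.

Lemma Csum_ext (f g : nat -> C) (n : nat) :
  (forall k, (k < n)%nat -> f k = g k) -> Csum_lt f n = Csum_lt g n.
Proof.
  induction n as [|n IH]; intros H; simpl; [easy|].
  rewrite IH, H; [easy | lia | intros; apply H; lia].
Qed.

Lemma Csum_Cmult (k : C) (f : nat -> C) (n : nat) :
  Csum_lt (fun i => k * f i)%C n = (k * Csum_lt f n)%C.
Proof. induction n as [|n IH]; simpl; [ring|]. rewrite IH. ring. Qed.

Lemma Csum_plus (f g : nat -> C) (n : nat) :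
  Csum_lt (fun i => f i + g i)%C n = (Csum_lt f n + Csum_lt g n)%C.
Proof. induction n as [|n IH]; simpl; [ring|]. rewrite IH. ring. Qed.

Lemma cauchy_kernel_expansion (w z : C) (N : nat) : w <> 0 -> (w - z)%C <> 0 ->
  (w * / (w - z) = Csum_lt (fun n => Cpow z n * / Cpow w n) N
                   + Cpow z N * / Cpow w N * (w * / (w - z)))%C.
Proof.
  intros Hw Hz. induction N as [|N IH]; simpl.
  - field. easy.
  - rewrite IH at 1. assert (Hp : Cpow w N <> 0) by now apply Cpow_nz.
    field. repeat split; easy.
Qed.

(** Cauchy's formula and the expansion of the kernel are done at once: the mean of [w * phi w]
    vanishes, where [phi] is the slope of [F] at [z], and the geometric sum is cut after [N] terms.
    The explicit remainder is what [removable_zero] uses, with [N = 3]. *)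
Lemma taylor (F : C -> C) (R0 rho : R) : 0 < rho < R0 ->
  (forall w, Cmod w < R0 -> cdiff F w) ->
  exists (y : nat -> C) (M : R), 0 <= M /\ forall z, Cmod z < rho -> forall N,
    Cmod (F z - Csum_lt (fun n => y n * Cpow z n)%C N) <= M * ((Cmod z / rho) ^ N * (rho / (rho - Cmod z))).
Proof.
  intros Hr HF. assert (P := PI_RGT_0).
  assert (Hc : forall w, Cmod w = rho -> ccont F w).
  { intros w Hw. apply cdiff_ccont, HF. lra. }
  destruct (circle_bounded F rho) as [M [HM0 HM]]; [lra|easy|].
  assert (P2 : RtoC (2 * PI) <> 0) by (intros E; apply RtoC_inj in E; lra).
  exists (fun n => / RtoC (2 * PI) * cmean (fun w => F w * / Cpow w n)%C rho)%C, M.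
  split; [easy|]. intros z Hz N. assert (Zp := Cmod_ge_0 z).
  destruct (HF z) as [d Hder]; [lra|].
  destruct (cderiv_slope F z d Hder) as [phi [Ephi [_ Hphi]]].
  assert (Ephi' : forall w, w <> z -> phi w = ((F w + - F z) * / (w - z))%C).
  { intros w Hw. assert (w - z <> 0)%C by now apply Cminus_eq_contra.
    change (F w + - F z)%C with (F w - F z)%C. rewrite Ephi. field. easy. }
  assert (Dphi : forall w, Cmod w < R0 -> w <> z -> cdiff phi w).
  { intros w Hw Hn. assert (Hn' : (w - z <> 0)%C) by now apply Cminus_eq_contra.
    apply cdiff_ext_loc with (f := fun w => ((F w + - F z) * / (w - z))%C) (r := Cmod (w - z)).
    - now apply Cmod_gt_0.
    - intros v Hv. symmetry. apply Ephi'. intros ->. rewrite Cmod_minus_sym in Hv. lra.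
    - apply cdiff_mult.
      + apply cdiff_plus; [now apply HF | apply cdiff_const].
      + apply (cdiff_inv (fun w => w - z)%C); [apply cdiff_minus_const | easy]. }
  assert (Cphi : forall w, Cmod w < R0 -> ccont phi w).
  { intros w Hw. destruct (Ceq_dec w z) as [->|Hn]; [easy|]. now apply cdiff_ccont, Dphi. }
  (* [psi] is continuous on the disc and vanishes at 0, so its circle means are 0;
     this is Cauchy's formula for [F z]. *)
  set (psi := fun w => (w * phi w)%C).
  assert (Cpsi : forall w, Cmod w < R0 -> ccont psi w).
  { intros w Hw. apply ccont_mult; [apply ccont_id | now apply Cphi]. }
  assert (Dpsi : forall w, Cmod w < R0 -> w <> z -> cdiff psi w).
  { intros w Hw Hn. apply cdiff_mult; [apply cdiff_id | now apply Dphi]. }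
  assert (Z : cmean psi rho = 0).
  { apply cmean_eq_0. intros eps He.
    destruct (ccont_bounded phi 0) as [del [Hd HK]]; [apply Cphi; rewrite Cmod_0; lra|].
    assert (Kp := Cmod_ge_0 (phi 0)). set (K := Cmod (phi 0) + 1) in *.
    assert (HK0 : 0 < eps / K) by (apply Rdiv_lt_0_compat; unfold K; lra).
    (* For [z] nonzero, [r < Cmod z] puts [z] strictly inside the annulus between [r] and [rho], as
       [cmean_radius_punctured] asks; for [z = 0] it lies outside that annulus. *)
    assert (X : exists r, 0 < r /\ r < rho /\ r < del /\ r <= eps / K /\ (z <> 0 -> r < Cmod z)).
    { destruct (Ceq_dec z 0) as [Ez|Hz0].
      - exists (Rmin (Rmin (rho / 2) (del / 2)) (eps / K)).
        assert (A1 := Rmin_l (Rmin (rho / 2) (del / 2)) (eps / K)).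
        assert (A2 := Rmin_r (Rmin (rho / 2) (del / 2)) (eps / K)).
        assert (A3 := Rmin_l (rho / 2) (del / 2)). assert (A4 := Rmin_r (rho / 2) (del / 2)).
        repeat split; try lra; [|easy]. repeat apply Rmin_pos; lra.
      - assert (Hz1 : 0 < Cmod z) by now apply Cmod_gt_0.
        exists (Rmin (Rmin (Cmod z / 2) (del / 2)) (eps / K)).
        assert (A1 := Rmin_l (Rmin (Cmod z / 2) (del / 2)) (eps / K)).
        assert (A2 := Rmin_r (Rmin (Cmod z / 2) (del / 2)) (eps / K)).
        assert (A3 := Rmin_l (Cmod z / 2) (del / 2)). assert (A4 := Rmin_r (Cmod z / 2) (del / 2)).
        repeat split; try lra. repeat apply Rmin_pos; lra. }
    destruct X as [r [X1 [X2 [X3 [X4 X5]]]]]. exists r. repeat split.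
    - easy.
    - destruct (Ceq_dec z 0) as [Ez|Hz0].
      + apply cmean_radius; [lra|]. intros w Hw. apply Dpsi; [lra|].
        rewrite Ez. apply Cmod_pos_neq_0. lra.
      + apply cmean_radius_punctured with z; [easy | specialize (X5 Hz0); lra | |].
        * intros w Hw. apply Cpsi. lra.
        * intros w Hw. apply Dpsi. lra.
    - intros w Hw. apply Cpsi. lra.
    - intros w Hw. unfold psi. rewrite Cmod_mult, Hw.
      assert (B : Cmod (phi w) <= K).
      { apply HK. replace (w - 0)%C with w by ring. lra. }
      apply Rle_div_r in X4; [|unfold K; lra].
      eapply Rle_trans; [|exact X4]. apply Rmult_le_compat_l; lra. }
  assert (Nz : forall w, Cmod w = rho -> w <> 0) by (intros w Hw; apply Cmod_pos_neq_0; lra).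
  assert (Nzz : forall w, Cmod w = rho -> (w - z)%C <> 0).
  { intros w Hw E. assert (T := Cmod_triangle_inv w z). rewrite E, Cmod_0 in T. lra. }
  set (rem := fun w => (Cpow z N * (/ Cpow w N * (F w * (w * / (w - z)))))%C).
  assert (Crem : forall w, Cmod w = rho -> ccont rem w).
  { intros w Hw. apply cdiff_ccont. apply cdiff_mult; [apply cdiff_const|].
    apply cdiff_mult; [apply cdiff_inv_pow; auto|]. apply cdiff_mult; [apply HF; lra|].
    apply cdiff_mult; [apply cdiff_id|]. apply (cdiff_inv (fun w => w - z)%C); [apply cdiff_minus_const | auto]. }
  assert (Cn : forall n w, Cmod w = rho -> ccont (fun w => F w * / Cpow w n)%C w).
  { intros n w Hw. apply cdiff_ccont, cdiff_mult; [apply HF; lra|]. apply cdiff_inv_pow; auto. }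
  assert (Ck : forall w, Cmod w = rho -> ccont (fun w => z * / (w - z))%C w).
  { intros w Hw. apply cdiff_ccont, cdiff_mult; [apply cdiff_const|].
    apply (cdiff_inv (fun w => w - z)%C); [apply cdiff_minus_const | auto]. }
  destruct (CI_Csum (fun n => Cpow z n) (fun n t => F (circ rho t) * / Cpow (circ rho t) n)%C 0 (2 * PI) N)
    as [S1 S2].
  { intros n. apply (EI_circ (fun w => F w * / Cpow w n)%C); [lra | apply Cn]. }
  (* [psi] is a difference of two kernel terms. The one with [F w] is expanded to order [N]; the one
     with [F z] is split as [1 + z / (w - z)]. *)
  assert (Z2 : cmean psi rho =
    (Csum_lt (fun n => Cpow z n * cmean (fun w => F w * / Cpow w n)%C rho)%C N + cmean rem rho
      - (RtoC (2 * PI) * F z + F z * cmean (fun w => z * / (w - z))%C rho))%C).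
  { unfold cmean at 1.
    rewrite (CI_ext _ (fun t =>
      (Csum_lt (fun n => Cpow z n * (F (circ rho t) * / Cpow (circ rho t) n))%C N + rem (circ rho t))
       - (F z + F z * (z * / (circ rho t - z))))%C).
    - rewrite CI_minus.
      + rewrite CI_plus; [|easy|apply EI_circ; [lra|easy]].
        rewrite CI_plus; [|apply EI_const|].
        * rewrite CI_const, S2. rewrite (CI_Cmult (F z) (fun t => z * / (circ rho t - z))%C).
          -- replace (2 * PI - 0) with (2 * PI) by ring. reflexivity.
          -- apply (EI_circ (fun w => z * / (w - z))%C); [lra | easy].
        * apply (EI_Cmult (F z) (fun t => z * / (circ rho t - z))%C).
          apply (EI_circ (fun w => z * / (w - z))%C); [lra | easy].
      + apply EI_plus; [easy|apply EI_circ; [lra|easy]].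
      + apply EI_plus; [apply EI_const|]. apply (EI_Cmult (F z) (fun t => z * / (circ rho t - z))%C).
        apply (EI_circ (fun w => z * / (w - z))%C); [lra | easy].
    - intros t _. assert (Hw := Cmod_circ rho t ltac:(lra)). set (w := circ rho t) in *.
      assert (W0 := Nz w Hw). assert (W1 := Nzz w Hw).
      unfold psi, rem. rewrite Ephi' by (intros E; apply W1; rewrite E; ring).
      rewrite (Csum_ext _ (fun n => F w * (Cpow z n * / Cpow w n))%C) by (intros; ring).
      rewrite Csum_Cmult.
      replace (w * ((F w + - F z) * / (w - z)))%C
        with (F w * (w * / (w - z)) - F z * (w * / (w - z)))%C by ring.
      rewrite (cauchy_kernel_expansion w z N W0 W1) at 1.
      replace (w * / (w - z))%C with (1 + z * / (w - z))%C at 2 by (field; easy).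
      ring. }
  rewrite Z, cmean_cauchy_kernel in Z2 by easy.
  assert (E : (F z - Csum_lt (fun n => / RtoC (2 * PI) * cmean (fun w => F w * / Cpow w n)%C rho * Cpow z n)%C N
               = / RtoC (2 * PI) * cmean rem rho)%C).
  { rewrite (Csum_ext _ (fun n => / RtoC (2 * PI) * (Cpow z n * cmean (fun w => F w * / Cpow w n)%C rho))%C)
      by (intros; ring).
    rewrite Csum_Cmult. set (S := Csum_lt _ N) in *. set (Rm := cmean rem rho) in *.
    replace (F z) with (/ RtoC (2 * PI) * (S + Rm))%C; [ring|].
    replace (S + Rm)%C with (RtoC (2 * PI) * F z)%C; [field; easy|].
    replace (S + Rm)%C with ((S + Rm - (RtoC (2 * PI) * F z + F z * 0)) + RtoC (2 * PI) * F z)%C by ring.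
    rewrite <- Z2. ring. }
  rewrite E, Cmod_mult, Cmod_inv, Cmod_RtoC_nonneg by (try easy; lra).
  apply Rmult_le_reg_l with (2 * PI); [lra|].
  rewrite <- Rmult_assoc, Rinv_r, Rmult_1_l by lra.
  apply cmean_bound; [lra | easy |].
  intros w Hw. unfold rem. rewrite !Cmod_mult, !Cmod_inv by (try apply Cpow_nz; auto).
  rewrite !Cmod_pow, Hw.
  assert (T := Cmod_triangle_inv w z). rewrite Hw in T.
  assert (A : Cmod (F w) * (rho * / Cmod (w - z)) <= M * (rho * / (rho - Cmod z))).
  { apply Rmult_le_compat; [apply Cmod_ge_0 | | now apply HM |].
    - apply Rmult_le_pos; [lra|]. apply Rlt_le, Rinv_0_lt_compat. lra.
    - apply Rmult_le_compat_l; [lra|]. apply Rinv_le_contravar; lra. }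
  assert (A2 : 0 <= (Cmod z / rho) ^ N) by (apply pow_le, Rdiv_le_0_compat; lra).
  unfold Rdiv at 1 2. rewrite Rpow_mult_distr, pow_inv. unfold Rdiv in A2. rewrite Rpow_mult_distr, pow_inv in A2.
  replace (Cmod z ^ N * (/ rho ^ N * (Cmod (F w) * (rho * / Cmod (w - z)))))
    with (Cmod z ^ N * / rho ^ N * (Cmod (F w) * (rho * / Cmod (w - z)))) by ring.
  replace (M * (Cmod z ^ N * / rho ^ N * (rho * / (rho - Cmod z))))
    with (Cmod z ^ N * / rho ^ N * (M * (rho * / (rho - Cmod z)))) by ring.
  now apply Rmult_le_compat_l.
Qed.

(** The quotient is the slope [phi] of [g] at [q]. Away from [q] the quotient rule applies; at [q]
    its differentiability is a second-order property of [g], read off from three Taylor terms, and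
    [y 2] is the derivative. *)
Lemma removable_zero (g : C -> C) (q : C) (r : R) : 0 < r ->
  (forall w, Cmod (w - q) < r -> cdiff g w) -> g q = 0 ->
  exists g1, (forall w, Cmod (w - q) < r -> cdiff g1 w) /\ forall w, g w = ((w - q) * g1 w)%C.
Proof.
  intros Hr Hg H0.
  destruct (Hg q) as [d Hd]; [rewrite Cmod_self_minus; lra|].
  destruct (cderiv_slope g q d Hd) as [phi [E [Ed Hphi]]].
  assert (Ephi : forall w, g w = ((w - q) * phi w)%C).
  { intros w. replace (g w) with (g w - g q)%C by (rewrite H0; ring). rewrite E. ring. }
  exists phi. split; [|exact Ephi].
  intros w Hw. destruct (Ceq_dec w q) as [->|Hn].
  2:{ assert (Hn' : (w - q <> 0)%C) by now apply Cminus_eq_contra.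
      apply cdiff_ext_loc with (f := fun w => (g w * / (w - q))%C) (r := Cmod (w - q)).
      - now apply Cmod_gt_0.
      - intros v Hv. rewrite Ephi. field. intros Ez.
        assert (v = q) by now apply Ceq_minus. subst v. rewrite Cmod_minus_sym in Hv. lra.
      - apply cdiff_mult; [now apply Hg|].
        apply (cdiff_inv (fun w => w - q)%C); [apply cdiff_minus_const | easy]. }
  set (F := fun z => g (z + q)%C).
  destruct (taylor F r (r / 2)) as [y [M [HM HT]]]; [lra| |].
  { intros z Hz. apply (cdiff_comp g (fun z => z + q)%C).
    - apply cdiff_plus; [apply cdiff_id | apply cdiff_const].
    - apply Hg. now replace (z + q - q)%C with z by ring. }
  assert (Hy0 : y O = 0).
  { specialize (HT 0 ltac:(rewrite Cmod_0; lra) 1%nat). simpl in HT. rewrite Cmod_0 in HT.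
    unfold F in HT. replace (0 + q)%C with q in HT by ring. rewrite H0 in HT.
    replace (0 - (0 + y O * 1))%C with (- y O)%C in HT by ring. rewrite Cmod_opp in HT.
    replace (M * (0 / (r / 2) * 1 * (r / 2 / (r / 2 - 0)))) with 0 in HT by (field; lra).
    apply Cmod_eq_0. assert (A := Cmod_ge_0 (y O)). lra. }
  (* [taylor] is used with radius [r / 2]: the cube of [Cmod z / (r / 2)] gives [8 / r ^ 3], and
     [(r / 2) / (r / 2 - Cmod z)] is at most 2 when [Cmod z < r / 4]. *)
  set (K := M * (8 / r ^ 3 * 2)).
  assert (HK : 0 <= K).
  { unfold K. apply Rmult_le_pos; [easy|]. apply Rmult_le_pos; [|lra].
    apply Rdiv_le_0_compat; [lra | apply pow_lt; lra]. }
  assert (B : forall v, Cmod (v - q) < r / 4 -> v <> q ->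
     Cmod (phi v - y 1%nat - y 2%nat * (v - q)) <= K * Cmod (v - q) ^ 2).
  { intros v Hv Hn. set (z := (v - q)%C) in *.
    assert (Hz : z <> 0) by now apply Cminus_eq_contra.
    assert (Hzp : 0 < Cmod z) by now apply Cmod_gt_0.
    specialize (HT z ltac:(lra) 3%nat). simpl in HT. unfold F in HT.
    replace (z + q)%C with v in HT by (unfold z; ring). rewrite Hy0, Ephi in HT. fold z in HT.
    replace (z * phi v - (0 + 0 * 1 + y 1%nat * (z * 1) + y 2%nat * (z * (z * 1))))%C
      with (z * (phi v - y 1%nat - y 2%nat * z))%C in HT by ring.
    rewrite Cmod_mult in HT. apply Rmult_le_reg_l with (Cmod z); [easy|].
    eapply Rle_trans; [exact HT|].
    replace (Cmod z * (K * Cmod z ^ 2)) with (M * (Cmod z ^ 3 * (8 / r ^ 3) * 2)) by (unfold K; ring).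
    apply Rmult_le_compat_l; [easy|].
    replace (Cmod z / (r / 2) * (Cmod z / (r / 2) * (Cmod z / (r / 2) * 1)))
      with (Cmod z ^ 3 * (8 / r ^ 3)) by (field; lra).
    apply Rmult_le_compat_l.
    - apply Rmult_le_pos; [apply pow_le; lra|]. apply Rdiv_le_0_compat; [lra | apply pow_lt; lra].
    - apply Rle_div_l; lra. }
  (* The estimate [B] excludes [v = q]; the value there follows from continuity of [phi], tested
     along [q + t]. *)
  assert (Hq : phi q = y 1%nat).
  { apply Cmod_minus_small_eq. intros eps He.
    assert (Y := Cmod_ge_0 (y 2%nat)).
    destruct (Hphi (eps / 2)) as [del [Hdel Hp]]; [lra|].
    set (D := K * r + Cmod (y 2%nat) + 1).
    assert (HD : 0 < D) by (unfold D; nra).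
    set (t := Rmin (Rmin (r / 8) (del / 2)) (eps / (2 * D))).
    assert (T1 := Rmin_l (Rmin (r / 8) (del / 2)) (eps / (2 * D))).
    assert (T2 := Rmin_r (Rmin (r / 8) (del / 2)) (eps / (2 * D))).
    assert (T3 := Rmin_l (r / 8) (del / 2)). assert (T4 := Rmin_r (r / 8) (del / 2)).
    assert (Ht : 0 < t).
    { unfold t. repeat apply Rmin_pos; try lra. apply Rdiv_lt_0_compat; lra. }
    fold t in T1, T2. clearbody t.
    assert (Ev : Cmod (q + RtoC t - q) = t).
    { replace (q + RtoC t - q)%C with (RtoC t) by ring. apply Cmod_RtoC_nonneg. lra. }
    specialize (B (q + RtoC t)%C ltac:(rewrite Ev; lra)
      ltac:(intros Eq; rewrite Eq, Cmod_self_minus in Ev; lra)).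
    specialize (Hp (q + RtoC t)%C ltac:(rewrite Ev; lra)).
    set (v := (q + RtoC t)%C) in *.
    replace (phi q - y 1%nat)%C
      with (- (phi v - phi q) + (phi v - y 1%nat - y 2%nat * (v - q)) + y 2%nat * (v - q))%C by ring.
    eapply Rle_trans; [apply Cmod_triangle|].
    eapply Rle_trans; [apply Rplus_le_compat_r; apply Cmod_triangle|].
    rewrite Cmod_opp, Cmod_mult. rewrite Ev in *.
    apply Rle_div_r in T2; [|lra].
    assert (T5 : K * t ^ 2 <= K * r * t).
    { replace (K * t ^ 2) with (K * t * t) by ring. replace (K * r * t) with (K * t * r) by ring.
      apply Rmult_le_compat_l; [apply Rmult_le_pos|]; lra. }
    unfold D in T2.
    replace (t * (2 * (K * r + Cmod (y 2%nat) + 1)))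
      with (2 * (K * r * t + Cmod (y 2%nat) * t + t)) in T2 by ring. lra. }
  exists (y 2%nat). intros eps He.
  exists (Rmin (r / 4) (eps / (K + 1))). split.
  { apply Rmin_pos; [lra | apply Rdiv_lt_0_compat; lra]. }
  intros v Hv.
  assert (T1 := Rmin_l (r / 4) (eps / (K + 1))). assert (T2 := Rmin_r (r / 4) (eps / (K + 1))).
  destruct (Ceq_dec v q) as [->|Hn].
  { replace (phi q - phi q - y 2%nat * (q - q))%C with (RtoC 0) by ring.
    rewrite Cmod_0, Cmod_self_minus. lra. }
  rewrite Hq. eapply Rle_trans; [apply B; [lra|easy]|].
  assert (Hp := Cmod_ge_0 (v - q)).
  assert (Hv' : Cmod (v - q) < eps / (K + 1)) by lra. apply Rlt_div_r in Hv'; [|lra].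
  replace (K * Cmod (v - q) ^ 2) with (K * Cmod (v - q) * Cmod (v - q)) by ring.
  apply Rmult_le_compat_r; nra.
Qed.

(** * Complex series and Cauchy estimates for their coefficients *)

Definition cser (h : nat -> C) (l : C) : Prop :=
  forall eps, 0 < eps -> exists N, forall n, (N <= n)%nat -> Cmod (Csum_lt h n - l) < eps.

Lemma Csum_bound (h : nat -> C) (b : nat -> R) (n : nat) :
  (forall k, (k < n)%nat -> Cmod (h k) <= b k) ->
  Cmod (Csum_lt h n) <= sum_f_R0 b n - b n.
Proof.
  induction n as [|n IH]; intros H; simpl.
  - rewrite Cmod_0. lra.
  - eapply Rle_trans; [apply Cmod_triangle|].
    assert (A := H n ltac:(lia)). assert (B := IH ltac:(intros; apply H; lia)). lra.
Qed.

Lemma Csum_geom_diff (h : nat -> C) (K th : R) (n k : nat) : 0 <= th < 1 -> 0 <= K ->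
  (forall k, (n <= k)%nat -> Cmod (h k) <= K * th ^ k) ->
  Cmod (Csum_lt h (n + k) - Csum_lt h n) <= K * th ^ n * / (1 - th).
Proof.
  intros Ht HK H. assert (P : 0 <= th ^ n) by (apply pow_le; lra).
  assert (I : Cmod (Csum_lt h (n + k) - Csum_lt h n) <= K * th ^ n * ((1 - th ^ k) * / (1 - th))).
  { induction k as [|k IH].
    - rewrite Nat.add_0_r, Cmod_self_minus. simpl. lra.
    - rewrite Nat.add_succ_r. simpl.
      replace (Csum_lt h (n + k) + h (n + k)%nat - Csum_lt h n)%C
        with ((Csum_lt h (n + k) - Csum_lt h n) + h (n + k)%nat)%C by ring.
      eapply Rle_trans; [apply Cmod_triangle|].
      assert (A := H (n + k)%nat ltac:(lia)). rewrite pow_add in A.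
      replace (K * th ^ n * ((1 - th * th ^ k) * / (1 - th)))
        with (K * th ^ n * ((1 - th ^ k) * / (1 - th)) + K * (th ^ n * th ^ k)) by (field; lra). lra. }
  eapply Rle_trans; [exact I|]. apply Rmult_le_compat_l; [now apply Rmult_le_pos|].
  assert (0 < / (1 - th)) by (apply Rinv_0_lt_compat; lra).
  assert (0 <= th ^ k) by (apply pow_le; lra). nra.
Qed.

Lemma cser_tail (h : nat -> C) (l : C) (K th : R) (n : nat) : 0 <= th < 1 -> 0 <= K -> cser h l ->
  (forall k, (n <= k)%nat -> Cmod (h k) <= K * th ^ k) ->
  Cmod (l - Csum_lt h n) <= K * th ^ n * / (1 - th).
Proof.
  intros Ht HK Hl H. apply Rle_plus_epsilon. intros eps He.
  destruct (Hl eps He) as [N HN]. specialize (HN (n + N)%nat ltac:(lia)).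
  replace (l - Csum_lt h n)%C
    with (- (Csum_lt h (n + N) - l) + (Csum_lt h (n + N) - Csum_lt h n))%C by ring.
  eapply Rle_trans; [apply Cmod_triangle|]. rewrite Cmod_opp.
  assert (A := Csum_geom_diff h K th n N Ht HK H). lra.
Qed.

Lemma cser_terms_bounded (h : nat -> C) (l : C) : cser h l ->
  exists K, 0 <= K /\ forall k, Cmod (h k) <= K.
Proof.
  intros H. destruct (H 1) as [N HN]; [lra|].
  assert (B : forall M, exists K, 0 <= K /\ forall k, (k < M)%nat -> Cmod (h k) <= K).
  { induction M as [|M [K [HK IH]]].
    - exists 0. split; [lra|]. intros; lia.
    - exists (K + Cmod (h M)). assert (A := Cmod_ge_0 (h M)). split; [lra|]. intros k Hk.
      destruct (Nat.eq_dec k M) as [->|Hn]; [lra|]. specialize (IH k ltac:(lia)). lra. }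
  destruct (B N) as [K [HK B']]. exists (K + 2). split; [lra|]. intros k.
  destruct (Nat.lt_ge_cases k N) as [Hk|Hk]; [specialize (B' k Hk); lra|].
  assert (A1 := HN k Hk). assert (A2 := HN (S k) ltac:(lia)). simpl in A2.
  replace (h k) with ((Csum_lt h k + h k - l) - (Csum_lt h k - l))%C by ring.
  eapply Rle_trans; [apply Cmod_triangle_minus|]. lra.
Qed.

Lemma pow_lt_eps (th eps : R) : 0 <= th < 1 -> 0 < eps -> exists N, forall n, (N <= n)%nat -> th ^ n < eps.
Proof.
  intros H He. destruct (pow_lt_1_zero th) with (y := eps) as [N HN]; [rewrite Rabs_pos_eq; lra | lra |].
  exists N. intros n Hn. specialize (HN n Hn). rewrite Rabs_pos_eq in HN; [easy | apply pow_le; lra].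
Qed.

(** Convergence at the larger radius [r] dominates the terms on the circle by a geometric sequence.
    The mean can then be taken term by term, and orthogonality of the powers leaves only [y n]. *)
Lemma cser_coef_cmean (F : C -> C) (y : nat -> C) (rho r : R) (n : nat) : 0 < rho < r ->
  (forall w, Cmod w = rho -> ccont F w) ->
  (forall w, Cmod w = rho -> cser (fun k => y k * Cpow w k)%C (F w)) ->
  (exists l, cser (fun k => y k * Cpow (RtoC r) k)%C l) ->
  cmean (fun w => F w * / Cpow w n)%C rho = (RtoC (2 * PI) * y n)%C.
Proof.
  intros Hr Hc HF [l Hl]. assert (P := PI_RGT_0).
  destruct (cser_terms_bounded _ _ Hl) as [K [HK HKb]].
  set (th := rho / r). assert (Hth : 0 <= th < 1).
  { unfold th. split; [apply Rdiv_le_0_compat; lra | apply Rlt_div_l; lra]. }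
  assert (Yb : forall w k, Cmod w = rho -> Cmod (y k * Cpow w k) <= K * th ^ k).
  { intros w k Hw. specialize (HKb k). rewrite Cmod_mult, Cmod_pow in *.
    rewrite Cmod_RtoC_nonneg in HKb by lra. rewrite Hw. unfold th, Rdiv.
    rewrite Rpow_mult_distr, pow_inv.
    assert (Hp : 0 < r ^ k) by (apply pow_lt; lra).
    assert (Hq : 0 <= rho ^ k * / r ^ k).
    { apply Rmult_le_pos; [apply pow_le; lra | now apply Rlt_le, Rinv_0_lt_compat]. }
    replace (Cmod (y k) * rho ^ k) with (Cmod (y k) * r ^ k * (rho ^ k * / r ^ k)) by (field; lra).
    now apply Rmult_le_compat_r. }
  assert (Nz : forall w, Cmod w = rho -> w <> 0) by (intros w Hw; apply Cmod_pos_neq_0; lra).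
  assert (Cp : forall k w, Cmod w = rho -> ccont (fun w => Cpow w k * / Cpow w n)%C w).
  { intros k w Hw. apply cdiff_ccont, cdiff_mult; [|apply cdiff_inv_pow; auto].
    apply (cdiff_pow (fun w => w)), cdiff_id. }
  assert (Orth : forall k, cmean (fun w => Cpow w k * / Cpow w n)%C rho
                   = if Nat.eq_dec k n then RtoC (2 * PI) else RtoC 0).
  { intros k. destruct (Nat.eq_dec k n) as [->|Hn].
    - unfold cmean. rewrite (CI_ext _ (fun _ => RtoC 1)).
      + rewrite CI_const. replace (2 * PI - 0) with (2 * PI) by ring. ring.
      + intros t _. field. apply Cpow_nz, Nz, Cmod_circ. lra.
    - destruct (Nat.lt_ge_cases k n) as [Hk|Hk].
      + rewrite <- (cmean_inv_pow (n - k - 1) rho) by lra.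
        unfold cmean. apply CI_ext. intros t _. assert (Hz := Nz _ (Cmod_circ rho t ltac:(lra))).
        replace n with (k + S (n - k - 1))%nat at 1 by lia. rewrite Cpow_add_r.
        field. split; now apply Cpow_nz.
      + rewrite <- (cmean_pow (k - n - 1) rho) by lra.
        unfold cmean. apply CI_ext. intros t _. assert (Hz := Nz _ (Cmod_circ rho t ltac:(lra))).
        replace k with (n + S (k - n - 1))%nat at 1 by lia. rewrite Cpow_add_r.
        field. now apply Cpow_nz. }
  apply Cmod_minus_small_eq. intros eps He.
  set (D := 2 * PI * (K * / (1 - th) * / rho ^ n) + 1).
  assert (Hi : 0 < / (1 - th)) by (apply Rinv_0_lt_compat; lra).
  assert (Hrn : 0 < / rho ^ n) by (apply Rinv_0_lt_compat, pow_lt; lra).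
  assert (HD : 0 < D).
  { unfold D. assert (0 <= K * / (1 - th) * / rho ^ n) by (repeat apply Rmult_le_pos; lra). nra. }
  destruct (pow_lt_eps th (eps / D) Hth) as [N0 HN0]; [apply Rdiv_lt_0_compat; lra|].
  (* [N] exceeds [n], so the partial sum contains the one term that survives. *)
  set (N := (N0 + S n)%nat). specialize (HN0 N ltac:(unfold N; lia)).
  destruct (CI_Csum y (fun k t => Cpow (circ rho t) k * / Cpow (circ rho t) n)%C 0 (2 * PI) N) as [S1 S2].
  { intros k. apply (EI_circ (fun w => Cpow w k * / Cpow w n)%C); [lra | apply Cp]. }
  assert (S3 : CI (fun t => Csum_lt (fun k => y k * (Cpow (circ rho t) k * / Cpow (circ rho t) n))%C N) 0 (2 * PI)
     = (RtoC (2 * PI) * y n)%C).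
  { rewrite S2.
    rewrite (Csum_ext _ (fun k => y k * (if Nat.eq_dec k n then RtoC (2 * PI) else RtoC 0))%C)
      by (intros k _; f_equal; apply Orth).
    assert (G : forall M, Csum_lt (fun k => y k * (if Nat.eq_dec k n then RtoC (2 * PI) else RtoC 0))%C M
       = if le_lt_dec M n then RtoC 0 else (RtoC (2 * PI) * y n)%C).
    { induction M as [|M IH]; cbn [Csum_lt].
      { destruct (le_lt_dec 0 n); [easy|lia]. }
      rewrite IH. generalize (RtoC (2 * PI)); intros p.
      destruct (le_lt_dec M n), (le_lt_dec (S M) n), (Nat.eq_dec M n); try lia; subst; ring. }
    rewrite G. destruct (le_lt_dec N n); [unfold N in *; lia | easy]. }
  rewrite <- S3. unfold cmean.
  rewrite <- CI_minus.
  2:{ apply (EI_circ (fun w => F w * / Cpow w n)%C); [lra|]. intros w Hw.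
      apply ccont_mult; [now apply Hc|]. apply cdiff_ccont, cdiff_inv_pow. auto. }
  2: exact S1.
  eapply Rle_trans.
  - apply CI_bound with (M := K * th ^ N * / (1 - th) * / rho ^ n); [lra | |].
    + apply EI_minus; [|exact S1].
      apply (EI_circ (fun w => F w * / Cpow w n)%C); [lra|]. intros w Hw.
      apply ccont_mult; [now apply Hc|]. apply cdiff_ccont, cdiff_inv_pow. auto.
    + intros t _. assert (Hw := Cmod_circ rho t ltac:(lra)). set (w := circ rho t) in *.
      rewrite (Csum_ext _ (fun k => / Cpow w n * (y k * Cpow w k))%C) by (intros; ring).
      rewrite Csum_Cmult.
      replace (F w * / Cpow w n - / Cpow w n * Csum_lt (fun k => y k * Cpow w k)%C N)%C
        with ((F w - Csum_lt (fun k => y k * Cpow w k)%C N) * / Cpow w n)%C by ring.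
      rewrite Cmod_mult, Cmod_inv, Cmod_pow, Hw by (apply Cpow_nz; auto).
      apply Rmult_le_compat_r; [lra|].
      apply cser_tail; try easy; [now apply HF|]. intros k _. now apply Yb.
  - replace ((2 * PI - 0) * (K * th ^ N * / (1 - th) * / rho ^ n)) with (th ^ N * (D - 1)) by (unfold D; ring).
    apply Rlt_div_r in HN0; [|easy]. assert (0 <= th ^ N) by (apply pow_le; lra). nra.
Qed.

(** The coefficient is read on a circle of radius below [sigma], where the series represents [F],
    and the mean is then moved across the annulus to radius [rho], where it is estimated. *)
Lemma coef_bound (F : C -> C) (y : nat -> C) (r0 sigma r1 rho : R) :
  0 < r0 < sigma -> sigma <= rho < r1 ->
  (forall w, r0 < Cmod w < r1 -> cdiff F w) ->
  (forall w, Cmod w < sigma -> cser (fun k => y k * Cpow w k)%C (F w)) ->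
  exists M, 0 <= M /\ forall n, Cmod (y n) <= M * / rho ^ n.
Proof.
  intros H0 H1 HF Hs. assert (P := PI_RGT_0).
  destruct (circle_bounded F rho) as [M [HM0 HM]]; [lra | intros; apply cdiff_ccont, HF; lra |].
  exists M. split; [easy|]. intros n.
  set (r := (r0 + sigma) / 2).
  assert (E := cser_coef_cmean F y r ((r + sigma) / 2) n).
  rewrite (cmean_radius _ r rho) in E.
  - assert (B : Cmod (RtoC (2 * PI) * y n) <= 2 * PI * (M * / rho ^ n)).
    { rewrite <- E.
      - apply cmean_bound; [lra| |].
        + intros w Hw. apply cdiff_ccont, cdiff_mult; [apply HF; lra|].
          apply cdiff_inv_pow, Cmod_pos_neq_0. lra.
        + intros w Hw. rewrite Cmod_mult, Cmod_inv, Cmod_pow, Hw by (apply Cpow_nz, Cmod_pos_neq_0; lra).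
          apply Rmult_le_compat_r; [|now apply HM]. apply Rlt_le, Rinv_0_lt_compat, pow_lt. lra.
      - unfold r; lra.
      - intros w Hw. apply cdiff_ccont, HF. unfold r in Hw; lra.
      - intros w Hw. apply Hs. unfold r in Hw; lra.
      - eexists. apply Hs. rewrite Cmod_RtoC_nonneg; unfold r; lra. }
    rewrite Cmod_mult, Cmod_RtoC_nonneg in B by lra.
    apply Rmult_le_reg_l with (2 * PI); lra.
  - unfold r; lra.
  - intros w Hw. apply cdiff_mult; [apply HF; unfold r in Hw; lra|].
    apply cdiff_inv_pow, Cmod_pos_neq_0. unfold r in Hw; lra.
Qed.

(** * Clearing the poles on the circle of convergence *)

Definition root_prod (ps : list C) (w : C) : C :=
  fold_right (fun p a => (1 - w * / p) * a)%C (RtoC 1) ps.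

Lemma root_prod_app (l1 l2 : list C) (w : C) :
  root_prod (l1 ++ l2) w = (root_prod l1 w * root_prod l2 w)%C.
Proof. induction l1 as [|p l IH]; simpl; [ring|]. rewrite IH. ring. Qed.

Lemma root_prod_repeat (p w : C) (n : nat) :
  root_prod (repeat p n) w = Cpow (1 - w * / p) n.
Proof. induction n as [|n IH]; simpl; [easy|]. now rewrite IH. Qed.

Lemma cdiff_root_prod (ps : list C) (w : C) : cdiff (root_prod ps) w.
Proof.
  induction ps as [|p l IH]; [apply (cdiff_const (RtoC 1))|].
  apply (cdiff_mult (fun w => 1 - w * / p)%C (root_prod l)); [|easy].
  apply cdiff_ext_loc with (f := fun w => (1 + (- / p) * w)%C) (r := 1); [lra | intros; ring |].
  apply cdiff_plus; [apply cdiff_const|]. apply cdiff_mult; [apply cdiff_const | apply cdiff_id].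
Qed.

(** Punctured, because [f] may take any value at a singularity. *)
Definition clim (f : C -> C) (w l : C) : Prop :=
  forall eps, 0 < eps -> exists del, 0 < del /\
    forall v, v <> w -> Cmod (v - w) < del -> Cmod (f v - l) < eps.

Lemma clim_unique (f : C -> C) (w l l' : C) : clim f w l -> clim f w l' -> l = l'.
Proof.
  intros H H'. apply Cmod_minus_small_eq. intros eps He.
  destruct (H (eps / 2)) as [d [Hd HN]]; [lra|]. destruct (H' (eps / 2)) as [d' [Hd' HN']]; [lra|].
  set (t := Rmin d d' / 2). assert (T1 := Rmin_l d d'). assert (T2 := Rmin_r d d').
  assert (Ht : 0 < Rmin d d') by now apply Rmin_pos.
  set (v := (w + RtoC t)%C).
  assert (Ev : Cmod (v - w) = t).
  { unfold v. replace (w + RtoC t - w)%C with (RtoC t) by ring. apply Cmod_RtoC_nonneg. unfold t; lra. }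
  assert (Hv : v <> w) by (intros E; rewrite E, Cmod_self_minus in Ev; unfold t in Ev; lra).
  specialize (HN v Hv ltac:(unfold t in Ev; lra)). specialize (HN' v Hv ltac:(unfold t in Ev; lra)).
  replace (l - l')%C with ((f v - l') - (f v - l))%C by ring.
  eapply Rle_trans; [apply Cmod_triangle_minus|]. lra.
Qed.

Lemma circle_point_neq_0 (sigma : R) (p : C) : 0 < sigma -> Cmod p = sigma -> p <> 0.
Proof. intros H E. apply Cmod_pos_neq_0. lra. Qed.

(* [ps] may repeat a point, which encodes the multiplicity of a zero of [root_prod]. *)
Lemma clear_poles (U : C -> Prop) (f : C -> C) (sigma : R) : 0 < sigma ->
  meromorphic_on U f -> (forall z, Cmod z <= sigma -> U z) ->
  exists (ps : list C) (F : C -> C) (r0 r1 : R),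
    0 < r0 < sigma /\ sigma < r1 /\ (forall p, In p ps -> Cmod p = sigma) /\
    (forall w, r0 < Cmod w < r1 -> cdiff F w) /\
    (forall w, Cmod w < sigma -> F w = (root_prod ps w * f w)%C).
Proof.
  intros Hs [_ Hm] HU.
  assert (Hloc : forall t : R, exists d : R * nat * (C -> C), 0 < fst (fst d) /\
     holomorphic_on_ball (snd d) (circ sigma t) (fst (fst d)) /\
     forall z, Cmod (z - circ sigma t) < fst (fst d) -> z <> circ sigma t ->
       f z = (snd d z / Cpow (z - circ sigma t) (snd (fst d)))%C).
  { intros t. destruct (Hm (circ sigma t)) as [r [m [g H]]].
    - apply HU. rewrite Cmod_circ; lra.
    - now exists (r, m, g). }
  set (data := fun t => proj1_sig (constructive_indefinite_description _ (Hloc t))).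
  assert (Hdata : forall t, 0 < fst (fst (data t)) /\
     holomorphic_on_ball (snd (data t)) (circ sigma t) (fst (fst (data t))) /\
     forall z, Cmod (z - circ sigma t) < fst (fst (data t)) -> z <> circ sigma t ->
       f z = (snd (data t) z / Cpow (z - circ sigma t) (snd (fst (data t))))%C).
  { intros t. exact (proj2_sig (constructive_indefinite_description _ (Hloc t))). }
  clearbody data. clear Hloc Hm HU.
  set (rr := fun t => fst (fst (data t))). set (mm := fun t => snd (fst (data t))).
  set (gg := fun t => snd (data t)).
  assert (Hdel : forall t, exists d : posreal, forall s, Rabs (s - t) < d ->
            Cmod (circ sigma s - circ sigma t) < rr t / 2).
  { intros t. destruct (Hdata t) as [Hr _].
    destruct (rcont_circ (fun w => w) sigma t Hs (fun w _ => ccont_id w) (rr t / 2)) as [d [Hd H]].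
    - unfold rr. lra.
    - now exists (mkposreal d Hd). }
  set (del := fun t => proj1_sig (constructive_indefinite_description _ (Hdel t))).
  assert (Hdel' : forall t s, Rabs (s - t) < del t -> Cmod (circ sigma s - circ sigma t) < rr t / 2).
  { intros t. exact (proj2_sig (constructive_indefinite_description _ (Hdel t))). }
  clearbody del.
  (* A finite subcover of the circle, parametrised by the angle. [compactness_list] speaks of
     tuples, hence the pairs with [tt], and concludes under a double negation. *)
  assert (HT : exists T : list R, forall x, 0 <= x <= 2 * PI -> exists t, In t T /\ Rabs (x - t) < del t).
  { apply NNPP. intros Hno.
    apply (compactness_list 1 (0, tt) (2 * PI, tt) (fun t => del (fst t))).
    intros [l Hl]. apply Hno. exists (map fst l). intros x Hx.
    destruct (Hl (x, tt)) as [[t []] [Ht [_ [Hc _]]]]; [now split|].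
    exists t. split; [|easy]. apply in_map_iff. now exists (t, tt). }
  destruct HT as [T HT].
  (* A point within [d] of the circle is within [rr t / 2] of its radial projection, which is within
     [rr t / 2] of some chosen centre; so the annulus of half-width [d] is covered by the discs. *)
  assert (Hmin : exists d, 0 < d /\ d < sigma /\ forall t, In t T -> d <= rr t / 2).
  { clear HT. induction T as [|t T [d [Hd [Hd' IH]]]].
    - exists (sigma / 2). split; [lra|]. split; [lra|]. easy.
    - exists (Rmin d (rr t / 2)). destruct (Hdata t) as [Hr _]. fold (rr t) in Hr.
      assert (T1 := Rmin_l d (rr t / 2)). assert (T2 := Rmin_r d (rr t / 2)). split; [apply Rmin_pos; lra|].
      split; [lra|]. intros s [<-|Hin]; [easy|]. specialize (IH s Hin). lra. }
  destruct Hmin as [d [Hd [Hds Hmin]]].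
  set (ps := flat_map (fun t => repeat (circ sigma t) (mm t)) T).
  assert (Hps : forall p, In p ps -> Cmod p = sigma).
  { intros p Hp. apply in_flat_map in Hp. destruct Hp as [t [_ Hp]].
    apply repeat_spec in Hp. rewrite Hp. apply Cmod_circ. lra. }
  (* The factors of [root_prod] contributed by the index [t] cancel the local denominator, up to the
     constant [Cpow (- / p) (mm t)]. *)
  assert (Hh : forall t, In t T -> exists h, forall w, Cmod (w - circ sigma t) < rr t ->
     cdiff h w /\ (w <> circ sigma t -> (root_prod ps w * f w)%C = h w)).
  { intros t Ht. destruct (in_split _ _ Ht) as [l1 [l2 El]].
    destruct (Hdata t) as [Hr [Hg Hf]]. fold (rr t) (gg t) (mm t) in *.
    set (p := circ sigma t) in *.
    assert (Hp0 : p <> 0) by (apply (circle_point_neq_0 sigma); [easy | apply Cmod_circ; lra]).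
    set (ps1 := flat_map (fun t => repeat (circ sigma t) (mm t)) l1).
    set (ps2 := flat_map (fun t => repeat (circ sigma t) (mm t)) l2).
    assert (Eps : ps = ps1 ++ repeat p (mm t) ++ ps2).
    { unfold ps. rewrite El, flat_map_app. reflexivity. }
    exists (fun w => root_prod ps1 w * (root_prod ps2 w * (Cpow (- / p) (mm t) * gg t w)))%C.
    intros w Hw. split.
    - apply cdiff_mult; [apply cdiff_root_prod|]. apply cdiff_mult; [apply cdiff_root_prod|].
      apply cdiff_mult; [apply cdiff_const|]. apply ex_derive_cdiff, Hg, Hw.
    - intros Hn. assert (Hn' : (w - p <> 0)%C) by now apply Cminus_eq_contra.
      rewrite Eps, !root_prod_app, root_prod_repeat, (Hf w Hw Hn). fold (gg t) (mm t).
      replace (1 - w * / p)%C with ((- / p) * (w - p))%C by (field; easy).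
      rewrite Cpow_mult_l. field. now apply Cpow_nz. }
  (* Taking limits from the circle outwards glues the local extensions [h] with no compatibility
     check on overlaps: a punctured limit is unique, so each [h] agrees with [F] on its whole
     disc. *)
  set (F := fun w => if Rlt_dec (Cmod w) sigma then (root_prod ps w * f w)%C
              else epsilon (inhabits (RtoC 0)) (clim (fun v => root_prod ps v * f v)%C w)).
  exists ps, F, (sigma - d), (sigma + d).
  split; [lra|]. split; [lra|]. split; [easy|]. split.
  - intros w Hw. destruct (polar_form w) as [x [Hx Ew]].
    destruct (HT x Hx) as [t [Ht Hxt]]. destruct (Hh t Ht) as [h Hhol].
    specialize (Hmin t Ht). specialize (Hdel' t x Hxt).
    assert (Hwb : Cmod (w - circ sigma t) < rr t).
    { replace (w - circ sigma t)%C with ((w - circ sigma x) + (circ sigma x - circ sigma t))%C by ring.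
      eapply Rle_lt_trans; [apply Cmod_triangle|].
      assert (B : Cmod (w - circ sigma x) < d).
      { rewrite Ew at 1. unfold circ.
        replace (RtoC (Cmod w) * expi x - RtoC sigma * expi x)%C with (RtoC (Cmod w - sigma) * expi x)%C
          by (rewrite RtoC_minus; ring).
        rewrite Cmod_mult, Cmod_expi, Cmod_R, Rmult_1_r. apply Rabs_def1; lra. }
      lra. }
    assert (EF : forall v, Cmod (v - circ sigma t) < rr t -> h v = F v).
    { intros v Hv. destruct (Hhol v Hv) as [Dv Ev]. unfold F.
      destruct (Rlt_dec (Cmod v) sigma) as [Hlt|Hge].
      - symmetry. apply Ev. intros E. rewrite E, Cmod_circ in Hlt; lra.
      - assert (L : clim (fun v => root_prod ps v * f v)%C v (h v)).
        { intros eps He. destruct (cdiff_ccont h v Dv eps He) as [e [He' Hc]].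
          assert (X : exists e', 0 < e' /\ e' <= e /\ e' <= rr t - Cmod (v - circ sigma t) /\
                    (v <> circ sigma t -> e' <= Cmod (v - circ sigma t))).
          { destruct (Ceq_dec v (circ sigma t)) as [E|Hn].
            - exists (Rmin e (rr t - Cmod (v - circ sigma t))).
              split; [apply Rmin_pos; lra|]. split; [apply Rmin_l|]. split; [apply Rmin_r|]. easy.
            - exists (Rmin (Rmin e (rr t - Cmod (v - circ sigma t))) (Cmod (v - circ sigma t))).
              assert (Hp : 0 < Cmod (v - circ sigma t)) by now apply Cmod_gt_0, Cminus_eq_contra.
              assert (T1 := Rmin_l e (rr t - Cmod (v - circ sigma t))).
              assert (T2 := Rmin_r e (rr t - Cmod (v - circ sigma t))).
              assert (T3 := Rmin_l (Rmin e (rr t - Cmod (v - circ sigma t))) (Cmod (v - circ sigma t))).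
              assert (T4 := Rmin_r (Rmin e (rr t - Cmod (v - circ sigma t))) (Cmod (v - circ sigma t))).
              split; [repeat apply Rmin_pos; lra|]. repeat split; lra. }
          destruct X as [e' [X1 [X2 [X3 X4]]]].
          exists e'. split; [easy|]. intros u Hu Hud.
          assert (Hub : Cmod (u - circ sigma t) < rr t).
          { replace (u - circ sigma t)%C with ((u - v) + (v - circ sigma t))%C by ring.
            eapply Rle_lt_trans; [apply Cmod_triangle|]. lra. }
          destruct (Hhol u Hub) as [_ Eu]. rewrite Eu; [apply Hc; lra|].
          intros E. destruct (Ceq_dec v (circ sigma t)) as [E'|Hn]; [congruence|].
          specialize (X4 Hn). rewrite E, Cmod_minus_sym in Hud. lra. }
        apply clim_unique with (1 := L). apply epsilon_spec. now exists (h v). }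
    destruct (Hhol w Hwb) as [Dw _].
    apply cdiff_ext_loc with (f := h) (r := rr t - Cmod (w - circ sigma t)); [lra| |easy].
    intros v Hv. apply EF.
    replace (v - circ sigma t)%C with ((v - w) + (w - circ sigma t))%C by ring.
    eapply Rle_lt_trans; [apply Cmod_triangle|]. lra.
  - intros w Hw. unfold F. destruct (Rlt_dec (Cmod w) sigma); [easy|lra].
Qed.

(** * Exponential-polynomial sequences *)

Lemma is_series_cser (a : nat -> C) (l : C) :
  @is_series C_AbsRing C_NormedModule a l -> cser a l.
Proof.
  intros H eps He.
  destruct (proj1 (filterlim_locally _ _) H (mkposreal (eps / 2) ltac:(lra))) as [N HN].
  assert (E : forall n, @sum_n C_AbelianMonoid a n = Csum_lt a (S n)).
  { induction n as [|n IH].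
    - rewrite sum_O. simpl. ring.
    - rewrite sum_Sn, IH. reflexivity. }
  exists (S N). intros n Hn. destruct n as [|n]; [lia|].
  specialize (HN n ltac:(lia)). rewrite <- E.
  apply Cmod_of_ball_C in HN. simpl in HN.
  eapply Rlt_le_trans; [exact HN|]. lra.
Qed.

Lemma cser_ext (a b : nat -> C) (l : C) : (forall k, a k = b k) -> cser a l -> cser b l.
Proof.
  intros E H eps He. destruct (H eps He) as [N HN]. exists N. intros n Hn.
  rewrite <- (Csum_ext a b) by (intros; apply E). now apply HN.
Qed.

Lemma geom_cser (h : nat -> C) (K th : R) : 0 <= th < 1 ->
  (forall k, Cmod (h k) <= K * th ^ k) -> exists l, cser h l.
Proof.
  intros Ht H.
  destruct (@ex_series_le C_AbsRing C_CompleteNormedModule h (fun k => K * th ^ k)) as [l Hl].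
  - exact H.
  - apply (@ex_series_scal_l R_AbsRing). apply ex_series_geom. rewrite Rabs_pos_eq; lra.
  - exists l. now apply is_series_cser.
Qed.

Lemma cser_plus (a b : nat -> C) (l m : C) : cser a l -> cser b m ->
  cser (fun k => a k + b k)%C (l + m)%C.
Proof.
  intros Ha Hb eps He. destruct (Ha (eps / 2)) as [N HN]; [lra|].
  destruct (Hb (eps / 2)) as [N' HN']; [lra|]. exists (N + N')%nat. intros n Hn.
  rewrite Csum_plus. specialize (HN n ltac:(lia)). specialize (HN' n ltac:(lia)).
  replace (Csum_lt a n + Csum_lt b n - (l + m))%C
    with ((Csum_lt a n - l) + (Csum_lt b n - m))%C by ring.
  eapply Rle_lt_trans; [apply Cmod_triangle|]. lra.
Qed.

Lemma cser_Cmult (c : C) (a : nat -> C) (l : C) : cser a l -> cser (fun k => c * a k)%C (c * l)%C.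
Proof.
  intros Ha eps He. assert (P := Cmod_ge_0 c).
  destruct (Ha (eps / (Cmod c + 1))) as [N HN]; [apply Rdiv_lt_0_compat; lra|].
  exists N. intros n Hn. specialize (HN n Hn). rewrite Csum_Cmult.
  replace (c * Csum_lt a n - c * l)%C with (c * (Csum_lt a n - l))%C by ring.
  rewrite Cmod_mult. apply Rlt_div_r in HN; [|lra].
  assert (Q := Cmod_ge_0 (Csum_lt a n - l)). nra.
Qed.

Lemma contraction_to_0 (d e : nat -> R) (r : R) : 0 <= r < 1 -> (forall n, 0 <= d n) ->
  (forall n, d (S n) <= e n + r * d n) ->
  (forall eps, 0 < eps -> exists N, forall n, (N <= n)%nat -> e n < eps) ->
  forall eps, 0 < eps -> exists N, forall n, (N <= n)%nat -> d n < eps.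
Proof.
  intros Hr Hd Hrec He eps Heps.
  destruct (He (eps * (1 - r) / 2)) as [N HN]; [apply Rdiv_lt_0_compat; nra|].
  assert (I : forall k, d (N + k)%nat <= eps / 2 + r ^ k * d N).
  { induction k as [|k IH].
    - rewrite Nat.add_0_r. simpl. lra.
    - rewrite Nat.add_succ_r. specialize (Hrec (N + k)%nat). specialize (HN (N + k)%nat ltac:(lia)).
      simpl. assert (r * d (N + k)%nat <= r * (eps / 2 + r ^ k * d N)) by (apply Rmult_le_compat_l; lra).
      nra. }
  assert (Q := Hd N).
  destruct (pow_lt_eps r (eps / (2 * (d N + 1)))) as [N' HN']; [lra | apply Rdiv_lt_0_compat; lra|].
  exists (N + N')%nat. intros n Hn. specialize (I (n - N)%nat). specialize (HN' (n - N)%nat ltac:(lia)).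
  replace (N + (n - N))%nat with n in I by lia. apply Rlt_div_r in HN'; [|lra].
  assert (0 <= r ^ (n - N)) by (apply pow_le; lra). nra.
Qed.

(* Coefficients of [(1 - z / p) * sum_k v_k z^k]. *)
Definition mul_root (p : C) (v : nat -> C) (k : nat) : C :=
  (v k - / p * match k with O => RtoC 0 | S k' => v k' end)%C.

Lemma Csum_mul_root (p w : C) (v : nat -> C) (n : nat) :
  Csum_lt (fun k => mul_root p v k * Cpow w k)%C (S n) =
  (Csum_lt (fun k => v k * Cpow w k) (S n) - w * / p * Csum_lt (fun k => v k * Cpow w k) n)%C.
Proof.
  induction n as [|n IH].
  - simpl. unfold mul_root. ring.
  - change (Csum_lt (fun k => mul_root p v k * Cpow w k)%C (S (S n)))
      with (Csum_lt (fun k => mul_root p v k * Cpow w k)%C (S n) + mul_root p v (S n) * Cpow w (S n))%C.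
    rewrite IH. simpl. unfold mul_root. ring.
Qed.

Lemma cser_mul_root (p w l : C) (v : nat -> C) :
  cser (fun k => v k * Cpow w k)%C l -> cser (fun k => mul_root p v k * Cpow w k)%C ((1 - w * / p) * l)%C.
Proof.
  intros H eps He. set (c := (w * / p)%C). assert (P := Cmod_ge_0 c).
  destruct (H (eps / (Cmod c + 1))) as [N HN]; [apply Rdiv_lt_0_compat; lra|].
  exists (S N). intros n Hn. destruct n as [|n]; [lia|]. rewrite Csum_mul_root. fold c.
  assert (A := HN (S n) ltac:(lia)). assert (B := HN n ltac:(lia)).
  set (V := Csum_lt _ (S n)) in *. set (W := Csum_lt _ n) in *.
  replace (V - c * W - (1 - c) * l)%C with ((V - l) + - (c * (W - l)))%C by ring.
  eapply Rle_lt_trans; [apply Cmod_triangle|]. rewrite Cmod_opp, Cmod_mult.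
  apply Rlt_div_r in A; [|lra]. apply Rlt_div_r in B; [|lra].
  set (e1 := Cmod (V - l)) in *. set (e2 := Cmod (W - l)) in *.
  assert (0 <= e1) by apply Cmod_ge_0. assert (0 <= e2) by apply Cmod_ge_0.
  apply Rmult_lt_reg_r with (Cmod c + 1); [lra|].
  replace ((e1 + Cmod c * e2) * (Cmod c + 1)) with (e1 * (Cmod c + 1) + Cmod c * (e2 * (Cmod c + 1))) by ring.
  nra.
Qed.

(** Convergence for [v] is part of the conclusion. With [c = w / p] of modulus below 1, the distance
    of the partial sums to the candidate limit obeys [d (S n) <= e n + Cmod c * d n], where [e] is
    the error of the given series, and [contraction_to_0] applies. *)
Lemma cser_div_root (p w l : C) (v : nat -> C) : Cmod w < Cmod p ->
  cser (fun k => mul_root p v k * Cpow w k)%C l -> cser (fun k => v k * Cpow w k)%C (l * / (1 - w * / p))%C.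
Proof.
  intros Hwp H. assert (Wp := Cmod_ge_0 w).
  assert (Hp : p <> 0) by (apply Cmod_pos_neq_0; lra).
  set (c := (w * / p)%C).
  assert (Hc : 0 <= Cmod c < 1).
  { split; [apply Cmod_ge_0|]. unfold c. rewrite Cmod_mult, Cmod_inv by easy.
    apply Rmult_lt_reg_r with (Cmod p); [lra|]. rewrite Rmult_assoc, Rinv_l; lra. }
  assert (Hc1 : (1 - c)%C <> 0).
  { intros E. assert (T := Cmod_triangle_inv 1 c). rewrite E, Cmod_0, Cmod_1 in T. lra. }
  set (L := (l * / (1 - c))%C).
  assert (G := contraction_to_0 (fun n => Cmod (Csum_lt (fun k => v k * Cpow w k)%C n - L))
     (fun n => Cmod (Csum_lt (fun k => mul_root p v k * Cpow w k)%C (S n) - l)) (Cmod c) Hc).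
  refine (G _ _ _); clear G.
  - intros n. apply Cmod_ge_0.
  - intros n. rewrite <- Cmod_mult. eapply Rle_trans; [|apply Cmod_triangle].
    apply Req_le. f_equal. rewrite Csum_mul_root. fold c.
    set (V := Csum_lt _ (S n)). set (W := Csum_lt _ n).
    replace l with ((1 - c) * L)%C by (unfold L; field; easy). ring.
  - intros eps He. destruct (H eps He) as [N HN]. exists N. intros n Hn. apply HN. lia.
Qed.

Definition bin (a k : nat) : R := Binomial.C (k + a) a.

Lemma bin_k_0 (a : nat) : bin a 0 = 1.
Proof.
  unfold bin, Binomial.C. simpl. rewrite Nat.sub_diag. simpl. field. apply INR_fact_neq_0.
Qed.

Lemma bin_0_l (k : nat) : bin 0 k = 1.
Proof.
  unfold bin, Binomial.C. rewrite Nat.add_0_r, Nat.sub_0_r. simpl. field. apply INR_fact_neq_0.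
Qed.

Lemma bin_pascal (a k : nat) : bin (S a) (S k) = bin (S a) k + bin a (S k).
Proof.
  unfold bin. rewrite Nat.add_succ_r. rewrite <- pascal by lia.
  replace (k + S a)%nat with (S k + a)%nat by lia. ring.
Qed.

Lemma bin_succ (a k : nat) : bin (S a) k = bin a k * (INR k + INR a + 1) / (INR a + 1).
Proof.
  unfold bin, Binomial.C.
  replace (k + S a - S a)%nat with k by lia. replace (k + a - a)%nat with k by lia.
  replace (k + S a)%nat with (S (k + a)) by lia. rewrite !fact_simpl, !mult_INR, !S_INR, plus_INR.
  assert (A := INR_fact_neq_0 a). assert (B := INR_fact_neq_0 k). assert (Q := pos_INR a).
  field. repeat split; try easy; lra.
Qed.

Lemma bin_nonneg (a k : nat) : 0 <= bin a k.
Proof.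
  induction a as [|a IH]; [rewrite bin_0_l; lra|].
  rewrite bin_succ. assert (Q := pos_INR a). assert (Q' := pos_INR k).
  apply Rdiv_le_0_compat; [apply Rmult_le_pos|]; lra.
Qed.

(* Coefficients of [(1 - z / q)^-(a + 1)]. *)
Definition gen (q : C) (a k : nat) : C := (RtoC (bin a k) * Cpow (/ q) k)%C.

Definition delta0 (k : nat) : C := match k with O => RtoC 1 | _ => RtoC 0 end.

Lemma mul_root_gen_0 (q : C) (k : nat) : q <> 0 -> mul_root q (gen q 0) k = delta0 k.
Proof.
  intros Hq. unfold mul_root, gen, delta0. destruct k as [|k]; rewrite !bin_0_l; simpl; ring.
Qed.

Lemma mul_root_gen_S (q : C) (a k : nat) : mul_root q (gen q (S a)) k = gen q a k.
Proof.
  unfold mul_root, gen. destruct k as [|k]; [rewrite !bin_k_0; simpl; ring|].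
  rewrite bin_pascal, RtoC_plus. simpl. ring.
Qed.

(** The identity [1 - z / p = (1 - q / p) + (q / p) * (1 - z / q)] divided by [1 - z / q] and read
    on coefficients; [mul_root_gen_ne_S] is the same for higher powers. *)
Lemma mul_root_gen_ne_0 (p q : C) (k : nat) : q <> 0 ->
  mul_root p (gen q 0) k = ((1 - q * / p) * gen q 0 k + q * / p * delta0 k)%C.
Proof.
  intros Hq. unfold mul_root, gen, delta0. destruct k as [|k]; rewrite !bin_0_l; simpl; [ring|].
  replace (Cpow (/ q) k) with (q * (/ q * Cpow (/ q) k))%C at 2; [ring|].
  rewrite Cmult_assoc, Cinv_r by easy. ring.
Qed.

Lemma mul_root_gen_ne_S (p q : C) (a k : nat) : q <> 0 ->
  mul_root p (gen q (S a)) k = ((1 - q * / p) * gen q (S a) k + q * / p * gen q a k)%C.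
Proof.
  intros Hq. unfold mul_root, gen. destruct k as [|k]; [rewrite !bin_k_0; simpl; ring|].
  rewrite bin_pascal, RtoC_plus. simpl.
  replace (/ p * (RtoC (bin (S a) k) * Cpow (/ q) k))%C
    with (q * / p * (RtoC (bin (S a) k) * (/ q * Cpow (/ q) k)))%C; [ring|].
  replace (q * / p * (RtoC (bin (S a) k) * (/ q * Cpow (/ q) k)))%C
    with (q * / q * (/ p * (RtoC (bin (S a) k) * Cpow (/ q) k)))%C by ring.
  rewrite Cinv_r by easy. ring.
Qed.

Lemma cser_gen (q w : C) (a : nat) : Cmod w < Cmod q ->
  cser (fun k => gen q a k * Cpow w k)%C (/ Cpow (1 - w * / q) (S a))%C.
Proof.
  intros H. assert (P := Cmod_ge_0 w).
  assert (Hq : q <> 0) by (apply Cmod_pos_neq_0; lra).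
  assert (Hc : (1 - w * / q)%C <> 0).
  { intros E. assert (E' : w = q).
    { replace w with (q * (1 - (1 - w * / q)))%C by (field; easy). rewrite E. ring. }
    rewrite E' in H. lra. }
  induction a as [|a IH].
  - rewrite Cpow_1_r. replace (/ (1 - w * / q))%C with (1 * / (1 - w * / q))%C by ring.
    apply cser_div_root; [easy|].
    intros eps He. exists 1%nat. intros n Hn.
    replace (Csum_lt _ n) with (RtoC 1); [now rewrite Cmod_self_minus|].
    destruct n as [|n]; [lia|]. clear Hn. induction n as [|n IH].
    + simpl. rewrite mul_root_gen_0 by easy. simpl. ring.
    + rewrite IH at 1. cbn [Csum_lt]. rewrite mul_root_gen_0 with (k := S n) by easy. simpl. ring.
  - replace (/ Cpow (1 - w * / q) (S (S a)))%C
      with (/ Cpow (1 - w * / q) (S a) * / (1 - w * / q))%C.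
    + apply cser_div_root; [easy|]. revert IH. apply cser_ext. intros k. now rewrite mul_root_gen_S.
    + rewrite (Cpow_S _ (S a)). set (X := (1 - w * / q)%C) in *. clearbody X.
      assert (HX : Cpow X (S a) <> 0) by now apply Cpow_nz.
      clear IH. generalize dependent (Cpow X (S a)). intros Y HY. field. now split.
Qed.

(* Coefficient sequences of functions with poles in [qs] only, up to [O(rho^-k)]. *)
Inductive expo (qs : list C) (rho : R) : (nat -> C) -> Prop :=
| expo_err v M : (forall k, Cmod (v k) <= M * / rho ^ k) -> expo qs rho v
| expo_gen q a : In q qs -> expo qs rho (gen q a)
| expo_plus u v : expo qs rho u -> expo qs rho v -> expo qs rho (fun k => u k + v k)%C
| expo_scal c v : expo qs rho v -> expo qs rho (fun k => c * v k)%C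
| expo_ext u v : (forall k, u k = v k) -> expo qs rho u -> expo qs rho v.

Section Peel.
Variables (qs : list C) (sigma rho : R).
Hypothesis Hsig : 0 < sigma < rho.
Hypothesis Hqs : forall q, In q qs -> Cmod q = sigma.

(** The solution is [p^-k] times the partial sum of [p^j * e j] up to [j = k]. As [sigma < rho],
    this sum converges geometrically to some [S]: the part [S * p^-k] is a generator at [p], and the
    tail is again an error of order [rho^-k]. *)
Lemma mul_root_solve_err (p : C) (e : nat -> C) (M : R) : In p qs ->
  (forall k, Cmod (e k) <= M * / rho ^ k) ->
  exists v, expo qs rho v /\ forall k, mul_root p v k = e k.
Proof.
  intros Hp He. assert (Ep := Hqs p Hp).
  assert (Hp0 : p <> 0) by (apply Cmod_pos_neq_0; lra).
  set (h := fun k => (Cpow p k * e k)%C).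
  set (th := sigma / rho).
  assert (Hth : 0 <= th < 1).
  { unfold th. split; [apply Rdiv_le_0_compat; lra | apply Rlt_div_l; lra]. }
  assert (HM : 0 <= M).
  { specialize (He O). simpl in He. assert (A := Cmod_ge_0 (e O)). lra. }
  assert (Hh : forall k, Cmod (h k) <= M * th ^ k).
  { intros k. unfold h, th, Rdiv. rewrite Cmod_mult, Cmod_pow, Ep, Rpow_mult_distr, pow_inv.
    replace (M * (sigma ^ k * / rho ^ k)) with (sigma ^ k * (M * / rho ^ k)) by ring.
    apply Rmult_le_compat_l; [apply pow_le; lra | apply He]. }
  destruct (geom_cser h M th Hth Hh) as [S HS].
  exists (fun k => Cpow (/ p) k * Csum_lt h (Datatypes.S k))%C. split.
  - apply expo_ext with (u := fun k => (S * gen p 0 k + (- Cpow (/ p) k * (S - Csum_lt h (Datatypes.S k))))%C).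
    { intros k. unfold gen. rewrite bin_0_l. ring. }
    apply expo_plus; [apply expo_scal, expo_gen, Hp|].
    apply expo_err with (M := M * / (1 - th)). intros k.
    rewrite Cmod_mult, Cmod_opp, Cmod_pow, Cmod_inv, Ep by easy.
    assert (A := cser_tail h S M th (Datatypes.S k) Hth HM HS (fun k _ => Hh k)).
    assert (Hi : 0 < / (1 - th)) by (apply Rinv_0_lt_compat; lra).
    assert (Hsk : 0 < (/ sigma) ^ k) by (apply pow_lt, Rinv_0_lt_compat; lra).
    apply Rle_trans with ((/ sigma) ^ k * (M * th ^ k * / (1 - th))).
    + apply Rmult_le_compat_l; [lra|]. eapply Rle_trans; [exact A|].
      apply Rmult_le_compat_r; [lra|]. apply Rmult_le_compat_l; [easy|].
      simpl. assert (0 <= th ^ k) by (apply pow_le; lra). nra.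
    + apply Req_le. unfold th at 1, Rdiv. rewrite Rpow_mult_distr, !pow_inv. field.
      repeat split; [apply pow_nonzero; lra | lra | apply pow_nonzero; lra].
  - intros k. unfold mul_root. destruct k as [|k].
    + simpl. unfold h. simpl. ring.
    + cbn [Csum_lt]. set (W := (Csum_lt h k + h k)%C). unfold h. rewrite Cpow_S.
      replace (/ p * Cpow (/ p) k * (W + Cpow p (Datatypes.S k) * e (Datatypes.S k)) - / p * (Cpow (/ p) k * W))%C
        with ((/ p * Cpow (/ p) k) * Cpow p (Datatypes.S k) * e (Datatypes.S k))%C by ring.
      rewrite <- Cpow_S, <- Cpow_mult_l, Cinv_l by easy. rewrite Cpow_1_l. ring.
Qed.

(** At [q = p] the order goes up by one. For [q] different from [p], the relation for
    [mul_root p (gen q a)] is solved for [gen q a] by induction on [a]; in the base case the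
    leftover [delta0] counts as an error sequence. *)
Lemma mul_root_solve_gen (p q : C) (a : nat) : In p qs -> In q qs ->
  exists v, expo qs rho v /\ forall k, mul_root p v k = gen q a k.
Proof.
  intros Hp Hq.
  assert (Hp0 : p <> 0) by (assert (A := Hqs p Hp); apply Cmod_pos_neq_0; lra).
  assert (Hq0 : q <> 0) by (assert (A := Hqs q Hq); apply Cmod_pos_neq_0; lra).
  destruct (Ceq_dec q p) as [->|Hn].
  { exists (gen p (S a)). split; [now apply expo_gen | intros; apply mul_root_gen_S]. }
  set (c := (1 - q * / p)%C).
  assert (Hc : c <> 0).
  { unfold c. intros E. apply Hn.
    replace q with (p * (1 - (1 - q * / p)))%C by (field; easy). rewrite E. ring. }
  assert (Step : forall u v w, expo qs rho u -> expo qs rho v ->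
    (forall k, mul_root p u k = c * w k + q * / p * mul_root p v k)%C ->
    exists v', expo qs rho v' /\ forall k, mul_root p v' k = w k).
  { intros u v w Hu Hv E. exists (fun k => / c * (u k + - (q * / p) * v k))%C. split.
    - apply expo_scal, expo_plus; [easy|]. now apply expo_scal.
    - intros k. replace (w k) with (/ c * (mul_root p u k - q * / p * mul_root p v k))%C
        by (rewrite E; field; split; easy).
      unfold mul_root. destruct k; ring. }
  induction a as [|a [v [Hv Ev]]].
  - destruct (mul_root_solve_err p delta0 1 Hp) as [v [Hv Ev]].
    { intros [|k]; simpl; [rewrite Cmod_1; lra|]. rewrite Cmod_0.
      rewrite Rmult_1_l. apply Rlt_le, Rinv_0_lt_compat. apply (pow_lt rho (S k)). lra. }
    apply Step with (u := gen q 0) (v := v); [now apply expo_gen | easy |].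
    intros k. rewrite Ev. now apply mul_root_gen_ne_0.
  - apply Step with (u := gen q (S a)) (v := v); [now apply expo_gen | easy |].
    intros k. rewrite Ev. now apply mul_root_gen_ne_S.
Qed.

Lemma mul_root_solve (p : C) (u : nat -> C) : In p qs -> expo qs rho u ->
  exists v, expo qs rho v /\ forall k, mul_root p v k = u k.
Proof.
  intros Hp Hu. induction Hu as [e M He|q a Hq|u1 u2 _ [v1 [H1 E1]] _ [v2 [H2 E2]]|c u _ [v [H E]]|u u' Euu _ [v [H E]]].
  - now apply mul_root_solve_err with M.
  - now apply mul_root_solve_gen.
  - exists (fun k => v1 k + v2 k)%C. split; [now apply expo_plus|].
    intros k. rewrite <- E1, <- E2. unfold mul_root. destruct k; ring.
  - exists (fun k => c * v k)%C. split; [now apply expo_scal|].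
    intros k. rewrite <- E. unfold mul_root. destruct k; ring.
  - exists v. split; [easy|]. intros k. now rewrite E.
Qed.

(** Two sequences with the same image under [mul_root p], apart from index 0, differ by a multiple
    of [p^-k], which is [gen p 0]. *)
Lemma expo_div_root (p : C) (v : nat -> C) : In p qs ->
  expo qs rho (mul_root p v) -> expo qs rho v.
Proof.
  intros Hp H. destruct (mul_root_solve p _ Hp H) as [u [Hu Eu]].
  apply expo_ext with (u := fun k => (u k + (v O - u O) * gen p 0 k)%C).
  - intros k. unfold gen. rewrite bin_0_l. induction k as [|k IH]; simpl; [ring|].
    specialize (Eu (S k)). unfold mul_root in Eu.
    assert (Ev : (v (S k) - / p * v k)%C = (u (S k) - / p * u k)%C) by (symmetry; exact Eu).
    replace (v (S k)) with ((v (S k) - / p * v k) + / p * v k)%C by ring.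
    rewrite Ev, <- IH. ring.
  - apply expo_plus; [easy|]. apply expo_scal. now apply expo_gen.
Qed.

End Peel.

Definition mul_roots (ps : list C) (v : nat -> C) : nat -> C := fold_right mul_root v ps.

Lemma cser_mul_roots (ps : list C) (v : nat -> C) (w l : C) :
  cser (fun k => v k * Cpow w k)%C l ->
  cser (fun k => mul_roots ps v k * Cpow w k)%C (root_prod ps w * l)%C.
Proof.
  intros H. induction ps as [|p ps IH]; simpl.
  - now replace (1 * l)%C with l by ring.
  - rewrite <- Cmult_assoc. now apply cser_mul_root.
Qed.

Lemma expo_div_roots (qs ps : list C) (sigma rho : R) (v : nat -> C) : 0 < sigma < rho ->
  (forall q, In q qs -> Cmod q = sigma) -> incl ps qs ->
  expo qs rho (mul_roots ps v) -> expo qs rho v.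
Proof.
  intros Hs Hqs. induction ps as [|p ps IH]; intros Hi H; [easy|].
  apply IH; [intros q Hq; apply Hi; now right|].
  apply (expo_div_root qs sigma rho Hs Hqs p); [apply Hi; now left | exact H].
Qed.

(** * Normal form of an exponential-polynomial sequence *)

Definition lsum (qs : list C) (h : C -> C) : C := fold_right (fun q a => h q + a)%C (RtoC 0) qs.

Lemma lsum_ext (qs : list C) (h h' : C -> C) :
  (forall q, In q qs -> h q = h' q) -> lsum qs h = lsum qs h'.
Proof.
  intros H. induction qs as [|q qs IH]; simpl; [easy|].
  rewrite IH, H; [easy | now left | intros; apply H; now right].
Qed.

Lemma lsum_plus (qs : list C) (h h' : C -> C) :
  lsum qs (fun q => h q + h' q)%C = (lsum qs h + lsum qs h')%C.
Proof. induction qs as [|q qs IH]; simpl; [ring|]. rewrite IH. ring. Qed.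

Lemma lsum_Cmult (c : C) (qs : list C) (h : C -> C) :
  lsum qs (fun q => c * h q)%C = (c * lsum qs h)%C.
Proof. induction qs as [|q qs IH]; simpl; [ring|]. rewrite IH. ring. Qed.

Lemma lsum_0 (qs : list C) (h : C -> C) : (forall q, In q qs -> h q = 0) -> lsum qs h = 0.
Proof.
  intros H. induction qs as [|q qs IH]; simpl; [easy|].
  rewrite IH, H; [ring | now left | intros; apply H; now right].
Qed.

Lemma lsum_single (qs : list C) (q0 : C) (h : C -> C) : NoDup qs -> In q0 qs ->
  (forall q, In q qs -> q <> q0 -> h q = 0) -> lsum qs h = h q0.
Proof.
  intros Hnd. induction Hnd as [|q qs Hq Hnd IH]; intros Hin H; [easy|]. simpl.
  destruct (Ceq_dec q q0) as [->|Hn].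
  - rewrite lsum_0; [ring|]. intros q Hq'. apply H; [now right|]. now intros ->.
  - rewrite (H q) by (try easy; now left).
    destruct Hin as [E|Hin]; [easy|]. rewrite IH; [ring | easy |]. intros; apply H; [now right|easy].
Qed.

Definition nform (qs : list C) (beta : C -> nat -> C) (D k : nat) : C :=
  lsum qs (fun q => Csum_lt (fun a => beta q a * gen q a k)%C D).

Lemma Csum_zero_tail (h : nat -> C) (D D' : nat) : (D <= D')%nat ->
  (forall a, (D <= a)%nat -> h a = 0) -> Csum_lt h D' = Csum_lt h D.
Proof.
  intros Hl H. induction Hl as [|D' Hl IH]; [easy|]. simpl. rewrite IH, H by lia. ring.
Qed.

Lemma nform_extend (qs : list C) (beta : C -> nat -> C) (D D' k : nat) : (D <= D')%nat ->
  (forall q a, In q qs -> (D <= a)%nat -> beta q a = 0) -> nform qs beta D' k = nform qs beta D k.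
Proof.
  intros Hl H. apply lsum_ext. intros q Hq. apply Csum_zero_tail; [easy|].
  intros a Ha. rewrite H by easy. ring.
Qed.

(** Coefficients are set to 0 from [D] on, so that normal forms of different lengths can be padded
    and added. Distinctness of the points lets one generator be represented by a single nonzero
    coefficient. *)
Lemma expo_nform (qs : list C) (rho : R) (v : nat -> C) : 0 < rho -> NoDup qs -> expo qs rho v ->
  exists (beta : C -> nat -> C) (D : nat) (M : R),
    (forall q a, In q qs -> (D <= a)%nat -> beta q a = 0) /\
    forall k, Cmod (v k - nform qs beta D k) <= M * / rho ^ k.
Proof.
  intros Hr Hnd H.
  induction H as [e M He|q a Hq|u1 u2 _ [b1 [D1 [M1 [Z1 E1]]]] _ [b2 [D2 [M2 [Z2 E2]]]]
                 |c u _ [b [D [M [Z E]]]]|u u' Euu _ [b [D [M [Z E]]]]].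
  - exists (fun _ _ => RtoC 0), O, M. split; [easy|]. intros k. unfold nform.
    rewrite lsum_0 by easy. replace (e k - 0)%C with (e k) by ring. apply He.
  - exists (fun q' a' => if Ceq_dec q' q then if Nat.eq_dec a' a then RtoC 1 else RtoC 0 else RtoC 0), (S a), 0.
    split.
    + intros q' a' _ Ha. destruct (Ceq_dec q' q); [|easy]. destruct (Nat.eq_dec a' a); [lia|easy].
    + intros k. unfold nform. rewrite (lsum_single qs q _ Hnd Hq).
      2:{ intros q' _ Hn. destruct (Ceq_dec q' q); [easy|].
          rewrite (Csum_zero_tail _ 0); [easy | lia |]. intros; ring. }
      destruct (Ceq_dec q q); [|easy]. simpl. destruct (Nat.eq_dec a a); [|easy].
      rewrite (Csum_ext _ (fun _ => 0 * 0)%C).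
      * rewrite Csum_Cmult. match goal with |- Cmod ?X <= _ => replace X with (RtoC 0) by ring end.
        rewrite Cmod_0. lra.
      * intros a' Ha'. destruct (Nat.eq_dec a' a); [lia|]. ring.
  - exists (fun q a => b1 q a + b2 q a)%C, (D1 + D2)%nat, (M1 + M2). split.
    + intros q a Hq Ha. rewrite Z1, Z2 by (try easy; lia). ring.
    + intros k. unfold nform.
      rewrite (lsum_ext _ _ (fun q => Csum_lt (fun a => b1 q a * gen q a k)%C (D1 + D2)
                                + Csum_lt (fun a => b2 q a * gen q a k)%C (D1 + D2))%C).
      * rewrite lsum_plus. fold (nform qs b1 (D1 + D2) k). fold (nform qs b2 (D1 + D2) k).
        rewrite (nform_extend qs b1 D1) by (try easy; lia).
        rewrite (nform_extend qs b2 D2) by (try easy; lia).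
        match goal with |- Cmod ?X <= _ =>
          replace X with ((u1 k - nform qs b1 D1 k) + (u2 k - nform qs b2 D2 k))%C by ring end.
        eapply Rle_trans; [apply Cmod_triangle|]. specialize (E1 k). specialize (E2 k). lra.
      * intros q _. rewrite <- Csum_plus. apply Csum_ext. intros; ring.
  - exists (fun q a => c * b q a)%C, D, (Cmod c * M). split.
    + intros q a Hq Ha. rewrite Z by easy. ring.
    + intros k. unfold nform.
      rewrite (lsum_ext _ _ (fun q => c * Csum_lt (fun a => b q a * gen q a k)%C D)%C).
      * rewrite lsum_Cmult. fold (nform qs b D k).
        replace (c * u k - c * nform qs b D k)%C with (c * (u k - nform qs b D k))%C by ring.
        rewrite Cmod_mult, Rmult_assoc. apply Rmult_le_compat_l; [apply Cmod_ge_0 | apply E].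
      * intros q _. rewrite <- Csum_Cmult. apply Csum_ext. intros; ring.
  - exists b, D, M. split; [easy|]. intros k. rewrite <- Euu. apply E.
Qed.

(** * Radial limits and poles *)

Definition rlim (h : R -> C) (l : C) : Prop :=
  forall eps, 0 < eps -> exists d, 0 < d /\ forall t, 1 - d < t < 1 -> Cmod (h t - l) < eps.

Lemma rlim_ext_loc (h h' : R -> C) (l : C) (d : R) : 0 < d ->
  (forall t, 1 - d < t < 1 -> h t = h' t) -> rlim h l -> rlim h' l.
Proof.
  intros Hd E H eps He. destruct (H eps He) as [e [He' H']].
  exists (Rmin d e). split; [now apply Rmin_pos|]. intros t Ht.
  assert (T1 := Rmin_l d e). assert (T2 := Rmin_r d e).
  rewrite <- E by lra. apply H'. lra.
Qed.

Lemma rlim_unique (h : R -> C) (l l' : C) : rlim h l -> rlim h l' -> l = l'.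
Proof.
  intros H H'. apply Cmod_minus_small_eq. intros eps He.
  destruct (H (eps / 2)) as [d [Hd A]]; [lra|]. destruct (H' (eps / 2)) as [d' [Hd' A']]; [lra|].
  assert (T1 := Rmin_l d d'). assert (T2 := Rmin_r d d').
  assert (T : 0 < Rmin d d') by now apply Rmin_pos.
  specialize (A (1 - Rmin d d' / 2) ltac:(lra)). specialize (A' (1 - Rmin d d' / 2) ltac:(lra)).
  set (v := h _) in *. replace (l - l')%C with ((v - l') - (v - l))%C by ring.
  eapply Rle_trans; [apply Cmod_triangle_minus|]. lra.
Qed.

Lemma rlim_const (c : C) : rlim (fun _ => c) c.
Proof. intros eps He. exists 1. split; [lra|]. intros t _. now rewrite Cmod_self_minus. Qed.

Lemma rlim_plus (h k : R -> C) (l m : C) : rlim h l -> rlim k m -> rlim (fun t => h t + k t)%C (l + m)%C.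
Proof.
  intros H H' eps He. destruct (H (eps / 2)) as [d [Hd A]]; [lra|].
  destruct (H' (eps / 2)) as [d' [Hd' A']]; [lra|].
  assert (T1 := Rmin_l d d'). assert (T2 := Rmin_r d d').
  exists (Rmin d d'). split; [now apply Rmin_pos|]. intros t Ht.
  specialize (A t ltac:(lra)). specialize (A' t ltac:(lra)).
  replace (h t + k t - (l + m))%C with ((h t - l) + (k t - m))%C by ring.
  eapply Rle_lt_trans; [apply Cmod_triangle|]. lra.
Qed.

Lemma rlim_0_mult (h k : R -> C) (K d : R) : 0 < d -> rlim h 0 ->
  (forall t, 1 - d < t < 1 -> Cmod (k t) <= K) -> rlim (fun t => h t * k t)%C 0.
Proof.
  intros Hd H HK eps He.
  assert (HK0 : 0 <= K).
  { eapply Rle_trans; [apply Cmod_ge_0 | apply (HK (1 - d / 2)); lra]. }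
  destruct (H (eps / (K + 1))) as [d' [Hd' A]]; [apply Rdiv_lt_0_compat; lra|].
  assert (T1 := Rmin_l d d'). assert (T2 := Rmin_r d d').
  exists (Rmin d d'). split; [now apply Rmin_pos|]. intros t Ht.
  specialize (A t ltac:(lra)). specialize (HK t ltac:(lra)).
  replace (h t - 0)%C with (h t) in A by ring. replace (h t * k t - 0)%C with (h t * k t)%C by ring.
  rewrite Cmod_mult. apply Rlt_div_r in A; [|lra].
  assert (P := Cmod_ge_0 (h t)). assert (P' := Cmod_ge_0 (k t)). nra.
Qed.

Lemma rlim_bounded (h : R -> C) (l : C) : rlim h l ->
  exists d, 0 < d /\ forall t, 1 - d < t < 1 -> Cmod (h t) <= Cmod l + 1.
Proof.
  intros H. destruct (H 1) as [d [Hd A]]; [lra|]. exists d. split; [easy|]. intros t Ht.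
  specialize (A t Ht). assert (T := Cmod_triangle_inv (h t) l). lra.
Qed.

Lemma rlim_ccont (G : C -> C) : ccont G 1 -> rlim (fun t => G (RtoC t)) (G 1).
Proof.
  intros H eps He. destruct (H eps He) as [d [Hd A]]. exists d. split; [easy|].
  intros t Ht. apply A. rewrite <- RtoC_minus, Cmod_R. apply Rabs_def1; lra.
Qed.

Lemma rlim_lsum (qs : list C) (h : C -> R -> C) (l : C -> C) :
  (forall q, In q qs -> rlim (h q) (l q)) -> rlim (fun t => lsum qs (fun q => h q t)) (lsum qs l).
Proof.
  intros H. induction qs as [|q qs IH]; simpl; [apply rlim_const|].
  apply rlim_plus; [apply H; now left | apply IH; intros; apply H; now right].
Qed.

Lemma rlim_Csum (h : nat -> R -> C) (l : nat -> C) (D : nat) :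
  (forall a, (a < D)%nat -> rlim (h a) (l a)) -> rlim (fun t => Csum_lt (fun a => h a t) D) (Csum_lt l D).
Proof.
  intros H. induction D as [|D IH]; simpl; [apply rlim_const|].
  apply rlim_plus; [apply IH; intros; apply H; lia | apply H; lia].
Qed.

Lemma cser_lsum (qs : list C) (h : C -> nat -> C) (l : C -> C) :
  (forall q, In q qs -> cser (h q) (l q)) -> cser (fun k => lsum qs (fun q => h q k)) (lsum qs l).
Proof.
  intros H. induction qs as [|q qs IH]; simpl.
  - intros eps He. exists O. intros n _. replace (Csum_lt _ n) with (RtoC 0); [now rewrite Cmod_self_minus|].
    induction n as [|n IHn]; simpl; [easy|]. rewrite <- IHn. ring.
  - apply cser_plus; [apply H; now left | apply IH; intros; apply H; now right].
Qed.

Lemma cser_Csum (h : nat -> nat -> C) (l : nat -> C) (D : nat) :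
  (forall a, cser (h a) (l a)) -> cser (fun k => Csum_lt (fun a => h a k) D) (Csum_lt l D).
Proof.
  intros H. induction D as [|D IH]; simpl.
  - intros eps He. exists O. intros n _. replace (Csum_lt _ n) with (RtoC 0); [now rewrite Cmod_self_minus|].
    induction n as [|n IHn]; simpl; [easy|]. rewrite <- IHn. ring.
  - apply cser_plus; [easy | apply H].
Qed.

(** This is [(1 - z / q)^m * f z] on the radius [z = t * q]. *)
Definition rad (f : C -> C) (m : nat) (q : C) (t : R) : C :=
  (Cpow (1 - RtoC t) m * f (RtoC t * q))%C.

Lemma RtoC_1_minus_neq_0 (t : R) : t < 1 -> (1 - RtoC t)%C <> 0.
Proof. intros H E. rewrite <- RtoC_minus in E. apply RtoC_inj in E. lra. Qed.

Lemma cdiff_1_minus_pow (n : nat) (z : C) : cdiff (fun w => Cpow (1 - w) n)%C z.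
Proof.
  apply (cdiff_pow (fun w => 1 - w)%C).
  apply cdiff_ext_loc with (f := fun w => (1 + (- (1)) * w)%C) (r := 1); [lra | intros; ring |].
  apply cdiff_plus; [apply cdiff_const|]. apply cdiff_mult; [apply cdiff_const | apply cdiff_id].
Qed.

Lemma rlim_1_minus_pow_S (n : nat) : rlim (fun t => Cpow (1 - RtoC t) (S n))%C 0.
Proof.
  assert (H := rlim_ccont (fun w => Cpow (1 - w) (S n))%C).
  replace (RtoC 0) with (Cpow (1 - 1) (S n))%C by (simpl; ring).
  apply H. apply cdiff_ccont, cdiff_1_minus_pow.
Qed.

Lemma rad_shift (f : C -> C) (q l : C) (n m : nat) : (n < m)%nat ->
  rlim (rad f n q) l -> rlim (rad f m q) 0.
Proof.
  intros Hn H. destruct (rlim_bounded _ _ H) as [d [Hd B]].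
  apply rlim_ext_loc with (h := fun t => (Cpow (1 - RtoC t) (S (m - n - 1)) * rad f n q t)%C) (d := 1); [lra| |].
  - intros t _. unfold rad. rewrite Cmult_assoc, <- Cpow_add_r.
    replace (S (m - n - 1) + n)%nat with m by lia. easy.
  - apply rlim_0_mult with (2 := rlim_1_minus_pow_S _) (3 := B). easy.
Qed.

(** The error has a series bounded up to the circle, so [(1 - t)^D] kills it. The terms at points
    other than [q0] stay regular at [q0], and among those at [q0] only the index [D - 1] survives.
    [D] is merely an upper bound for the order, so the limit may be 0. *)
Lemma radial_limit (qs : list C) (sigma rho : R) (beta : C -> nat -> C) (D : nat) (M : R)
  (v : nat -> C) (f : C -> C) (q0 : C) :
  0 < sigma < rho -> NoDup qs -> (forall q, In q qs -> Cmod q = sigma) ->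
  (forall k, Cmod (v k - nform qs beta D k) <= M * / rho ^ k) ->
  (forall z, Cmod z < sigma -> cser (fun k => v k * Cpow z k)%C (f z)) ->
  Cmod q0 = sigma -> (1 <= D)%nat ->
  rlim (rad f D q0) (if in_dec Ceq_dec q0 qs then beta q0 (D - 1)%nat else 0).
Proof.
  intros Hs Hnd Hqs Hv Hf Hq0 HD.
  assert (HM : 0 <= M).
  { specialize (Hv O). simpl in Hv. match type of Hv with Cmod ?X <= _ => assert (A := Cmod_ge_0 X) end. lra. }
  set (T := fun (q : C) (a : nat) (z : C) => (beta q a * / Cpow (1 - z * / q) (S a))%C).
  set (nz := fun z => lsum qs (fun q => Csum_lt (fun a => T q a z) D)).
  assert (Hnz : forall z, Cmod z < sigma -> cser (fun k => nform qs beta D k * Cpow z k)%C (nz z)).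
  { intros z Hz.
    apply cser_ext with (a := fun k => lsum qs (fun q => Csum_lt (fun a => beta q a * (gen q a k * Cpow z k))%C D)).
    - intros k. unfold nform. rewrite Cmult_comm, <- lsum_Cmult. apply lsum_ext. intros q _.
      rewrite <- Csum_Cmult. apply Csum_ext. intros; ring.
    - apply (cser_lsum qs (fun q k => Csum_lt (fun a => beta q a * (gen q a k * Cpow z k))%C D)).
      intros q Hq. apply (cser_Csum (fun a k => beta q a * (gen q a k * Cpow z k))%C).
      intros a. apply cser_Cmult. apply cser_gen. now rewrite (Hqs q Hq). }
  set (th := sigma / rho).
  assert (Hth : 0 <= th < 1).
  { unfold th. split; [apply Rdiv_le_0_compat; lra | apply Rlt_div_l; lra]. }
  assert (HE : forall z, Cmod z < sigma -> Cmod (f z - nz z) <= M * / (1 - th)).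
  { intros z Hz.
    assert (S : cser (fun k => (v k - nform qs beta D k) * Cpow z k)%C (f z - nz z)%C).
    { apply cser_ext with (a := fun k => (v k * Cpow z k + (- (1)) * (nform qs beta D k * Cpow z k))%C).
      - intros; ring.
      - replace (f z - nz z)%C with (f z + (- (1)) * nz z)%C by ring.
        apply cser_plus; [now apply Hf|]. apply cser_Cmult. now apply Hnz. }
    assert (A := cser_tail _ _ M th 0 Hth HM S).
    simpl in A. replace (f z - nz z - 0)%C with (f z - nz z)%C in A by ring.
    rewrite Rmult_1_r in A. apply A. intros k _. rewrite Cmod_mult, Cmod_pow.
    unfold th, Rdiv. rewrite Rpow_mult_distr, pow_inv.
    replace (M * (sigma ^ k * / rho ^ k)) with (M * / rho ^ k * sigma ^ k) by ring.
    apply Rmult_le_compat; [apply Cmod_ge_0 | apply pow_le, Cmod_ge_0 | apply Hv |].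
    apply pow_incr. split; [apply Cmod_ge_0 | lra]. }
  assert (Hin : forall t, 0 < t < 1 -> Cmod (RtoC t * q0) < sigma).
  { intros t Ht. rewrite Cmod_mult, Hq0, Cmod_RtoC_nonneg by lra. nra. }
  assert (Hq0z : q0 <> 0) by (apply Cmod_pos_neq_0; lra).
  set (lim := fun q => if Ceq_dec q q0 then beta q (D - 1)%nat else RtoC 0).
  assert (Elim : (if in_dec Ceq_dec q0 qs then beta q0 (D - 1)%nat else RtoC 0) = (lsum qs lim + 0)%C).
  { destruct (in_dec Ceq_dec q0 qs) as [Hi|Hni].
    - rewrite (lsum_single qs q0 lim Hnd Hi).
      + unfold lim. destruct (Ceq_dec q0 q0); [ring|easy].
      + intros q _ Hn. unfold lim. now destruct (Ceq_dec q q0).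
    - rewrite lsum_0; [ring|]. intros q Hq. unfold lim. destruct (Ceq_dec q q0); [|easy]. now subst. }
  rewrite Elim.
  apply rlim_ext_loc with (d := 1) (h := fun t =>
    (lsum qs (fun q => Csum_lt (fun a => Cpow (1 - RtoC t) D * T q a (RtoC t * q0))%C D)
     + Cpow (1 - RtoC t) D * (f (RtoC t * q0) - nz (RtoC t * q0)))%C); [lra| |].
  - intros t Ht. unfold rad.
    rewrite (lsum_ext _ _ (fun q => Cpow (1 - RtoC t) D * Csum_lt (fun a => T q a (RtoC t * q0))%C D)%C)
      by (intros; apply Csum_Cmult).
    rewrite lsum_Cmult. fold (nz (RtoC t * q0)%C). ring.
  - apply rlim_plus.
    2:{ apply rlim_0_mult with (K := M * / (1 - th)) (d := 1); [lra| |].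
        - replace D with (S (D - 1)) by lia. apply rlim_1_minus_pow_S.
        - intros t Ht. apply HE, Hin. lra. }
    apply (rlim_lsum qs (fun q t => Csum_lt (fun a => Cpow (1 - RtoC t) D * T q a (RtoC t * q0))%C D)).
    intros q Hq.
    assert (Hqz : q <> 0) by (assert (A := Hqs q Hq); apply Cmod_pos_neq_0; lra).
    assert (El : lim q = Csum_lt (fun a => if Ceq_dec q q0 then
                   if Nat.eq_dec a (D - 1) then beta q a else RtoC 0 else RtoC 0) D).
    { unfold lim. destruct (Ceq_dec q q0).
      - replace D with (S (D - 1)) at 2 by lia. cbn [Csum_lt].
        destruct (Nat.eq_dec (D - 1) (D - 1)); [|easy].
        rewrite (Csum_ext _ (fun _ => 0 * 0)%C).
        + rewrite Csum_Cmult. ring.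
        + intros k Hk. destruct (Nat.eq_dec k (D - 1)); [lia|ring].
      - rewrite (Csum_zero_tail _ 0); [easy | lia | easy]. }
    rewrite El.
    apply (rlim_Csum (fun a t => Cpow (1 - RtoC t) D * T q a (RtoC t * q0))%C).
    intros a Ha. destruct (Ceq_dec q q0) as [->|Hn].
    + apply rlim_ext_loc with (h := fun t => (beta q0 a * Cpow (1 - RtoC t) (D - 1 - a))%C) (d := 1); [lra| |].
      * intros t Ht. unfold T.
        replace (RtoC t * q0 * / q0)%C with (RtoC t) by (field; easy).
        replace D with (S a + (D - 1 - a))%nat at 2 by lia. rewrite Cpow_add_r.
        assert (Hnz0 : Cpow (1 - RtoC t) (S a) <> 0) by (apply Cpow_nz, RtoC_1_minus_neq_0; lra).
        field_simplify; [ring | exact Hnz0].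
      * destruct (Nat.eq_dec a (D - 1)) as [->|Hna].
        -- rewrite Nat.sub_diag. apply rlim_ext_loc with (h := fun _ => beta q0 (D - 1)%nat) (d := 1); [lra| |].
           ++ intros t _. simpl. ring.
           ++ apply rlim_const.
        -- apply rlim_ext_loc with (h := fun t => (Cpow (1 - RtoC t) (S (D - 2 - a)) * beta q0 a)%C) (d := 1); [lra| |].
           ++ intros t _. replace (S (D - 2 - a)) with (D - 1 - a)%nat by lia. ring.
           ++ apply rlim_0_mult with (K := Cmod (beta q0 a)) (d := 1); [lra | apply rlim_1_minus_pow_S |].
              intros; lra.
    + assert (Hne : (1 - q0 * / q)%C <> 0).
      { intros E. apply Hn. symmetry.
        replace q0 with (q * (1 - (1 - q0 * / q)))%C by (field; easy). rewrite E. ring. }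
      set (G := fun w => (Cpow (1 - w) D * (beta q a * / Cpow (1 - w * q0 * / q) (S a)))%C).
      replace (RtoC 0) with (G 1).
      * apply (rlim_ccont G). apply cdiff_ccont. apply cdiff_mult; [apply cdiff_1_minus_pow|].
        apply cdiff_mult; [apply cdiff_const|].
        apply (cdiff_inv (fun w => Cpow (1 - w * q0 * / q) (S a))%C).
        -- apply (cdiff_pow (fun w => 1 - w * q0 * / q)%C).
           apply cdiff_ext_loc with (f := fun w => (1 + (- (q0 * / q)) * w)%C) (r := 1); [lra | intros; ring |].
           apply cdiff_plus; [apply cdiff_const|]. apply cdiff_mult; [apply cdiff_const | apply cdiff_id].
        -- apply Cpow_nz. now replace (1 - 1 * q0 * / q)%C with (1 - q0 * / q)%C by ring.
      * unfold G. replace D with (S (D - 1)) by lia. simpl. ring.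
Qed.

Lemma quotient_radial (f g : C -> C) (q : C) (n : nat) (r : R) : q <> 0 -> 0 < r ->
  (forall w, Cmod (w - q) < r -> cdiff g w) ->
  (forall z, Cmod (z - q) < r -> z <> q -> f z = (g z / Cpow (z - q) n)%C) ->
  rlim (rad f n q) (Cpow (- / q) n * g q)%C.
Proof.
  intros Hq Hr Hg Hf. assert (Hp : 0 < Cmod q) by now apply Cmod_gt_0.
  apply rlim_ext_loc with (h := fun t => (Cpow (- / q) n * g (RtoC t * q))%C) (d := Rmin 1 (r / Cmod q)).
  - apply Rmin_pos; [lra | now apply Rdiv_lt_0_compat].
  - intros t Ht. assert (T1 := Rmin_l 1 (r / Cmod q)). assert (T2 := Rmin_r 1 (r / Cmod q)).
    assert (E : (RtoC t * q - q)%C = (- q * (1 - RtoC t))%C) by ring.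
    assert (Hnz : (1 - RtoC t)%C <> 0) by (apply RtoC_1_minus_neq_0; lra).
    unfold rad. rewrite Hf.
    + rewrite E, Cpow_mult_l.
      replace (- / q)%C with (/ - q)%C by (field; easy). rewrite Cpow_inv.
      * field. split; apply Cpow_nz; [easy|].
        intros H0. apply Hq. replace q with (- - q)%C by ring. rewrite H0. ring.
      * intros H0. apply Hq. replace q with (- - q)%C by ring. rewrite H0. ring.
    + rewrite E, Cmod_mult, Cmod_opp, <- RtoC_minus, Cmod_RtoC_nonneg by lra.
      rewrite Rmult_comm. apply Rlt_div_r; lra.
    + intros E'. apply Hnz. rewrite E' in E.
      replace (1 - RtoC t)%C with (- / q * (- q * (1 - RtoC t)))%C by (field; easy).
      rewrite <- E. ring.
  - set (G := fun w => (Cpow (- / q) n * g (w * q))%C).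
    replace (Cpow (- / q) n * g q)%C with (G 1) by (unfold G; f_equal; f_equal; ring).
    apply (rlim_ccont G). apply cdiff_ccont. apply cdiff_mult; [apply cdiff_const|].
    apply (cdiff_comp g (fun w => w * q)%C).
    + apply cdiff_mult; [apply cdiff_id | apply cdiff_const].
    + apply Hg. replace (1 * q - q)%C with (RtoC 0) by ring. now rewrite Cmod_0.
Qed.

Lemma pole_radial (f : C -> C) (q : C) (m : nat) : q <> 0 -> is_pole_of_order f q m ->
  exists b : C, b <> 0 /\ rlim (rad f m q) b.
Proof.
  intros Hq [_ [r [g [Hr [Hg [Hgq Hf]]]]]].
  exists (Cpow (- / q) m * g q)%C. split.
  - apply Cmult_neq_0; [|easy]. apply Cpow_nz.
    intros E. apply (Cmult_neq_0 q (- / q)%C Hq); [intros E'|].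
    + apply C1_nz. replace (RtoC 1) with (- (q * - / q))%C by (field; easy). rewrite E'. ring.
    + rewrite E. ring.
  - apply quotient_radial with r; try easy. intros w Hw. now apply ex_derive_cdiff, Hg.
Qed.

(** The exponent [n] of a local representation is lowered to [m]: below [m] the limit [b] would be
    0, and above [m] the existence of the limit forces [g q = 0], so a factor cancels. This is how a
    point with nonzero top coefficient is seen to be a dominant pole. *)
Lemma radial_pole (f : C -> C) (q b : C) (m n : nat) (r : R) (g : C -> C) : q <> 0 -> (1 <= m)%nat ->
  b <> 0 -> rlim (rad f m q) b -> 0 < r ->
  (forall w, Cmod (w - q) < r -> cdiff g w) ->
  (forall z, Cmod (z - q) < r -> z <> q -> f z = (g z / Cpow (z - q) n)%C) ->
  is_pole_of_order f q m.
Proof.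
  intros Hq Hm Hb Hlim Hr. revert g.
  induction n as [|n IH]; intros g Hg Hf; assert (Hn := quotient_radial f g q _ r Hq Hr Hg Hf).
  - exfalso. apply Hb. apply (rlim_unique _ _ _ Hlim). apply rad_shift with (2 := Hn). lia.
  - destruct (lt_eq_lt_dec (S n) m) as [[Hlt|Heq]|Hgt].
    + exfalso. apply Hb. apply (rlim_unique _ _ _ Hlim). now apply rad_shift with (2 := Hn).
    + rewrite Heq in Hn, Hf. split; [easy|]. exists r, g. repeat split; try easy.
      * intros w Hw. now apply cdiff_ex_derive, Hg.
      * intros E. apply Hb. rewrite (rlim_unique _ _ _ Hlim Hn), E. ring.
    + assert (E : (Cpow (- / q) (S n) * g q)%C = 0).
      { apply (rlim_unique _ _ _ Hn). now apply rad_shift with (2 := Hlim). }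
      assert (Hg0 : g q = 0).
      { apply NNPP. intros Hne. apply (Cmult_neq_0 (Cpow (- / q) (S n)) (g q)); [|easy|easy].
        apply Cpow_nz. intros E'. apply C1_nz.
        replace (RtoC 1) with (- (q * - / q))%C by (field; easy). rewrite E'. ring. }
      destruct (removable_zero g q r Hr Hg Hg0) as [g1 [Hg1 Eg]].
      apply IH with g1; [easy|]. intros z Hz Hzq. rewrite Hf by easy. rewrite Eg.
      assert (Hn' : (z - q <> 0)%C) by now apply Cminus_eq_contra.
      rewrite Cpow_S. field. split; [now apply Cpow_nz | easy].
Qed.

(** * Recurrence and positivity *)

Definition unbounded (A : nat -> Prop) : Prop := forall K, exists n, (K <= n)%nat /\ A n.

(** Pigeonhole over [N] cells of width [eps]: either the top cell is visited by unboundedly many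
    indices of [A], or dropping an initial segment leaves [N - 1] cells. *)
Lemma unbounded_close_R (u : nat -> R) (eps : R) (N : nat) (A : nat -> Prop) : unbounded A ->
  (forall n, A n -> 0 <= u n < INR N * eps) ->
  exists A', unbounded A' /\ (forall n, A' n -> A n) /\
    forall n n', A' n -> A' n' -> Rabs (u n - u n') < eps.
Proof.
  revert A. induction N as [|N IH]; intros A HA Hu.
  - destruct (HA O) as [n [_ Hn]]. specialize (Hu n Hn). simpl in Hu. lra.
  - destruct (classic (unbounded (fun n => A n /\ INR N * eps <= u n))) as [Hi|Hni].
    + exists (fun n => A n /\ INR N * eps <= u n). split; [easy|]. split; [easy|].
      intros n n' [Hn Hn1] [Hn' Hn1']. assert (B := Hu n Hn). assert (B' := Hu n' Hn').
      rewrite S_INR in B, B'. apply Rabs_def1; lra.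
    + apply not_all_ex_not in Hni. destruct Hni as [K HK].
      destruct (IH (fun n => A n /\ (K <= n)%nat)) as [A' [H1 [H2 H3]]].
      * intros K'. destruct (HA (K + K')%nat) as [n [Hn Hn']]. exists n. split; [lia|]. split; [easy|lia].
      * intros n [Hn Hn']. assert (B := Hu n Hn). split; [easy|].
        destruct (Rlt_dec (u n) (INR N * eps)) as [|Hge]; [easy|].
        exfalso. apply HK. exists n. split; [easy|]. split; [easy|lra].
      * exists A'. split; [easy|]. split; [|easy]. intros n Hn. now apply H2.
Qed.

Lemma unbounded_close_unit (u : nat -> R) (eps : R) (A : nat -> Prop) : 0 < eps -> unbounded A ->
  (forall n, Rabs (u n) <= 1) ->
  exists A', unbounded A' /\ (forall n, A' n -> A n) /\
    forall n n', A' n -> A' n' -> Rabs (u n - u n') < eps.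
Proof.
  intros He HA Hu.
  destruct (archimed_cor1 (eps / 3)) as [N [HN HN0]]; [lra|].
  destruct (unbounded_close_R (fun n => u n + 1) eps N A HA) as [A' [H1 [H2 H3]]].
  - intros n _. specialize (Hu n). apply Rabs_le_between in Hu. split; [lra|].
    assert (P : 0 < INR N) by (apply lt_0_INR; lia).
    assert (Q : INR N * / INR N = 1) by (apply Rinv_r; lra).
    assert (INR N * / INR N < INR N * (eps / 3)) by now apply Rmult_lt_compat_l. lra.
  - exists A'. split; [easy|]. split; [easy|]. intros n n' Hn Hn'.
    replace (u n - u n') with (u n + 1 - (u n' + 1)) by ring. now apply H3.
Qed.

(** Simultaneous approximation in the manner of Dirichlet: take two distant indices at which all
    powers nearly agree. As the bases have modulus 1, dividing shows that their difference works. *)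
Lemma unit_powers_recur (lambda : nat -> C) (P : nat) (eps : R) (K : nat) : 0 < eps ->
  (forall j, (j < P)%nat -> Cmod (lambda j) = 1) ->
  exists n, (K <= n)%nat /\ forall j, (j < P)%nat -> Cmod (Cpow (lambda j) n - 1) < eps.
Proof.
  intros He Hl.
  assert (X : exists A, unbounded A /\ forall j n n', (j < P)%nat -> A n -> A n' ->
     Cmod (Cpow (lambda j) n - Cpow (lambda j) n') < eps).
  { induction P as [|P IH].
    - exists (fun _ => True). split; [intros K'; now exists K'|]. intros; lia.
    - destruct IH as [A [HA H]]; [intros; apply Hl; lia|].
      assert (Hu : forall n, Cmod (Cpow (lambda P) n) = 1).
      { intros n. rewrite Cmod_pow, Hl by lia. apply pow1. }
      destruct (unbounded_close_unit (fun n => fst (Cpow (lambda P) n)) (eps / 2) A) as [A1 [H1 [H2 H3]]];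
        [lra | easy | intros n; rewrite <- (Hu n); apply fst_le_Cmod |].
      destruct (unbounded_close_unit (fun n => snd (Cpow (lambda P) n)) (eps / 2) A1) as [A2 [H4 [H5 H6]]];
        [lra | easy | intros n; rewrite <- (Hu n); apply snd_le_Cmod |].
      exists A2. split; [easy|]. intros j n n' Hj Hn Hn'.
      destruct (Nat.eq_dec j P) as [->|Hne].
      + eapply Rle_lt_trans; [apply Cmod_le_add|].
        specialize (H3 n n' (H5 _ Hn) (H5 _ Hn')). specialize (H6 n n' Hn Hn').
        change (Rabs (fst (Cpow (lambda P) n) - fst (Cpow (lambda P) n'))
              + Rabs (snd (Cpow (lambda P) n) - snd (Cpow (lambda P) n')) < eps). lra.
      + apply H; [lia | apply H2, H5, Hn | apply H2, H5, Hn']. }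
  destruct X as [A [HA H]]. destruct (HA O) as [n0 [_ Hn0]].
  destruct (HA (n0 + K)%nat) as [n1 [Hn1 Hn1']].
  exists (n1 - n0)%nat. split; [lia|]. intros j Hj.
  specialize (H j n1 n0 Hj Hn1' Hn0).
  replace n1 with (n0 + (n1 - n0))%nat in H by lia. rewrite Cpow_add_r in H.
  replace (Cpow (lambda j) n0 * Cpow (lambda j) (n1 - n0) - Cpow (lambda j) n0)%C
    with (Cpow (lambda j) n0 * (Cpow (lambda j) (n1 - n0) - 1))%C in H by ring.
  rewrite Cmod_mult, Cmod_pow, Hl, pow1, Rmult_1_l in H by easy. exact H.
Qed.

Definition expsum (lambda c : nat -> C) (P k : nat) : C :=
  Csum_lt (fun j => Cpow (lambda j) k * c j)%C P.

Lemma expsum_bound (lambda c : nat -> C) (P k : nat) :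
  (forall j, (j < P)%nat -> Cmod (lambda j) = 1) ->
  Cmod (expsum lambda c P k) <= sum_f_R0 (fun j => Cmod (c j)) P.
Proof.
  intros Hl. eapply Rle_trans; [apply (Csum_bound _ (fun j => Cmod (c j)))|].
  - intros j Hj. rewrite Cmod_mult, Cmod_pow, Hl, pow1 by easy. lra.
  (* [sum_f_R0] runs to [P] inclusive; the surplus term is nonnegative. *)
  - assert (A := Cmod_ge_0 (c P)). lra.
Qed.

Lemma expsum_recur (lambda c : nat -> C) (P : nat) (eps : R) (K : nat) : 0 < eps ->
  (forall j, (j < P)%nat -> Cmod (lambda j) = 1) ->
  exists n, (K <= n)%nat /\ forall k,
    Cmod (expsum lambda c P (k + n) - expsum lambda c P k) <= eps.
Proof.
  intros He Hl. set (X := sum_f_R0 (fun j => Cmod (c j)) P).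
  assert (HX : 0 <= X).
  { apply Rle_trans with (Cmod (expsum lambda c P 0)); [apply Cmod_ge_0 | now apply expsum_bound]. }
  destruct (unit_powers_recur lambda P (eps / (X + 1)) K) as [n [Hn H]];
    [apply Rdiv_lt_0_compat; lra | easy |].
  exists n. split; [easy|]. intros k. unfold expsum.
  replace (Csum_lt (fun j => Cpow (lambda j) (k + n) * c j)%C P - Csum_lt (fun j => Cpow (lambda j) k * c j)%C P)%C
    with (Csum_lt (fun j => Cpow (lambda j) k * (Cpow (lambda j) n - 1) * c j)%C P).
  - eapply Rle_trans; [apply (Csum_bound _ (fun j => Cmod (c j) * (eps / (X + 1))))|].
    + intros j Hj. rewrite !Cmod_mult, Cmod_pow, Hl, pow1, Rmult_1_l by easy.
      rewrite Rmult_comm. apply Rmult_le_compat_l; [apply Cmod_ge_0 | now apply Rlt_le, H].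
    + rewrite <- scal_sum. fold X.
      assert (E : eps / (X + 1) * (X + 1) = eps) by (field; lra).
      assert (0 < eps / (X + 1)) by (apply Rdiv_lt_0_compat; lra).
      assert (A := Cmod_ge_0 (c P)). assert (0 <= Cmod (c P) * (eps / (X + 1))) by (apply Rmult_le_pos; lra).
      nra.
  - set (d := Csum_lt (fun j => Cpow (lambda j) k * c j)%C P).
    replace (Csum_lt (fun j => Cpow (lambda j) (k + n) * c j)%C P)
      with (Csum_lt (fun j => Cpow (lambda j) k * (Cpow (lambda j) n - 1) * c j + Cpow (lambda j) k * c j)%C P).
    + rewrite Csum_plus. fold d. ring.
    + apply Csum_ext. intros j _. rewrite Cpow_add_r. ring.
Qed.

Section Positivity.
(** In the application [lambda j] is [sigma / s j], [expsum] is [xi], and [t k] is [x k] divided by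
    its leading factor [bin n k / sigma ^ k]. *)
Variables (lambda c : nat -> C) (P : nat) (t : nat -> R).
Hypothesis Hl : forall j, (j < P)%nat -> Cmod (lambda j) = 1.
Hypothesis Ht : forall k, 0 <= t k.
Hypothesis Hlim : forall eps, 0 < eps -> exists K, forall k, (K <= k)%nat ->
  Cmod (RtoC (t k) - expsum lambda c P k) < eps.
Hypothesis Hne : exists k, expsum lambda c P k <> 0.

Lemma expsum_nonneg (k : nat) : Im (expsum lambda c P k) = 0 /\ 0 <= Re (expsum lambda c P k).
Proof.
  assert (B : forall eps, 0 < eps -> Rabs (Im (expsum lambda c P k)) <= eps /\ - eps <= Re (expsum lambda c P k)).
  { intros eps He. destruct (Hlim (eps / 2)) as [K HK]; [lra|].
    destruct (expsum_recur lambda c P (eps / 2) K) as [n [Hn H]]; [lra | easy |].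
    specialize (H k). specialize (HK (k + n)%nat ltac:(lia)). specialize (Ht (k + n)%nat).
    set (z := expsum lambda c P k) in *. set (w := expsum lambda c P (k + n)) in *.
    set (r := t (k + n)%nat) in *.
    assert (D : Cmod (RtoC r - z) < eps).
    { replace (RtoC r - z)%C with ((RtoC r - w) + (w - z))%C by ring.
      eapply Rle_lt_trans; [apply Cmod_triangle|]. lra. }
    assert (D1 := fst_le_Cmod (RtoC r - z)). assert (D2 := snd_le_Cmod (RtoC r - z)).
    change (Rabs (r - Re z) <= Cmod (RtoC r - z)) in D1.
    change (Rabs (0 - Im z) <= Cmod (RtoC r - z)) in D2.
    split.
    - rewrite <- Rabs_Ropp. replace (- Im z) with (0 - Im z) by ring. lra.
    - assert (D3 : Rabs (r - Re z) <= eps) by lra. apply Rabs_le_between in D3. lra. }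
  split.
  - destruct (Req_dec (Im (expsum lambda c P k)) 0) as [|Hn]; [easy|].
    apply Rabs_pos_lt in Hn.
    destruct (B (Rabs (Im (expsum lambda c P k)) / 2)) as [B1 _]; lra.
  - destruct (Rle_dec 0 (Re (expsum lambda c P k))) as [|Hn]; [easy|].
    destruct (B (- Re (expsum lambda c P k) / 2)) as [_ B1]; lra.
Qed.

Lemma expsum_Re_pos (k : nat) : expsum lambda c P k <> 0 -> 0 < Re (expsum lambda c P k).
Proof.
  intros H. destruct (expsum_nonneg k) as [H1 H2].
  destruct (Rle_lt_or_eq_dec _ _ H2) as [|E]; [easy|].
  exfalso. apply H. apply injective_projections; [now symmetry | exact H1].
Qed.

(** One positive value [d] recurs, up to an error [d / 2], at arbitrarily late indices. *)
Lemma expsum_LimSup : Rbar_lt (Finite 0) (LimSup_seq (fun k => Re (expsum lambda c P k))).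
Proof.
  destruct Hne as [k0 H0]. assert (Hd := expsum_Re_pos k0 H0).
  set (d := Re (expsum lambda c P k0)) in *.
  assert (Inf : forall K, exists n, (K <= n)%nat /\ d / 2 <= Re (expsum lambda c P n)).
  { intros K. destruct (expsum_recur lambda c P (d / 2) K) as [n [Hn H]]; [lra | easy |].
    exists (k0 + n)%nat. split; [lia|]. specialize (H k0).
    assert (D1 := fst_le_Cmod (expsum lambda c P (k0 + n) - expsum lambda c P k0)).
    change (Rabs (Re (expsum lambda c P (k0 + n)) - d)
            <= Cmod (expsum lambda c P (k0 + n) - expsum lambda c P k0)) in D1.
    assert (D3 : Rabs (Re (expsum lambda c P (k0 + n)) - d) <= d / 2) by lra.
    apply Rabs_le_between in D3. lra. }
  unfold LimSup_seq. destruct (ex_LimSup_seq _) as [[l| |] HL]; simpl in *; [|easy|].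
  - destruct (Rlt_dec 0 l) as [|Hn]; [easy|]. exfalso.
    destruct (HL (mkposreal (d / 2) ltac:(lra))) as [_ [N HN]]. simpl in HN.
    destruct (Inf N) as [n [Hn1 Hn2]]. specialize (HN n Hn1). lra.
  - destruct (HL 0) as [N HN]. destruct (Inf N) as [n [Hn1 Hn2]]. specialize (HN n Hn1). lra.
Qed.

(** A zero at [k] makes [t] tend to 0 along [k + n * N]. For fixed [i],
    [t (l + i) <= t l * sigma ^ i] carries this to the class of [k + i], so [expsum] vanishes at
    every [k + i] and, by periodicity, everywhere. *)
Lemma expsum_pos_periodic (N : nat) (sigma : R) : (1 <= N)%nat -> 0 < sigma ->
  (forall k, expsum lambda c P (k + N) = expsum lambda c P k) ->
  (exists K, forall k, (K <= k)%nat -> t (S k) <= t k * sigma) ->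
  forall k, 0 < Re (expsum lambda c P k).
Proof.
  intros HN Hs Hper [K HK] k. apply expsum_Re_pos. intros Hz.
  assert (Hper' : forall n k, expsum lambda c P (k + n * N) = expsum lambda c P k).
  { induction n as [|n IH]; intros k'; [f_equal; lia|].
    replace (k' + S n * N)%nat with (k' + n * N + N)%nat by lia. now rewrite Hper. }
  assert (Hi : forall i l, (K <= l)%nat -> t (l + i)%nat <= t l * sigma ^ i).
  { induction i as [|i IH]; intros l Hll; [rewrite Nat.add_0_r; simpl; lra|].
    rewrite Nat.add_succ_r. specialize (HK (l + i)%nat ltac:(lia)). specialize (IH l Hll).
    simpl. assert (t (l + i)%nat * sigma <= t l * sigma ^ i * sigma) by (apply Rmult_le_compat_r; lra). lra. }
  assert (Z : forall i, expsum lambda c P (k + i) = 0).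
  { intros i. apply Cmod_minus_small_eq. intros eps He.
    replace (expsum lambda c P (k + i) - 0)%C with (expsum lambda c P (k + i)) by ring.
    assert (Hsi : 0 < sigma ^ i) by now apply pow_lt.
    destruct (Hlim (eps / (sigma ^ i + 1))) as [K' HK']; [apply Rdiv_lt_0_compat; lra|].
    set (e := eps / (sigma ^ i + 1)) in *.
    assert (Ee : e * (sigma ^ i + 1) = eps) by (unfold e; field; lra).
    (* An index congruent to [k] modulo [N], late enough for both the monotonicity and the
       approximation. *)
    set (l := (k + (K + K') * N)%nat).
    assert (Hl' : (K + K' <= l)%nat) by (unfold l; nia).
    assert (A := HK' l ltac:(lia)). assert (A' := HK' (l + i)%nat ltac:(lia)).
    unfold l in A at 2. rewrite Hper', Hz in A.
    replace (RtoC (t l) - 0)%C with (RtoC (t l)) in A by ring.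
    rewrite Cmod_RtoC_nonneg in A by apply Ht.
    assert (El : expsum lambda c P (l + i) = expsum lambda c P (k + i)).
    { unfold l. replace (k + (K + K') * N + i)%nat with (k + i + (K + K') * N)%nat by lia. apply Hper'. }
    rewrite El in A'.
    replace (expsum lambda c P (k + i))
      with (RtoC (t (l + i)%nat) - (RtoC (t (l + i)%nat) - expsum lambda c P (k + i)))%C by ring.
    eapply Rle_trans; [apply Cmod_triangle_minus|]. rewrite Cmod_RtoC_nonneg by apply Ht.
    specialize (Hi i l ltac:(lia)).
    assert (t l * sigma ^ i <= e * sigma ^ i) by (apply Rmult_le_compat_r; lra). lra. }
  destruct Hne as [k1 Hk1]. apply Hk1.
  rewrite <- (Hper' k k1). replace (k1 + k * N)%nat with (k + (k1 + k * N - k))%nat by nia. apply Z.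
Qed.

End Positivity.

(** * Growth of binomial coefficients and of normal forms *)

Lemma bin_upper (a : nat) : exists B, 0 <= B /\ forall k, (1 <= k)%nat -> bin a k <= B * INR k ^ a.
Proof.
  induction a as [|a [B [HB H]]].
  - exists 1. split; [lra|]. intros k _. rewrite bin_0_l. simpl. lra.
  - exists (B * (INR a + 2)). assert (Pa := pos_INR a). split; [nra|]. intros k Hk.
    specialize (H k Hk). assert (K1 : 1 <= INR k) by (apply (le_INR 1); lia).
    rewrite bin_succ. apply Rle_div_l; [lra|].
    assert (Bp := bin_nonneg a k).
    assert (Kp : 0 <= INR k ^ a) by (apply pow_le; lra).
    apply Rle_trans with (B * INR k ^ a * (INR k * (INR a + 2))).
    + apply Rmult_le_compat; try easy; nra.
    + simpl. replace (B * (INR a + 2) * (INR k * INR k ^ a) * (INR a + 1))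
        with (B * INR k ^ a * (INR k * (INR a + 2)) * (INR a + 1)) by ring.
      assert (0 <= B * INR k ^ a * (INR k * (INR a + 2))).
      { apply Rmult_le_pos; [now apply Rmult_le_pos|]. nra. }
      nra.
Qed.

Lemma bin_lower (a k : nat) : INR k ^ a / INR (fact a) <= bin a k.
Proof.
  induction a as [|a IH].
  - rewrite bin_0_l. simpl. lra.
  - rewrite bin_succ, fact_simpl, mult_INR, S_INR. assert (Pa := pos_INR a). assert (Pk := pos_INR k).
    assert (F := lt_0_INR _ (lt_O_fact a)).
    replace (INR k ^ S a / ((INR a + 1) * INR (fact a)))
      with (INR k ^ a / INR (fact a) * INR k / (INR a + 1)) by (simpl; field; lra).
    unfold Rdiv at 1 3. apply Rmult_le_compat_r; [apply Rlt_le, Rinv_0_lt_compat; lra|].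
    apply Rmult_le_compat; [|lra|exact IH|lra].
    apply Rdiv_le_0_compat; [apply pow_le; lra | easy].
Qed.

(** The error is one power of [k] below the leading term, which is the size that (a) allows; this
    yields its second form from the first. *)
Lemma bin_asymptotic (n : nat) : exists B, 0 <= B /\ forall k, (1 <= k)%nat ->
  Rabs (bin (S n) k - INR k ^ S n / INR (fact (S n))) <= B * INR k ^ n.
Proof.
  induction n as [|n [B [HB H]]].
  - exists 1. split; [lra|]. intros k _. rewrite bin_succ, bin_0_l. simpl.
    replace (_ - _) with 1 by field. rewrite Rabs_R1. lra.
  - exists (2 * B + 1). split; [lra|]. intros k Hk. specialize (H k Hk).
    assert (K1 : 1 <= INR k) by (apply (le_INR 1); lia). assert (Pn := pos_INR n).
    assert (F := lt_0_INR _ (lt_O_fact (S n))).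
    assert (F1 : 1 <= INR (fact (S n))) by (apply (le_INR 1), (lt_O_fact (S n))).
    rewrite bin_succ, (fact_simpl (S n)), mult_INR, (S_INR (S n)).
    set (N := INR (S n)) in *. assert (HN : 1 <= N) by (unfold N; rewrite S_INR; lra).
    set (b := bin (S n) k) in *. set (Fa := INR (fact (S n))) in *.
    replace (b * (INR k + N + 1) / (N + 1) - INR k ^ S (S n) / ((N + 1) * Fa))
      with ((b - INR k ^ S n / Fa) * (INR k / (N + 1) + 1) + INR k ^ S n / Fa)
      by (simpl; field; lra).
    assert (Kp : 0 < INR k ^ n) by (apply pow_lt; lra).
    eapply Rle_trans; [apply Rabs_triang|]. rewrite Rabs_mult.
    assert (Q : 0 <= INR k / (N + 1) <= INR k).
    { split; [apply Rdiv_le_0_compat; lra|]. apply Rle_div_l; nra. }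
    rewrite (Rabs_pos_eq (INR k / (N + 1) + 1)) by lra.
    rewrite (Rabs_pos_eq (INR k ^ S n / Fa)) by (apply Rdiv_le_0_compat; [apply pow_le|]; lra).
    replace ((2 * B + 1) * INR k ^ S n) with (B * INR k ^ n * (2 * INR k) + INR k ^ S n) by (simpl; ring).
    apply Rplus_le_compat.
    + apply Rmult_le_compat; [apply Rabs_pos | lra | easy | lra].
    + apply Rle_div_l; [easy|]. assert (0 < INR k ^ S n) by (apply pow_lt; lra). nra.
Qed.

Lemma bin_ge_1 (a k : nat) : 1 <= bin a k.
Proof.
  induction a as [|a IH]; [rewrite bin_0_l; lra|]. rewrite bin_succ.
  assert (Q := pos_INR a). assert (Q' := pos_INR k). apply Rle_div_r; nra.
Qed.

Lemma bin_mono (a k : nat) : bin a k <= bin a (S k).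
Proof.
  induction a as [|a IH]; [rewrite !bin_0_l; lra|].
  rewrite bin_pascal. assert (A := bin_nonneg a (S k)). lra.
Qed.

Lemma Csum_bound_exists (h : nat -> nat -> C) (w : nat -> R) (D : nat) :
  (forall a, (a < D)%nat -> exists B, 0 <= B /\ forall k, (1 <= k)%nat -> Cmod (h a k) <= B * w k) ->
  exists B, 0 <= B /\ forall k, (1 <= k)%nat -> Cmod (Csum_lt (fun a => h a k) D) <= B * w k.
Proof.
  induction D as [|D IH]; intros H.
  - exists 0. split; [lra|]. intros k _. simpl. rewrite Cmod_0. lra.
  - destruct IH as [B [HB HB']]; [intros; apply H; lia|].
    destruct (H D) as [B2 [HB2 HB2']]; [lia|].
    exists (B + B2). split; [lra|]. intros k Hk. simpl.
    eapply Rle_trans; [apply Cmod_triangle|]. specialize (HB' k Hk). specialize (HB2' k Hk). lra.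
Qed.

Lemma lsum_bound_exists (qs : list C) (h : C -> nat -> C) (w : nat -> R) :
  (forall q, In q qs -> exists B, 0 <= B /\ forall k, (1 <= k)%nat -> Cmod (h q k) <= B * w k) ->
  exists B, 0 <= B /\ forall k, (1 <= k)%nat -> Cmod (lsum qs (fun q => h q k)) <= B * w k.
Proof.
  induction qs as [|q qs IH]; intros H.
  - exists 0. split; [lra|]. intros k _. simpl. rewrite Cmod_0. lra.
  - destruct IH as [B [HB HB']]; [intros; apply H; now right|].
    destruct (H q) as [B2 [HB2 HB2']]; [now left|].
    exists (B + B2). split; [lra|]. intros k Hk. simpl.
    eapply Rle_trans; [apply Cmod_triangle|]. specialize (HB' k Hk). specialize (HB2' k Hk). lra.
Qed.

(** From [k = 1] on, [INR k ^ n] dominates all lower powers; at [k = 0] it vanishes for positive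
    [n]. *)
Lemma nform_bound (qs : list C) (sigma : R) (beta : C -> nat -> C) (n : nat) : 0 < sigma ->
  (forall q, In q qs -> Cmod q = sigma) ->
  exists B, 0 <= B /\ forall k, (1 <= k)%nat -> Cmod (nform qs beta (S n) k) <= B * (INR k ^ n / sigma ^ k).
Proof.
  intros Hs Hqs. unfold nform.
  apply (lsum_bound_exists qs (fun q k => Csum_lt (fun a => beta q a * gen q a k)%C (S n))).
  intros q Hq. apply (Csum_bound_exists (fun a k => beta q a * gen q a k)%C). intros a Ha.
  destruct (bin_upper a) as [B [HB H]]. exists (Cmod (beta q a) * B).
  assert (Pb := Cmod_ge_0 (beta q a)). split; [now apply Rmult_le_pos|]. intros k Hk.
  assert (K1 : 1 <= INR k) by (apply (le_INR 1); lia).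
  unfold gen. assert (Eq := Hqs q Hq). assert (Hq0 : q <> 0) by (apply Cmod_pos_neq_0; lra).
  rewrite !Cmod_mult, Cmod_pow, Cmod_inv, Eq, pow_inv by easy.
  rewrite Cmod_RtoC_nonneg by apply bin_nonneg.
  rewrite Rmult_assoc. apply Rmult_le_compat_l; [easy|].
  unfold Rdiv. rewrite <- Rmult_assoc.
  apply Rmult_le_compat_r; [apply Rlt_le, Rinv_0_lt_compat, pow_lt; lra|].
  eapply Rle_trans; [now apply H|]. apply Rmult_le_compat_l; [easy|].
  apply Rle_pow; [easy|lia].
Qed.

(** Passes from all the points of [qs], among which may be removable singularities and poles of
    lower order, to the dominant poles [s j]. *)
Lemma lsum_Csum_support (qs : list C) (s : nat -> C) (P : nat) (g : C -> C) : NoDup qs ->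
  (forall i j, (i < P)%nat -> (j < P)%nat -> s i = s j -> i = j) ->
  (forall j, (j < P)%nat -> In (s j) qs) ->
  (forall q, In q qs -> (forall j, (j < P)%nat -> q <> s j) -> g q = 0) ->
  lsum qs g = Csum_lt (fun j => g (s j)) P.
Proof.
  intros Hnd. revert g. induction P as [|P IH]; intros g Hinj Hin Hg.
  - simpl. apply lsum_0. intros q Hq. apply Hg; [easy|]. intros; lia.
  - simpl.
    rewrite (lsum_ext _ _ (fun q => (if Ceq_dec q (s P) then RtoC 0 else g q)
                                  + (if Ceq_dec q (s P) then g q else RtoC 0))%C).
    2:{ intros q _. destruct (Ceq_dec q (s P)); ring. }
    rewrite lsum_plus. f_equal.
    + rewrite IH.
      * apply Csum_ext. intros j Hj. destruct (Ceq_dec (s j) (s P)) as [E|]; [|easy].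
        apply Hinj in E; lia.
      * intros; apply Hinj; try lia; easy.
      * intros; apply Hin; lia.
      * intros q Hq H. destruct (Ceq_dec q (s P)) as [|Hn]; [easy|].
        apply Hg; [easy|]. intros j Hj. destruct (Nat.eq_dec j P) as [->|]; [easy|]. apply H. lia.
    + rewrite (lsum_single qs (s P) _ Hnd).
      * now destruct (Ceq_dec (s P) (s P)).
      * apply Hin. lia.
      * intros q _ Hn. now destruct (Ceq_dec q (s P)).
Qed.

(** * Expansion of the coefficients and proof of the theorem *)

Lemma is_pseries_cser (x : nat -> R) (z l : C) :
  @is_pseries C_AbsRing C_NormedModule (fun k => RtoC (x k)) z l ->
  cser (fun k => RtoC (x k) * Cpow z k)%C l.
Proof.
  intros H. apply is_series_cser in H. revert H. apply cser_ext. intros k.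
  assert (E : @pow_n C_Ring z k = Cpow z k).
  { induction k as [|k IH]; [easy|]. simpl. now rewrite <- IH. }
  change (Cmult (@pow_n C_Ring z k) (RtoC (x k)) = (RtoC (x k) * Cpow z k)%C).
  rewrite E. ring.
Qed.

Lemma nonneg_series_dominated (x : nat -> R) (z l l' : C) : (forall k, 0 <= x k) ->
  cser (fun k => RtoC (x k) * Cpow z k)%C l ->
  cser (fun k => RtoC (x k) * Cpow (RtoC (Cmod z)) k)%C l' -> Cmod l <= Cmod l'.
Proof.
  intros Hx H H'. apply Rle_plus_epsilon. intros eps He.
  destruct (H (eps / 2)) as [N HN]; [lra|]. destruct (H' (eps / 2)) as [N' HN']; [lra|].
  specialize (HN (N + N')%nat ltac:(lia)). specialize (HN' (N + N')%nat ltac:(lia)).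
  assert (B : forall n, exists r, 0 <= r /\ Csum_lt (fun k => RtoC (x k) * Cpow (RtoC (Cmod z)) k)%C n = RtoC r
     /\ Cmod (Csum_lt (fun k => RtoC (x k) * Cpow z k)%C n) <= r).
  { induction n as [|n [r [Hr [E IH]]]].
    - exists 0. simpl. rewrite Cmod_0. repeat split; lra.
    - exists (r + x n * Cmod z ^ n).
      assert (Ppos : 0 <= x n * Cmod z ^ n) by (apply Rmult_le_pos; [easy | apply pow_le, Cmod_ge_0]).
      split; [lra|]. split.
      + simpl. rewrite E, RtoC_plus, RtoC_mult. f_equal. f_equal.
        clear. induction n as [|n IH]; simpl; [easy|]. now rewrite IH, RtoC_mult.
      + simpl. eapply Rle_trans; [apply Cmod_triangle|].
        rewrite Cmod_mult, Cmod_pow, Cmod_RtoC_nonneg by easy. lra. }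
  destruct (B (N + N')%nat) as [r [Hr [E Hle]]]. rewrite E in HN'.
  set (V := Csum_lt _ _) in *.
  assert (T1 := Cmod_triangle_inv l V). rewrite Cmod_minus_sym in T1.
  assert (T2 := Cmod_triangle_inv (RtoC r) l'). rewrite Cmod_RtoC_nonneg in T2 by easy. lra.
Qed.

Lemma expansion (x : nat -> R) (sigma : R) (U : C -> Prop) (f : C -> C) (m : nat) (b : C) :
  (forall k, 0 <= x k) -> 0 < sigma ->
  (forall z, Cmod z < sigma -> cser (fun k => RtoC (x k) * Cpow z k)%C (f z)) ->
  meromorphic_on U f -> (forall z, Cmod z <= sigma -> U z) ->
  rlim (rad f m (RtoC sigma)) b ->
  exists (rho M : R) (qs : list C) (beta : C -> nat -> C),
    sigma < rho /\ NoDup qs /\ (forall q, In q qs -> Cmod q = sigma) /\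
    forall k, Cmod (RtoC (x k) - nform qs beta m k) <= M * / rho ^ k.
Proof.
  intros Hx Hs Hf Hm HU Hb.
  destruct (clear_poles U f sigma Hs Hm HU) as [ps [F [r0 [r1 [Hr0 [Hr1 [Hps [HF EF]]]]]]]].
  set (X := fun k => RtoC (x k)).
  destruct (coef_bound F (mul_roots ps X) r0 sigma r1 ((sigma + r1) / 2)) as [M0 [_ HM0]]; [lra | lra | easy | |].
  { intros w Hw. rewrite EF by easy. apply cser_mul_roots. now apply Hf. }
  set (rho := (sigma + r1) / 2) in *. assert (Hrho : 0 < sigma < rho) by (unfold rho; lra).
  set (qs := nodup Ceq_dec ps).
  assert (Hqs : forall q, In q qs -> Cmod q = sigma) by (intros q Hq; apply Hps; now apply nodup_In in Hq).
  assert (Hnd : NoDup qs) by apply NoDup_nodup.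
  assert (HX : expo qs rho X).
  { apply (expo_div_roots qs ps sigma rho X Hrho Hqs).
    - intros q Hq. now apply nodup_In.
    - now apply expo_err with M0. }
  destruct (expo_nform qs rho X ltac:(lra) Hnd HX) as [beta [D [M [HD HE]]]].
  exists rho, M, qs, beta. split; [easy|]. split; [easy|]. split; [easy|].
  (* Nonnegativity gives [|f (t q)| <= f (t sigma)], so no pole on the circle
     has order above [m]: lower the bound on the orders one at a time. *)
  assert (Main : forall n, (forall q a, In q qs -> (m + n <= a)%nat -> beta q a = 0) ->
     (forall k, Cmod (X k - nform qs beta (m + n) k) <= M * / rho ^ k) ->
     forall k, Cmod (X k - nform qs beta m k) <= M * / rho ^ k).
  { induction n as [|n IH]; intros Hz Hn.
    - now rewrite Nat.add_0_r in Hn.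
    - assert (Hz' : forall q a, In q qs -> (m + n <= a)%nat -> beta q a = 0).
      { intros q a Hq Ha. destruct (Nat.eq_dec a (m + n)) as [->|Hne]; [|apply Hz; [easy|lia]].
        assert (R1 := radial_limit qs sigma rho beta (m + S n) M X f q Hrho Hnd Hqs Hn Hf (Hqs q Hq) ltac:(lia)).
        destruct (in_dec Ceq_dec q qs); [|easy].
        replace (m + S n - 1)%nat with (m + n)%nat in R1 by lia.
        apply (rlim_unique _ _ _ R1).
        assert (R2 := rad_shift f (RtoC sigma) b m (m + S n) ltac:(lia) Hb).
        intros eps He. destruct (R2 eps He) as [d [Hd A]].
        (* The cap 1 keeps [t] positive, so that [t * q] has modulus [t * sigma]. *)
        exists (Rmin d 1). split; [apply Rmin_pos; lra|]. intros t Ht.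
        assert (T1 := Rmin_l d 1). assert (T2 := Rmin_r d 1).
        specialize (A t ltac:(lra)).
        replace (rad f (m + S n) (RtoC sigma) t - 0)%C with (rad f (m + S n) (RtoC sigma) t) in A by ring.
        replace (rad f (m + S n) q t - 0)%C with (rad f (m + S n) q t) by ring.
        eapply Rle_lt_trans; [|exact A]. unfold rad. rewrite !Cmod_mult.
        apply Rmult_le_compat_l; [apply Cmod_ge_0|].
        assert (C1 : Cmod (RtoC t * q) = t * sigma).
        { rewrite Cmod_mult, (Hqs q Hq), Cmod_RtoC_nonneg by lra. easy. }
        assert (C2 : Cmod (RtoC t * RtoC sigma) < sigma).
        { rewrite <- RtoC_mult, Cmod_RtoC_nonneg; nra. }
        apply (nonneg_series_dominated x (RtoC t * q)%C); [easy | |].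
        - apply Hf. rewrite C1. nra.
        - rewrite C1, RtoC_mult. now apply Hf. }
      apply IH; [easy|]. intros k. rewrite <- (nform_extend qs beta (m + n) (m + S n)) by (try easy; lia).
      apply Hn. }
  (* The descent starts at [m + D], which bounds the orders whether or not [D] exceeds [m]. *)
  apply (Main D).
  - intros q a Hq Ha. apply HD; [easy|lia].
  - intros k. rewrite (nform_extend qs beta D (m + D)) by (try easy; lia). apply HE.
Qed.

Lemma expi_eq_1 (x : R) : 0 <= x < 2 * PI -> expi x = 1 -> x = 0.
Proof.
  intros Hx H. destruct (Rle_dec x PI) as [Hle|Hgt].
  - apply expi_eq_1_small; [lra|easy].
  - assert (E : x - 2 * PI = 0).
    { apply expi_eq_1_small; [lra|]. rewrite <- expi_period.
      now replace (x - 2 * PI + 2 * PI) with x by ring. }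
    lra.
Qed.

Lemma expi_0 : expi 0 = 1.
Proof. unfold expi. now rewrite cos_0, sin_0. Qed.

Lemma expi_pow (t : R) (n : nat) : Cpow (expi t) n = expi (INR n * t).
Proof.
  induction n as [|n IH].
  - simpl. now rewrite Rmult_0_l, expi_0.
  - rewrite S_INR, Cpow_S, IH, <- expi_plus. f_equal. ring.
Qed.

Lemma expi_2PI_Z (z : Z) : expi (2 * (IZR z * PI)) = 1.
Proof.
  assert (S : sin (IZR z * PI) = 0) by (apply sin_eq_0_1; now exists z).
  unfold expi. rewrite cos_2a_sin, sin_2a, S. unfold RtoC. f_equal; ring.
Qed.

Lemma rational_angle_period (t : R) (p q : Z) : q <> 0%Z -> t / PI = IZR p / IZR q ->
  exists n, (1 <= n)%nat /\ Cpow (expi t) n = 1.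
Proof.
  intros Hq E. assert (P := PI_RGT_0).
  (* Multiplying the angle [p * PI / q] by [2 * |q|] gives [2 * p * PI] up to sign. *)
  exists (2 * Z.abs_nat q)%nat. split; [lia|].
  assert (Hq' : IZR q <> 0) by now apply not_0_IZR.
  assert (Et : t = IZR p / IZR q * PI) by (rewrite <- E; field; lra).
  rewrite expi_pow, mult_INR, (INR_IZR_INZ (Z.abs_nat q)), Zabs2Nat.id_abs. simpl (INR 2).
  destruct (Z.abs_spec q) as [[_ ->]|[_ ->]].
  - rewrite <- (expi_2PI_Z p). f_equal. rewrite Et. field. easy.
  - rewrite <- (expi_2PI_Z (- p)). f_equal. rewrite Et, !opp_IZR. field. easy.
Qed.

Lemma common_period (w : nat -> C) (P : nat) :
  (forall j, (j < P)%nat -> exists n, (1 <= n)%nat /\ Cpow (w j) n = 1) ->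
  exists N, (1 <= N)%nat /\ forall j, (j < P)%nat -> Cpow (w j) N = 1.
Proof.
  induction P as [|P IH]; intros H.
  - exists 1%nat. split; [lia|]. intros; lia.
  - destruct IH as [N [HN HN']]; [intros; apply H; lia|].
    destruct (H P) as [n [Hn Hn']]; [lia|].
    exists (N * n)%nat. split; [nia|]. intros j Hj.
    destruct (Nat.eq_dec j P) as [->|Hne].
    + rewrite Nat.mul_comm, Cpow_mult_r, Hn'. apply Cpow_1_l.
    + rewrite Cpow_mult_r, HN' by lia. apply Cpow_1_l.
Qed.

Lemma filterlim_rad (f : C -> C) (m : nat) (q l : C) : q <> 0 ->
  filterlim (fun z => Cmult (Cpow (Cminus (RtoC 1) (Cdiv z q)) m) (f z)) (locally' q) (locally l) ->
  rlim (rad f m q) l.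
Proof.
  intros Hq H eps He. assert (Hp : 0 < Cmod q) by now apply Cmod_gt_0.
  destruct (proj1 (filterlim_locally _ _) H (mkposreal (eps / 2) ltac:(lra))) as [d Hd].
  exists (Rmin 1 (d / Cmod q)). split.
  { apply Rmin_pos; [lra|]. apply Rdiv_lt_0_compat; [apply cond_pos | easy]. }
  intros t Ht. assert (T1 := Rmin_l 1 (d / Cmod q)). assert (T2 := Rmin_r 1 (d / Cmod q)).
  assert (E : (RtoC t * q - q)%C = (- q * RtoC (1 - t))%C) by (rewrite RtoC_minus; ring).
  assert (Em : Cmod (RtoC t * q - q) = Cmod q * (1 - t)).
  { rewrite E, Cmod_mult, Cmod_opp, Cmod_RtoC_nonneg; lra. }
  assert (B := Hd (RtoC t * q)%C).
  assert (Hn : (RtoC t * q)%C <> q).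
  { intros Eq. rewrite Eq, Cmod_self_minus in Em. nra. }
  specialize (B ltac:(apply ball_C_of_Cmod; rewrite Em, Rmult_comm; apply Rlt_div_r; lra) Hn).
  apply Cmod_of_ball_C in B. simpl in B.
  replace (eps) with (2 * (eps / 2)) by field. eapply Rle_lt_trans; [|exact B].
  apply Req_le. unfold rad. do 4 f_equal. field. easy.
Qed.

Theorem theoremA1
  (x : nat -> R) (sigma : R) (U : C -> Prop) (f : C -> C)
  (m P : nat) (s : nat -> C) (theta : nat -> R) (c : nat -> C) :
  (forall k, 0 <= x k) ->
  (forall N, exists k, (N <= k)%nat /\ 0 < x k) ->
  0 < sigma ->
  conv_radius x = Finite sigma ->
  (* f is the generating function inside the disc of convergence *)
  (forall z, Cmod z < sigma ->
     @is_pseries C_AbsRing C_NormedModule (fun k => RtoC (x k)) z (f z)) ->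
  (* f meromorphic on an open set containing the closed disc *)
  meromorphic_on U f ->
  (forall z, Cmod z <= sigma -> U z) ->
  (* z = sigma is a pole of order m >= 1 *)
  (1 <= m)%nat ->
  is_pole_of_order f (RtoC sigma) m ->
  (* exactly P >= 1 dominant poles s_j = sigma e^{i theta_j} *)
  (1 <= P)%nat ->
  theta 0%nat = 0 ->
  (forall j, (S j < P)%nat -> theta j < theta (S j)) ->
  (forall j, (j < P)%nat -> theta j < 2 * PI) ->
  (forall j, (j < P)%nat -> s j = Cmult (RtoC sigma) (expi (theta j))) ->
  (forall j, (j < P)%nat -> is_pole_of_order f (s j) m) ->
  (forall z, Cmod z = sigma -> is_pole_of_order f z m ->
     exists j, (j < P)%nat /\ z = s j) ->
  (* c_j = lim_{z -> s_j} (1 - z/s_j)^m f(z) *)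
  (forall j, (j < P)%nat ->
     filterlim (fun z => Cmult (Cpow (Cminus (RtoC 1) (Cdiv z (s j))) m) (f z))
               (locally' (s j)) (locally (c j))) ->
  let xi := fun k : nat =>
    Csum_lt (fun j => Cmult (Cpow (Cdiv (RtoC sigma) (s j)) k) (c j)) P in
  (* (a) *)
  (exists eps1, 0 < eps1 /\ forall eps0, 0 < eps0 < eps1 ->
     bigO_seq (fun k => Cmod (Cminus (RtoC (x k))
                 (Cmult (RtoC (Binomial.C (k + m - 1) (m - 1) / sigma ^ k)) (xi k))))
              (a_seq sigma eps0 m) /\
     bigO_seq (fun k => Cmod (Cminus (RtoC (x k))
                 (Cmult (RtoC (INR k ^ (m - 1) / INR (fact (m - 1)) / sigma ^ k)) (xi k))))
              (a_seq sigma eps0 m)) /\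
  (* (b) *)
  Rbar_lt (Finite 0) (LimSup_seq (fun k => Re (xi k))) /\
  (* (c) *)
  (forall k, Im (xi k) = 0 /\ 0 <= Re (xi k)) /\
  (* (d) *)
  ((exists K, forall k, (K <= k)%nat -> x (S k) <= x k) ->
   (forall j, (j < P)%nat -> exists (p q : Z), q <> 0%Z /\ theta j / PI = IZR p / IZR q) ->
   forall k, Im (xi k) = 0 /\ 0 < Re (xi k)).
Proof.
  intros Hx _ Hs _ Hser Hmer HU Hm Hpole _ Hth0 Hthi Hthl Hsj Hpolej Hdom Hc xi.
  assert (Hf : forall z, Cmod z < sigma -> cser (fun k => RtoC (x k) * Cpow z k)%C (f z)).
  { intros z Hz. now apply is_pseries_cser, Hser. }
  assert (Hths : forall n i, (i + S n < P)%nat -> theta i < theta (i + S n)%nat).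
  { induction n as [|n IH]; intros i Hi.
    - replace (i + 1)%nat with (S i) in * by lia. now apply Hthi.
    - apply Rlt_trans with (theta (i + S n)%nat); [apply IH; lia|].
      replace (i + S (S n))%nat with (S (i + S n)) in * by lia. now apply Hthi. }
  assert (Hthp : forall j, (j < P)%nat -> 0 <= theta j).
  { intros [|j] Hj; [lra|]. specialize (Hths j O Hj). simpl in Hths. lra. }
  assert (Hsm : forall j, (j < P)%nat -> Cmod (s j) = sigma).
  { intros j Hj. rewrite Hsj by easy. apply Cmod_circ. lra. }
  assert (Hs0 : forall j, (j < P)%nat -> s j <> 0).
  { intros j Hj. apply Cmod_pos_neq_0. rewrite Hsm by easy. easy. }
  assert (HsR : RtoC sigma <> 0) by (intros E; apply RtoC_inj in E; lra).
  assert (Hlt : forall i j, (i < j < P)%nat -> s i <> s j).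
  { intros i j Hij E. rewrite !Hsj in E by lia.
    assert (A := Hths (j - i - 1)%nat i ltac:(lia)).
    replace (i + S (j - i - 1))%nat with j in A by lia.
    assert (B1 := Hthp i ltac:(lia)). assert (B2 := Hthl j ltac:(lia)).
    assert (Z : theta j - theta i = 0).
    { apply expi_eq_1; [lra|].
      assert (Hn := expi_neq_0 (theta i)).
      replace (expi (theta j - theta i))
        with (RtoC sigma * (expi (theta j - theta i) * expi (theta i)) / (RtoC sigma * expi (theta i)))%C
        by (field; now split).
      rewrite <- expi_plus. replace (theta j - theta i + theta i) with (theta j) by ring.
      rewrite <- E. field. now split. }
    lra. }
  assert (Hinj : forall i j, (i < P)%nat -> (j < P)%nat -> s i = s j -> i = j).
  { intros i j Hi Hj E. destruct (Nat.lt_trichotomy i j) as [H|[H|H]]; [|easy|].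
    - exfalso. now apply (Hlt i j).
    - exfalso. now apply (Hlt j i). }
  destruct (pole_radial f (RtoC sigma) m HsR Hpole) as [b [Hb Hblim]].
  destruct (expansion x sigma U f m b Hx Hs Hf Hmer HU Hblim) as [rho [M [qs [beta [Hrho [Hnd [Hqs Hexp]]]]]]].
  destruct m as [|n]; [lia|].
  (* The radial limit of order [m] sees exactly the top row of [beta]; by uniqueness of limits it
     identifies that row at the [s j] and shows it to be 0 elsewhere. *)
  assert (Hrad : forall q, Cmod q = sigma ->
     rlim (rad f (S n) q) (if in_dec Ceq_dec q qs then beta q n else 0)).
  { intros q Hq.
    assert (R1 := radial_limit qs sigma rho beta (S n) M (fun k => RtoC (x k)) f q
              ltac:(lra) Hnd Hqs Hexp Hf Hq ltac:(lia)).
    now replace (S n - 1)%nat with n in R1 by lia. }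
  assert (Hcj : forall j, (j < P)%nat -> In (s j) qs /\ beta (s j) n = c j).
  { intros j Hj. assert (R1 := Hrad (s j) (Hsm j Hj)).
    assert (R2 := filterlim_rad f (S n) (s j) (c j) (Hs0 j Hj) (Hc j Hj)).
    destruct (pole_radial f (s j) (S n) (Hs0 j Hj) (Hpolej j Hj)) as [bj [Hbj R3]].
    (* A pole of order [m] has a nonzero radial limit, so [s j] is among the cleared points. *)
    destruct (in_dec Ceq_dec (s j) qs) as [Hi|Hni].
    - split; [easy|]. exact (rlim_unique _ _ _ R1 R2).
    - exfalso. apply Hbj. exact (rlim_unique _ _ _ R3 R1). }
  (* A nonzero top coefficient would make [q] a dominant pole, and these are exhausted by the
     [s j]. *)
  assert (Hother : forall q, In q qs -> (forall j, (j < P)%nat -> q <> s j) -> beta q n = 0).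
  { intros q Hq Hn. apply NNPP. intros Hne. assert (R1 := Hrad q (Hqs q Hq)).
    destruct (in_dec Ceq_dec q qs); [|easy].
    destruct Hmer as [_ Hmer]. destruct (Hmer q) as [r [d [g [Hr [Hg Hfg]]]]].
    { apply HU. rewrite Hqs by easy. lra. }
    destruct (Hdom q (Hqs q Hq)) as [j [Hj E]].
    - apply radial_pole with (b := beta q n) (n := d) (r := r) (g := g); try easy.
      + apply Cmod_pos_neq_0. rewrite Hqs by easy. easy.
      + intros w Hw. now apply ex_derive_cdiff, Hg.
    - now apply (Hn j Hj). }
  set (lambda := fun j => (RtoC sigma / s j)%C).
  assert (Hlam : forall j, (j < P)%nat -> Cmod (lambda j) = 1).
  { intros j Hj. unfold lambda. rewrite Cmod_div by now apply Hs0.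
    rewrite Hsm, Cmod_RtoC_nonneg by (easy || lra).
    field. lra. }
  assert (Hxi : forall k, xi k = expsum lambda c P k) by reflexivity.
  assert (Hsk : forall k, 0 < sigma ^ k) by (intros k; now apply pow_lt).
  assert (Hsplit : forall k, nform qs beta (S n) k
             = (nform qs beta n k + RtoC (bin n k / sigma ^ k) * xi k)%C).
  { intros k. unfold nform at 1. cbn [Csum_lt]. rewrite lsum_plus. fold (nform qs beta n k).
    f_equal. rewrite (lsum_Csum_support qs s P _ Hnd Hinj).
    - rewrite Hxi. unfold expsum. rewrite <- Csum_Cmult. apply Csum_ext. intros j Hj.
      destruct (Hcj j Hj) as [_ ->]. unfold gen, lambda, Cdiv.
      specialize (Hsk k). rewrite Cpow_mult_l, RtoC_div by lra.
      assert (E : RtoC (sigma ^ k) = Cpow (RtoC sigma) k).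
      { clear. induction k as [|k IH]; simpl; [easy|]. now rewrite RtoC_mult, IH. }
      rewrite E. field. now apply Cpow_nz.
    - intros j Hj. now apply Hcj.
    - intros q Hq Hn. rewrite Hother by easy. ring. }
  set (diff := fun k => Cmod (RtoC (x k) - RtoC (bin n k / sigma ^ k) * xi k)).
  assert (Hdiff : forall k, diff k <= Cmod (nform qs beta n k) + M * / rho ^ k).
  { intros k. specialize (Hexp k). rewrite Hsplit in Hexp. unfold diff.
    set (A := nform qs beta n k) in *. set (B := (RtoC (bin n k / sigma ^ k) * xi k)%C) in *.
    replace (RtoC (x k) - B)%C with (A + (RtoC (x k) - (A + B)))%C by ring.
    eapply Rle_trans; [apply Cmod_triangle|]. lra. }
  assert (HM : 0 <= M).
  { specialize (Hexp O). simpl in Hexp. match type of Hexp with Cmod ?X <= _ => assert (A := Cmod_ge_0 X) end. lra. }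
  assert (Hrs : forall k, / rho ^ k <= / sigma ^ k).
  { intros k. apply Rinv_le_contravar; [apply Hsk|]. apply pow_incr. lra. }
  (* For [m = 1] there is no lower row and the whole error is of order [rho^-k], whence the separate
     form of [a_seq] in that case. *)
  assert (Hn0 : n = O -> forall k, diff k <= M * / rho ^ k).
  { intros E k. specialize (Hdiff k). rewrite E in Hdiff.
    unfold nform in Hdiff. rewrite lsum_0, Cmod_0 in Hdiff by easy. lra. }
  assert (HnS : forall n', n = S n' -> exists B, 0 <= B /\
            forall k, (1 <= k)%nat -> diff k <= B * (INR k ^ n' / sigma ^ k)).
  { intros n' E. subst n. destruct (nform_bound qs sigma beta n' Hs Hqs) as [B [HB H]].
    exists (B + M). split; [lra|]. intros k Hk. specialize (H k Hk). specialize (Hdiff k). specialize (Hrs k).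
    assert (K1 : 1 <= INR k) by (apply (le_INR 1); lia).
    assert (K2 : 1 <= INR k ^ n') by (now apply pow_R1_Rle).
    assert (Hi : 0 < / sigma ^ k) by (apply Rinv_0_lt_compat, Hsk).
    assert (M * / rho ^ k <= M * (INR k ^ n' / sigma ^ k)).
    { apply Rmult_le_compat_l; [easy|]. unfold Rdiv. nra. }
    lra. }
  (* Boundedness of [xi] lets the binomial be replaced by [k^n / n!] at a cost of lower order. *)
  set (Xi := sum_f_R0 (fun j => Cmod (c j)) P).
  assert (HXi : forall k, Cmod (xi k) <= Xi) by (intros k; now apply expsum_bound).
  assert (HXi0 : 0 <= Xi) by (eapply Rle_trans; [apply Cmod_ge_0 | apply (HXi O)]).
  assert (Ha1 : forall eps0, 0 < eps0 < rho - sigma -> bigO_seq diff (a_seq sigma eps0 (S n))).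
  { intros eps0 He. destruct n as [|n'].
    - exists 1%nat, M. intros k _. rewrite Rabs_pos_eq by apply Cmod_ge_0.
      eapply Rle_trans; [now apply Hn0|]. simpl. apply Rmult_le_compat_l; [easy|].
      apply Rinv_le_contravar; [apply pow_lt; lra|]. apply pow_incr. lra.
    - destruct (HnS n' eq_refl) as [B [HB H]]. exists 1%nat, B. intros k Hk.
      rewrite Rabs_pos_eq by apply Cmod_ge_0. eapply Rle_trans; [now apply H|].
      simpl. rewrite Nat.sub_0_r. lra. }
  set (diff2 := fun k => Cmod (RtoC (x k) - RtoC (INR k ^ n / INR (fact n) / sigma ^ k) * xi k)).
  assert (Ha2 : forall eps0, 0 < eps0 < rho - sigma -> bigO_seq diff2 (a_seq sigma eps0 (S n))).
  { intros eps0 He. destruct n as [|n'].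
    - destruct (Ha1 eps0 He) as [K [M' H]]. exists K, M'. intros k Hk. specialize (H k Hk).
      unfold diff, diff2 in *. rewrite bin_0_l in H. simpl in *.
      now replace (1 / 1) with 1 by field.
    - destruct (HnS n' eq_refl) as [B [HB H]].
      destruct (bin_asymptotic n') as [B2 [HB2 H2]].
      exists 1%nat, (B + B2 * Xi). intros k Hk. specialize (H k Hk). specialize (H2 k Hk).
      rewrite Rabs_pos_eq by apply Cmod_ge_0.
      change (a_seq sigma eps0 (S (S n')) k) with (INR k ^ (n' - 0) / sigma ^ k).
      rewrite Nat.sub_0_r. unfold diff2, diff in *. specialize (Hsk k). specialize (HXi k).
      set (be := bin (S n') k) in *. set (w := INR k ^ S n' / INR (fact (S n'))) in *.
      replace (RtoC (x k) - RtoC (w / sigma ^ k) * xi k)%C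
        with ((RtoC (x k) - RtoC (be / sigma ^ k) * xi k) + RtoC ((be - w) / sigma ^ k) * xi k)%C.
      + eapply Rle_trans; [apply Cmod_triangle|]. rewrite Cmod_mult, Cmod_R.
        unfold Rdiv at 2. rewrite Rabs_mult, (Rabs_pos_eq (/ _)) by (apply Rlt_le, Rinv_0_lt_compat, Hsk).
        replace ((B + B2 * Xi) * (INR k ^ n' / sigma ^ k))
          with (B * (INR k ^ n' / sigma ^ k) + (B2 * INR k ^ n' * / sigma ^ k) * Xi) by (unfold Rdiv; ring).
        apply Rplus_le_compat; [easy|].
        assert (Hi : 0 < / sigma ^ k) by (apply Rinv_0_lt_compat, Hsk).
        apply Rmult_le_compat; [|apply Cmod_ge_0| |easy].
        * apply Rmult_le_pos; [apply Rabs_pos | lra].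
        * apply Rmult_le_compat_r; [lra | easy].
      +
        replace ((be - w) / sigma ^ k) with (be / sigma ^ k - w / sigma ^ k) by (field; lra).
        rewrite RtoC_minus. ring. }
  (* If [xi] vanished identically, [f] would have order below [m] at [sigma]. *)
  assert (Hne : exists k, expsum lambda c P k <> 0).
  { apply NNPP. intros Hno. apply Hb.
    (* With [xi] zero, erasing the top row leaves the normal form unchanged, and [radial_limit] then
       gives 0 at [sigma] against [b <> 0]. *)
    set (beta' := fun q a => if lt_dec a n then beta q a else RtoC 0).
    assert (Hb' : forall k, Cmod (RtoC (x k) - nform qs beta' (S n) k) <= M * / rho ^ k).
    { intros k. rewrite (nform_extend qs beta' n (S n)).
      - replace (nform qs beta' n k) with (nform qs beta (S n) k); [apply Hexp|].
        rewrite Hsplit. replace (xi k) with (RtoC 0).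
        + replace (nform qs beta n k + RtoC (bin n k / sigma ^ k) * 0)%C with (nform qs beta n k) by ring.
          apply lsum_ext. intros q _. apply Csum_ext. intros a Ha. unfold beta'.
          destruct (lt_dec a n); [easy|lia].
        + symmetry. rewrite Hxi. apply NNPP. intros H. apply Hno. now exists k.
      - lia.
      - intros q a _ Ha. unfold beta'. destruct (lt_dec a n); [lia|easy]. }
    assert (R1 := radial_limit qs sigma rho beta' (S n) M (fun k => RtoC (x k)) f (RtoC sigma)
              ltac:(lra) Hnd Hqs Hb' Hf ltac:(apply Cmod_RtoC_nonneg; lra) ltac:(lia)).
    apply (rlim_unique _ _ _ Hblim).
    replace (S n - 1)%nat with n in R1 by lia. unfold beta' in R1.
    destruct (lt_dec n n); [lia|]. now destruct (in_dec Ceq_dec (RtoC sigma) qs). }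
  (* The binomial is at least 1 for every [k], whereas [INR k ^ n] may vanish at 0; it is also
     nondecreasing, which (d) uses. *)
  set (t := fun k => x k * sigma ^ k / bin n k).
  assert (Hb1 : forall k, 1 <= bin n k) by (intros; apply bin_ge_1).
  assert (Ht : forall k, 0 <= t k).
  { intros k. specialize (Hb1 k). specialize (Hsk k). apply Rdiv_le_0_compat; [|lra].
    apply Rmult_le_pos; [apply Hx | lra]. }
  assert (Htd : forall k, Cmod (RtoC (t k) - expsum lambda c P k) = diff k * (sigma ^ k / bin n k)).
  { intros k. specialize (Hb1 k). specialize (Hsk k). rewrite <- Hxi. unfold diff.
    rewrite <- (Cmod_RtoC_nonneg (sigma ^ k / bin n k)) by (apply Rdiv_le_0_compat; lra).
    rewrite <- Cmod_mult. f_equal.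
    replace (RtoC (t k)) with (RtoC (x k) * RtoC (sigma ^ k / bin n k))%C
      by (rewrite <- RtoC_mult; f_equal; unfold t; field; lra).
    assert (E : (RtoC (bin n k / sigma ^ k) * RtoC (sigma ^ k / bin n k))%C = 1).
    { rewrite <- RtoC_mult. f_equal. field. lra. }
    replace ((RtoC (x k) - RtoC (bin n k / sigma ^ k) * xi k) * RtoC (sigma ^ k / bin n k))%C
      with (RtoC (x k) * RtoC (sigma ^ k / bin n k)
            - (RtoC (bin n k / sigma ^ k) * RtoC (sigma ^ k / bin n k)) * xi k)%C by ring.
    rewrite E. ring. }
  (* The relative error is at most [M * (sigma / rho)^k] for a simple pole. For higher order it is
     at most [B * F / k], where the factorial [F] comes from the lower bound on the binomial. *)
  assert (Hlim : forall eps, 0 < eps -> exists K, forall k, (K <= k)%nat ->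
            Cmod (RtoC (t k) - expsum lambda c P k) < eps).
  { intros eps He. destruct n as [|n'].
    - destruct (pow_lt_eps (sigma / rho) (eps / (M + 1))) as [K HK].
      + split; [apply Rdiv_le_0_compat; lra | apply Rlt_div_l; lra].
      + apply Rdiv_lt_0_compat; lra.
      + exists K. intros k Hk. specialize (HK k Hk). specialize (Hn0 eq_refl k). rewrite Htd.
        rewrite bin_0_l. specialize (Hsk k).
        assert (Hpr : 0 < rho ^ k) by (apply pow_lt; lra).
        apply Rle_lt_trans with (M * / rho ^ k * (sigma ^ k / 1)).
        * apply Rmult_le_compat_r; [lra|easy].
        * replace (M * / rho ^ k * (sigma ^ k / 1)) with (M * (sigma / rho) ^ k)
            by (unfold Rdiv; rewrite Rpow_mult_distr, pow_inv; field; lra).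
          apply Rlt_div_r in HK; [|lra].
          assert (0 <= (sigma / rho) ^ k) by (apply pow_le, Rdiv_le_0_compat; lra). nra.
    - destruct (HnS n' eq_refl) as [B [HB H]].
      set (F := INR (fact (S n'))). assert (HF : 0 < F) by (apply lt_0_INR, lt_O_fact).
      destruct (archimed_cor1 (eps / (B * F + 1))) as [K [HK HK0]]; [apply Rdiv_lt_0_compat; nra|].
      exists K. intros k Hk. specialize (H k ltac:(lia)). specialize (Hsk k). rewrite Htd.
      assert (K1 : 0 < INR K) by (apply lt_0_INR; lia).
      assert (K2 : INR K <= INR k) by (apply le_INR; lia).
      assert (L := bin_lower (S n') k). fold F in L. specialize (Hb1 k).
      set (be := bin (S n') k) in *.
      assert (Kn : 0 < INR k ^ n') by (apply pow_lt; lra).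
      apply Rle_lt_trans with (B * (INR k ^ n' / sigma ^ k) * (sigma ^ k / be)).
      + apply Rmult_le_compat_r; [apply Rdiv_le_0_compat; lra | easy].
      + replace (B * (INR k ^ n' / sigma ^ k) * (sigma ^ k / be)) with (B * INR k ^ n' / be) by (field; lra).
        apply Rle_lt_trans with (B * F * / INR k).
        * apply Rle_div_l; [lra|].
          replace (B * INR k ^ n') with (B * F * / INR k * (INR k ^ S n' / F)) by (simpl; field; lra).
          apply Rmult_le_compat_l; [|exact L].
          apply Rmult_le_pos; [nra|]. apply Rlt_le, Rinv_0_lt_compat. lra.
        * assert (I : / INR k <= / INR K) by (apply Rinv_le_contravar; lra).
          apply Rlt_div_r in HK; [|nra].
          assert (I2 : 0 < / INR K) by now apply Rinv_0_lt_compat.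
          assert (B * F * / INR k <= B * F * / INR K) by (apply Rmult_le_compat_l; nra). nra. }
  split.
  - exists (rho - sigma). split; [lra|]. intros eps0 He.
    replace (S n - 1)%nat with n by lia. split; [|now apply Ha2].
    destruct (Ha1 eps0 He) as [K [M' H]]. exists K, M'. intros k Hk.
    replace (k + S n - 1)%nat with (k + n)%nat by lia. now apply H.
  - split; [exact (expsum_LimSup lambda c P t Hlam Ht Hlim Hne)|].
    split; [intros k; exact (expsum_nonneg lambda c P t Hlam Ht Hlim k)|].
    intros [K HK] Hrat k.
    split; [apply (expsum_nonneg lambda c P t Hlam Ht Hlim k)|].
    destruct (common_period (fun j => expi (theta j)) P) as [N [HN HN']].
    { intros j Hj. destruct (Hrat j Hj) as [p [q [Hq E]]]. now apply (rational_angle_period _ p q). }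
    apply (expsum_pos_periodic lambda c P t Hlam Ht Hlim Hne N sigma HN Hs).
    (* [lambda j] is the inverse of [expi (theta j)], so a common period of the angles is a period
       of [xi]. *)
    + intros k'. apply Csum_ext. intros j Hj. rewrite Cpow_add_r.
      replace (Cpow (lambda j) N) with (RtoC 1); [ring|].
      unfold lambda. rewrite (Hsj j Hj).
      replace (RtoC sigma / (RtoC sigma * expi (theta j)))%C with (/ expi (theta j))%C
        by (field; split; [apply expi_neq_0 | easy]).
      rewrite Cpow_inv by apply expi_neq_0. rewrite (HN' j Hj). field.
    (* Passing from [k'] to [S k'] lowers [x] and raises the binomial; only the factor [sigma] is
       left. *)
    + exists K. intros k' Hk'. specialize (HK k' Hk'). unfold t.
      assert (A := bin_mono n k'). assert (A1 := Hb1 k'). assert (A2 := Hsk k'). assert (A3 := Hx (S k')).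
      replace (x k' * sigma ^ k' / bin n k' * sigma) with (x k' * sigma ^ S k' * / bin n k') by (simpl; field; lra).
      unfold Rdiv. assert (A4 := Hsk (S k')).
      apply Rmult_le_compat.
      * apply Rmult_le_pos; lra.
      * apply Rlt_le, Rinv_0_lt_compat. lra.
      * apply Rmult_le_compat_r; lra.
      * apply Rinv_le_contravar; lra.
Qed.
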